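(* Consider the cooperative multi-agent problem and the Zeroth-order Feedback Optimization (ZFO) algorithm described in the context, in the constrained convex setting. Suppose $\sigma>0$ (noisy observations), let $x^\ast$ be a minimizer of $f$ over $\mathcal{X}$, and let $\epsilon>0$ be sufficiently small. Consider the conditions $$(\ast)\qquad u\cdot\sqrt{d+\frac{4}{9}\left[\ln\frac{20G\overline{R}^2\sqrt{n}}{u\epsilon}\right]_+}\leq\frac{\delta\underline{r}}{3},\qquad \eta\leq\frac{3u^2\epsilon}{8\sigma^2(\bar{\mathfrak{b}}+1/2)(\sqrt{d}+1)^2},\qquad T-B+1\geq\left\lceil\frac{15\overline{\mathscr{D}}}{2\eta\epsilon}\right\rceil .$$ 1. If the parameters satisfy $\delta\leq\dfrac{\epsilon}{5G\overline{R}}$ and $(\ast)$, then $\mathbb{E}[f(\bar x(T))]-f(x^\ast)\leq\epsilon$. Moreover, if all these conditions hold with equality, then $$T=\Theta\left(\frac{\bar{\mathfrak{b}}(d^2+d\ln(1/\epsilon))}{\epsilon^4}\right).$$ 2. Suppose it is known that $x^\ast\in\operatorname{int}\mathcal{X}$. If the parameters satisfy $\delta\leq\dfrac{\sqrt{\epsilon}}{\overline{R}\sqrt{2L}}$ and $(\ast)$, then $\mathbb{E}[f(\bar x(T))]-f(x^\ast)\leq\epsilon$. Moreover, if all these conditions hold with equality, then $$T=\Theta\left(\frac{\bar{\mathfrak{b}}(d^2+d\ln(1/\epsilon))}{\epsilon^3}\right).$$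
   Context: Notation: $[x]_+=\max\{0,x\}$; $\mathbb{B}_p$ is the closed Euclidean unit ball of $\mathbb{R}^p$; $\mathcal{P}_C$ is Euclidean projection onto a closed convex set $C$; $\|\cdot\|$ is the $\ell_2$ norm. Problem. There are $n$ agents; agent $i$ has an action $x^i\in\mathcal{X}_i\subseteq\mathbb{R}^{d_i}$, $d=\sum_i d_i$, $\mathcal{X}=\prod_{i=1}^n\mathcal{X}_i\subseteq\mathbb{R}^d$. Each $\mathcal{X}_i$ is closed and convex with $0\in\operatorname{int}\mathcal{X}_i$. Set $\underline{r}_i=\sup\{r>0:r\mathbb{B}_{d_i}\subseteq\mathcal{X}_i\}$ and $\underline{r}=\min_i\underline{r}_i$. Each local cost $f_i:\mathcal{X}\to\mathbb{R}$ is $G$-Lipschitz and $L$-smooth on $\mathcal{X}$ ($|f_i(x)-f_i(y)|\le G\|x-y\|$, $\|\nabla f_i(x)-\nabla f_i(y)\|\le L\|x-y\|$). The objective is $f=\frac1n\sum_{i=1}^n f_i$. Constrained convex setting: each $\mathcal{X}_i$ is moreover compact, $\overline{R}_i>0$ satisfies $\mathcal{X}_i\subseteq\overline{R}_i\mathbb{B}_{d_i}$, $\overline{R}=\sqrt{\sum_i\overline{R}_i^2}$, and $f$ is convex. ZFO algorithm. Parameters: step size $\eta>0$, smoothing radius $u>0$, shrinkage $\delta\in(0,1)$, number of iterations $T\ge B$, an initial action profile $x(0)$, and for each $i$ a continuously differentiable $1$-strongly convex function $\psi_i$; let $\psi(x)=\sum_i\psi_i(x^i)$. The Bregman divergence of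 a function $\phi$ is $\mathscr{D}_{\phi}(x|y)=\phi(x)-\phi(y)-\langle\nabla\phi(y),x-y\rangle$. For $x^i\in\operatorname{int}\mathcal{X}_i$ let $\mathcal{S}_i(x^i,u)=\frac1u(\mathcal{X}_i-x^i)\cap\left(-\frac1u(\mathcal{X}_i-x^i)\right)$. The agents are joined by a communication network, a connected undirected graph on $\{1,\ldots,n\}$; $b_{ij}$ is the graph distance between $i$ and $j$. At each time $t=0,1,2,\ldots$: (1) each agent $i$ sets $z^i(t)=\mathcal{P}_{\mathcal{S}_i(x^i(t),u)}[\tilde z^i(t)]$ with $\tilde z^i(t)\sim\mathcal{N}(0,I_{d_i})$ drawn afresh at each time and independently across agents; $z(t)=(z^1(t),\ldots,z^n(t))$; (2) agent $i$ observes $\hat f_i^{\pm}(t)=f_i(x(t)\pm uz(t))+\varepsilon_i^\pm(t)$ and computes $D_i(t)=\frac{\hat f_i^+(t)-\hat f_i^-(t)}{2u}$; the noises $\varepsilon_i^\pm(t)$ have zero mean and variance at most $\sigma^2$, and are independent of each other and of the action profile; (3) agent $i$ keeps for every $j$ a pair $(D^i_j(t),\tau^i_j(t))$, initialised as $(0,-1)$ at time $-1$. It sets $D^i_i(t)=D_i(t)$, $\tau^i_i(t)=t$; for $j\ne i$ it adopts, among the pairs concerning $j$ received at time $t$ from its neighbours (its own previous pair standing in for a neighbour from which nothing arrives), the one with the largest time stamp; it then sends all its pairs to its neighbours. Thus $D^i_j(t)=D_j(\tau^i_j(t))$, with the convention $D_j(s)=0$, $z(s)=0$ for $s<0$. It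 forms $G^i(t)=\frac1n\sum_{j=1}^n D^i_j(t)\,z^i(\tau^i_j(t))$; (4) $x^i(t+1)=\arg\min_{x^i\in(1-\delta)\mathcal{X}_i}\left\{\langle G^i(t),x^i-x^i(t)\rangle+\frac1\eta\mathscr{D}_{\psi_i}(x^i|x^i(t))\right\}$. Delays. There is $\Delta\ge0$ with $t-\tau^i_j(t)\le b_{ij}+\Delta$ for all $t\ge0$ and all $i,j$. Define $$\bar{\mathfrak{b}}=\left(\frac{\sum_{i,j=1}^n(b_{ij}+\Delta)^2d_i}{nd}\right)^{1/2},\qquad B=\max_{i,j}b_{ij}+\Delta .$$ Finally $\bar x(T)=\frac{1}{T-B+1}\sum_{t=B}^{T}x(t)$ and $\overline{\mathscr{D}}=\max_{x\in\mathcal{X}}\mathscr{D}_\psi(x^\ast|x)$.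
   Formalization: The two Θ claims for T are stated only for b̄ > 0: when n = 1 and Δ = 0 one has b̄ = 0, so T = Θ(0) would be false because T ≥ 1 for small ε. *)

(* Defs.v *)
From HB Require Import structures.
From mathcomp Require Export all_boot all_order all_algebra finmap.
From mathcomp Require Export all_classical all_reals all_analysis.

Set Implicit Arguments.
Unset Strict Implicit.
Unset Printing Implicit Defensive.

Export Order.TTheory GRing.Theory Num.Theory.
Export numFieldNormedType.Exports.

#[export] Set Implicit Arguments.
#[export] Unset Strict Implicit.
#[export] Unset Printing Implicit Defensive.

Local Open Scope classical_set_scope.
Local Open Scope ring_scope.

Section Euclidean.
Variables (R : realType) (m : nat).
Implicit Types (C : set 'rV[R]_m) (x y v : 'rV[R]_m) (h : 'rV[R]_m -> R).

Definition dot x y : R := \sum_k x 0 k * y 0 k.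

(* The norm `|x| of the library on row vectors is the sup norm; the topologies
   agree, so compact, closed and interior are taken from the library. *)
Definition norm2 x : R := Num.sqrt (dot x x).

Definition ball2 (r : R) : set 'rV[R]_m := [set y | norm2 y <= r].

Definition is_proj C y p := C p /\ forall q, C q -> norm2 (p - y) <= norm2 (q - y).

Definition is_argmin C h x := C x /\ forall y, C y -> h x <= h y.

Definition lipschitz2 C (G : R) h :=
  forall x y, C x -> C y -> `|h x - h y| <= G * norm2 (x - y).

(* Gradient of a function that is only meaningful on C: Frechet
   differentiability relative to C. It determines g when C is convex with
   nonempty interior, and coincides with the usual gradient in the interior. *)
Definition is_gradient C h x g :=
  forall e, 0 < e -> exists2 r, 0 < r &
    forall y, C y -> norm2 (y - x) < r ->
      `|h y - h x - dot g (y - x)| <= e * norm2 (y - x).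

Definition smooth_on C (L : R) h :=
  exists gh : 'rV[R]_m -> 'rV[R]_m,
    (forall x, C x -> is_gradient C h x (gh x)) /\
    (forall x y, C x -> C y -> norm2 (gh x - gh y) <= L * norm2 (x - y)).

Definition strongly_convex_on C (mu : R) h :=
  forall x y (t : R), C x -> C y -> 0 <= t <= 1 ->
    h (t *: x + (1 - t) *: y) <=
    t * h x + (1 - t) * h y - mu / 2 * (t * (1 - t)) * norm2 (x - y) ^+ 2.

Definition bregman h (gh : 'rV[R]_m -> 'rV[R]_m) x y : R :=
  h x - h y - dot (gh y) (x - y).

Definition inradius C : R := sup [set r | 0 < r /\ ball2 r `<=` C].

Definition shrink (delta : R) C : set 'rV[R]_m := [set (1 - delta) *: y | y in C].

Definition sym_set C x (u : R) : set 'rV[R]_m :=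
  [set u^-1 *: (y - x) | y in C] `&` [set - (u^-1 *: (y - x)) | y in C].

End Euclidean.

Definition is_max (R : realType) (A : set R) (a : R) := A a /\ ubound A a.

Section Graph.
Variables (n : nat) (e : rel 'I_n).

Definition connected_graph :=
  [/\ symmetric e, irreflexive e & forall i j, connect e i j].

(* Least length of a path from i to j; searching lengths below n suffices in a
   connected graph on n vertices. *)
Definition gdist (i j : 'I_n) : nat :=
  find (fun k => [exists p : k.-tuple 'I_n, path e i p && (last i p == j)])
       (iota 0 n).

Definition Bmax (Delta : nat) : nat := (\max_i \max_j gdist i j + Delta)%N.

Definition bbar (R : realType) (dim : 'I_n -> nat) (Delta : nat) : R :=
  Num.sqrt ((\sum_i \sum_j (gdist i j + Delta)%:R ^+ 2 * (dim i)%:R)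
            / (n%:R * (\sum_i dim i)%:R)).

End Graph.

Section Profiles.
Variables (R : realType) (n : nat) (dim : 'I_n -> nat).

Definition profile := 'rV[R]_(\sum_i dim i).

Definition block (x : profile) (i : 'I_n) : 'rV[R]_(dim i) := submxrow x i.

Definition prod_set (X : forall i, set 'rV[R]_(dim i)) : set profile :=
  [set x | forall i, X i (block x i)].

(* The index set is finite, and nonempty when 0 < n, so this inf is a min. *)
Definition min_inradius (X : forall i, set 'rV[R]_(dim i)) : R :=
  inf [set inradius (X i) | i in [set: 'I_n]].

Definition avg_cost (f : 'I_n -> profile -> R) (x : profile) : R :=
  n%:R^-1 * \sum_i f i x.

Definition sum_psi (psi : forall i, 'rV[R]_(dim i) -> R) (x : profile) : R :=
  \sum_i psi i (block x i).

Definition sum_gpsi (gpsi : forall i, 'rV[R]_(dim i) -> 'rV[R]_(dim i))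
  (x : profile) : profile := mxrow (fun i => gpsi i (block x i)).

Definition constrained_convex_setting (X : forall i, set 'rV[R]_(dim i))
    (Ri : 'I_n -> R) (G L : R) (f : 'I_n -> profile -> R) : Prop :=
  [/\ (0 < n)%N /\ (forall i, 0 < dim i)%N,
      forall i, [/\ closed (X i), @convex_set R 'rV[R]_(dim i) (X i),
                    interior (X i) 0 & compact (X i)],
      forall i, 0 < Ri i /\ X i `<=` ball2 (Ri i),
      forall i, lipschitz2 (prod_set X) G (f i) /\
                smooth_on (prod_set X) L (f i) &
      @convex_function R profile (prod_set X) (avg_cost f)].

(* psi i need only be defined and C^1 on X i; a C^1 function on the whole space
   is a special case. *)
Definition mirror_maps (X : forall i, set 'rV[R]_(dim i))
    (psi : forall i, 'rV[R]_(dim i) -> R)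
    (gpsi : forall i, 'rV[R]_(dim i) -> 'rV[R]_(dim i)) : Prop :=
  forall i, [/\ forall y, X i y -> is_gradient (X i) (psi i) y (gpsi i y),
                {within X i, continuous (gpsi i)} &
                strongly_convex_on (X i) 1 (psi i)].

End Profiles.

Definition mutually_independent (disp : measure_display)
    (Omega : measurableType disp) (R : realType) (P : probability Omega R)
    (I : choiceType) (Y : I -> Omega -> R) : Prop :=
  forall (J : {fset I}) (A : I -> set R), (forall i, measurable (A i)) ->
    P (\bigcap_(i in [set` J]) (Y i @^-1` A i)) =
    (\prod_(i <- J) P (Y i @^-1` A i))%E.

Section Run.
Variables (R : realType) (n : nat) (dim : 'I_n -> nat).
Variables (X : forall i, set 'rV[R]_(dim i)) (f : 'I_n -> profile R dim -> R).
Variables (edge : rel 'I_n) (Delta : nat) (sigma : R).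
Variables (psi : forall i, 'rV[R]_(dim i) -> R)
          (gpsi : forall i, 'rV[R]_(dim i) -> 'rV[R]_(dim i)).
Arguments X : clear implicits.
Arguments psi : clear implicits.
Arguments gpsi : clear implicits.
Variables (eta u delta : R) (x0 : profile R dim).
Variables (disp : measure_display) (Omega : measurableType disp)
          (P : probability Omega R).

(* gauss t i k is the k-th coordinate of the Gaussian vector drawn by agent i
   at time t; noise b t i is the error of agent i's observation at
   x(t) + u z(t) if b = true, and at x(t) - u z(t) if b = false. *)
Variables (gauss : nat -> forall i, 'I_(dim i) -> {RV P >-> R})
          (noise : bool -> nat -> 'I_n -> {RV P >-> R}).
Arguments gauss : clear implicits.

Definition sample_index : Type :=
  ((nat * {i : 'I_n & 'I_(dim i)}) + (bool * nat * 'I_n))%type.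

Definition sample (a : sample_index) : Omega -> R :=
  match a with
  | inl (t, k) => gauss t (tag k) (tagged k)
  | inr (b, t, i) => noise b t i
  end.

(* N(0, I) has independent standard normal coordinates. *)
Record sampling : Prop := Sampling {
  gaussP : forall t i k (A : set R), measurable A ->
    distribution P (gauss t i k) A = normal_prob 0 1 A;
  noise_mean : forall b t i, ('E_P[noise b t i] = 0)%E;
  noise_var : forall b t i, ('V_P[noise b t i] <= (sigma ^+ 2)%:E)%E;
  sample_indep : mutually_independent P sample }.

(* arrivals t i k lists the sending times of the messages from k that reach i at
   time t; it is empty when nothing arrives. Transmission takes at least one
   time step, but may take more and messages may get lost. The pair kept by i
   about j at time t is (Dmem t i j, tau t i j); communication does not depend
   on the samples, hence tau is not random. *)
Variables (arrivals : nat -> 'I_n -> 'I_n -> seq nat).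
Variables (x z : nat -> Omega -> profile R dim)
          (Dmem : nat -> 'I_n -> 'I_n -> Omega -> R)
          (tau : nat -> 'I_n -> 'I_n -> int).

Definition observation (b : bool) t i w : R :=
  f i (x t w + (if b then u else - u) *: z t w) + noise b t i w.

Definition diff_quotient t i w : R :=
  (observation true t i w - observation false t i w) / (2 * u).

Definition pair_at t i j w : R * int := (Dmem t i j w, tau t i j).

Definition previous_pair t i j w : R * int :=
  if t is t'.+1 then pair_at t' i j w else (0, -1).

(* p is a pair about j that i considers at time t on account of neighbour k *)
Definition candidate t i j k w (p : R * int) : Prop :=
  if arrivals t i k is [::] then p = previous_pair t i j w
  else exists2 s, s \in arrivals t i k & p = pair_at s k j w.

Definition z_at (i : 'I_n) (s : int) w : 'rV[R]_(dim i) :=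
  if s is Posz t then block (z t w) i else 0.

Definition gradient_estimate t i w : 'rV[R]_(dim i) :=
  n%:R^-1 *: \sum_j Dmem t i j w *: z_at i (tau t i j) w.

Record zfo_run : Prop := ZfoRun {
  run_meas : forall t k, measurable_fun setT (fun w => x t w 0 k) /\
                         measurable_fun setT (fun w => z t w 0 k);
  run_init : forall w, x 0%N w = x0;
  run_perturb : forall t w i,
    is_proj (sym_set (X i) (block (x t w) i) u)
            (\row_k gauss t i k w) (block (z t w) i);
  run_causal : forall t i k s, s \in arrivals t i k -> (s < t)%N;
  run_own : forall t i w, pair_at t i i w = (diff_quotient t i w, t%:Z);
  run_adopt : forall t i j w, j != i ->
    (exists2 k, edge i k & candidate t i j k w (pair_at t i j w)) /\
    (forall k p, edge i k -> candidate t i j k w p -> p.2 <= tau t i j);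
  run_delay : forall t i j, t%:Z - tau t i j <= (gdist edge i j + Delta)%:Z;
  run_step : forall t w i,
    is_argmin (shrink delta (X i))
      (fun y => dot (gradient_estimate t i w) (y - block (x t w) i)
                + eta^-1 * bregman (psi i) (gpsi i) y (block (x t w) i))
      (block (x t.+1 w) i) }.

Definition xbar (T : nat) (w : Omega) : profile R dim :=
  let B := Bmax edge Delta in
  (T - B + 1)%:R^-1 *: \sum_(B <= t < T.+1) x t w.

End Run.

Section Conditions.
Variables (R : realType) (n d B T : nat).
Variables (G Rbar rlow sigma Dbar b : R) (eps u delta eta : R).

Definition u_lhs : R :=
  u * Num.sqrt (d%:R + 4 / 9 *
        Num.max 0 (ln (20 * G * Rbar ^+ 2 * Num.sqrt n%:R / (u * eps)))).

Definition u_rhs : R := delta * rlow / 3.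

Definition eta_max : R :=
  3 * u ^+ 2 * eps / (8 * sigma ^+ 2 * (b + 1 / 2) * (Num.sqrt d%:R + 1) ^+ 2).

Definition T_min : int := Num.ceil (15 * Dbar / (2 * eta * eps)).

Definition star_le : Prop :=
  [/\ u_lhs <= u_rhs, eta <= eta_max & T_min <= (T - B + 1)%:Z].

Definition star_eq : Prop :=
  [/\ u_lhs = u_rhs, eta = eta_max & (T - B + 1)%:Z = T_min].

Definition admissible : Prop :=
  [/\ 0 < eta, 0 < u, 0 < delta < 1 & (B <= T)%N].

(* T lies between c1 and c2 times b (d^2 + d ln (1/eps)) / eps^p *)
Definition complexity (p : nat) (c1 c2 : R) : Prop :=
  let g := b * (d%:R ^+ 2 + d%:R * ln (1 / eps)) / eps ^+ p in
  c1 * g <= T%:R <= c2 * g.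

End Conditions.

(* E[f(xbar(T))] - f(xstar) <= eps for every initial profile, every communication
   pattern obeying the delay bound, and every probability space carrying the
   samples *)
Definition zfo_accuracy (R : realType) (n : nat) (dim : 'I_n -> nat)
    (X : forall i, set 'rV[R]_(dim i)) (f : 'I_n -> profile R dim -> R)
    (edge : rel 'I_n) (Delta : nat) (sigma : R)
    (psi : forall i, 'rV[R]_(dim i) -> R)
    (gpsi : forall i, 'rV[R]_(dim i) -> 'rV[R]_(dim i))
    (xstar : profile R dim) (eta u delta : R) (T : nat) (eps : R) : Prop :=
  forall (disp : measure_display) (Omega : measurableType disp)
    (P : probability Omega R)
    (gauss : nat -> forall i, 'I_(dim i) -> {RV P >-> R})
    (noise : bool -> nat -> 'I_n -> {RV P >-> R})
    (x0 : profile R dim) (arrivals : nat -> 'I_n -> 'I_n -> seq nat)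
    (x z : nat -> Omega -> profile R dim)
    (Dmem : nat -> 'I_n -> 'I_n -> Omega -> R)
    (tau : nat -> 'I_n -> 'I_n -> int),
  prod_set X x0 ->
  sampling sigma gauss noise ->
  zfo_run X f edge Delta psi gpsi eta u delta x0 gauss noise
          arrivals x z Dmem tau ->
  ('E_P[fun w => avg_cost f (xbar edge Delta x T w)] - (avg_cost f xstar)%:E
     <= eps%:E)%E.

(* Main.v *)
From HB Require Import structures.
Require Import Defs.
From mathcomp Require Import measurable_realfun.
From mathcomp Require Import ring lra zify.

(** The gap is measured against the shrunk optimum (1 - delta) xstar. Mirror descent
    telescopes pathwise, so that it suffices to bound from below the expected inner
    products of the delayed estimates D_j z^i with x^i(t) - (1 - delta) xstar^i.
    - Replacing x(t) by x(tau) costs eta times the second moment of the estimates times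
      the delay, because one mirror step has length at most eta |G^i|.
    - The observation noise averages out, being independent of z(tau) and x(tau).
    - The projection of the Gaussian vector is the identity with overwhelming
      probability; the tail is controlled by the logarithmic term in the condition on u.
    - Conditioning on the past turns the remaining product into a smoothed finite
      difference. By the Cameron-Martin formula its sum over the agents is the directional
      derivative of a convex Gaussian smoothing of f, hence at least
      f(x) - f((1 - delta) xstar), up to L u^2 d / 2.
    The costs are extended to the whole space by McShane's formula, which makes all these
    expectations meaningful. For small eps all contributions add up to less than eps. *)

(** The delays force two replacements of different order. Replacing x(t) by x(tau) in the vector
    paired with an estimate costs a multiple of [eta * Vc], of order eta / u^2, and is what limits
    eta. Afterwards the smoothed differences [Hij] sit at points x(tau) that vary with (i, j), and
    only at a common point do they add up to one directional derivative; moving them back to x(t)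
    costs a multiple of [lag], of order eta / u. As eta is at most of order u^2 eps and u at most of
    order sqrt eps, the first cost is of order eps, while the second carries an extra factor u. The
    initial profile lies in X but possibly outside of the shrunken sets, so that x(0) has no margin
    for perturbations. Hence the times t > B, for which all estimates stem from times at least 1,
    are treated apart from t = B. Projections and argmins are given implicitly. That x(t) and z(t)
    are functions of the samples drawn so far, on which all uses of independence rest, is derived by
    induction from their continuous dependence on finitely many real quantities. *)

Local Open Scope classical_set_scope.
Local Open Scope ring_scope.

(** * Euclidean geometry of row vectors *)

Section EuclideanTheory.
Variables (R : realType) (m : nat).
Implicit Types (x y v : 'rV[R]_m) (C : set 'rV[R]_m).

Lemma dotC x y : dot x y = dot y x.
Proof. by apply: eq_bigr => k _; rewrite mulrC. Qed.

Lemma dotDl x y v : dot (x + y) v = dot x v + dot y v.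
Proof. by rewrite -big_split; apply: eq_bigr => k _; rewrite mxE mulrDl. Qed.

Lemma dotZl a x v : dot (a *: x) v = a * dot x v.
Proof. by rewrite mulr_sumr; apply: eq_bigr => k _; rewrite mxE mulrA. Qed.

Lemma dotDr x y v : dot v (x + y) = dot v x + dot v y.
Proof. by rewrite dotC dotDl !(dotC v). Qed.

Lemma dotZr a x v : dot v (a *: x) = a * dot v x.
Proof. by rewrite dotC dotZl dotC. Qed.

Lemma dotNl x v : dot (- x) v = - dot x v.
Proof. by rewrite -scaleN1r dotZl mulN1r. Qed.

Lemma dotNr x v : dot v (- x) = - dot v x.
Proof. by rewrite dotC dotNl dotC. Qed.

Lemma dotBl x y v : dot (x - y) v = dot x v - dot y v.
Proof. by rewrite dotDl dotNl. Qed.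

Lemma dotBr x y v : dot v (x - y) = dot v x - dot v y.
Proof. by rewrite dotDr dotNr. Qed.

Lemma dot0l v : dot 0 v = 0.
Proof. by rewrite -(scale0r v) dotZl mul0r. Qed.

Lemma dot_suml (I : Type) (r : seq I) (P : pred I) (F : I -> 'rV[R]_m) v :
  dot (\sum_(i <- r | P i) F i) v = \sum_(i <- r | P i) dot (F i) v.
Proof.
by elim/big_rec2: _ => [|i a b _ <-]; rewrite ?dot0l// dotDl.
Qed.

Lemma dot_ge0 x : 0 <= dot x x.
Proof. by apply: sumr_ge0 => k _; rewrite -expr2 sqr_ge0. Qed.

Lemma norm2_ge0 x : 0 <= norm2 x.
Proof. exact: sqrtr_ge0. Qed.

Lemma sqr_norm2 x : norm2 x ^+ 2 = dot x x.
Proof. by rewrite sqr_sqrtr// dot_ge0. Qed.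

Lemma sqr_norm2E x : norm2 x ^+ 2 = \sum_k x 0 k ^+ 2.
Proof. by rewrite sqr_norm2; apply: eq_bigr => k _; rewrite expr2. Qed.

Lemma norm2_eq0 x : norm2 x = 0 -> x = 0.
Proof.
move=> x0; have := sqr_norm2E x; rewrite x0 expr0n/= => /esym/eqP.
rewrite psumr_eq0 => [|k _]; last exact: sqr_ge0.
move=> /allP h; apply/rowP => k; rewrite mxE.
by have := h k (mem_index_enum k); rewrite /= sqrf_eq0 => /eqP.
Qed.

Lemma norm2Z a x : norm2 (a *: x) = `|a| * norm2 x.
Proof.
by rewrite /norm2 dotZl dotZr mulrA -expr2 sqrtrM ?sqr_ge0// sqrtr_sqr.
Qed.

Lemma norm2N x : norm2 (- x) = norm2 x.
Proof. by rewrite -scaleN1r norm2Z normrN1 mul1r. Qed.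

Lemma norm2_sub x y : norm2 (x - y) = norm2 (y - x).
Proof. by rewrite -norm2N opprB. Qed.

Lemma norm20 : norm2 (0 : 'rV[R]_m) = 0.
Proof. by rewrite -(scale0r 0) norm2Z normr0 mul0r. Qed.

Lemma dot_le x y : dot x y <= norm2 x * norm2 y.
Proof.
have [/norm2_eq0 ->|y0] := eqVneq (norm2 y) 0; first by rewrite dotC dot0l norm20 mulr0.
have [/norm2_eq0 ->|x0] := eqVneq (norm2 x) 0; first by rewrite dot0l norm20 mul0r.
have h := dot_ge0 (norm2 y *: x - norm2 x *: y).
rewrite dotBl !dotBr !dotZl !dotZr -!sqr_norm2 (dotC y x) in h.
have xy : 0 < norm2 x * norm2 y.
  by rewrite mulr_gt0// lt_def ?x0 ?y0 norm2_ge0.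
nra.
Qed.

Lemma normr_dot_le x y : `|dot x y| <= norm2 x * norm2 y.
Proof.
rewrite ler_norml dot_le andbT lerNl -dotNl -(norm2N x); exact: dot_le.
Qed.

Lemma ler_norm2D x y : norm2 (x + y) <= norm2 x + norm2 y.
Proof.
rewrite -(@ler_pXn2r _ 2)// ?nnegrE ?addr_ge0 ?norm2_ge0//.
rewrite sqr_norm2 dotDl !dotDr (dotC y x) -!sqr_norm2.
have := dot_le x y; nra.
Qed.

Lemma ler_norm2B x y : norm2 (x - y) <= norm2 x + norm2 y.
Proof. by rewrite -(norm2N y) ler_norm2D. Qed.

Lemma ler_dist2D v x y : norm2 (x - y) <= norm2 (x - v) + norm2 (v - y).
Proof. by apply: le_trans (ler_norm2D _ _); rewrite addrA subrK. Qed.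

Lemma norm2_sum (I : Type) (r : seq I) (P : pred I) (F : I -> 'rV[R]_m) :
  norm2 (\sum_(i <- r | P i) F i) <= \sum_(i <- r | P i) norm2 (F i).
Proof.
elim/big_rec2: _ => [|i a b _ h]; first by rewrite norm20.
by apply: le_trans (ler_norm2D _ _) _; rewrite lerD2l.
Qed.

Lemma normr_coord_le x k : `|x 0 k| <= norm2 x.
Proof.
rewrite -(@ler_pXn2r _ 2)// ?nnegrE ?norm2_ge0// real_normK ?num_real//.
by rewrite sqr_norm2E (bigD1 k)//= lerDl sumr_ge0// => j _; rewrite sqr_ge0.
Qed.

Lemma norm2_le_sum x : norm2 x <= \sum_k `|x 0 k|.
Proof.
rewrite {1}(row_sum_delta x).
apply: le_trans (norm2_sum _ _ _) _; apply: ler_sum => k _.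
rewrite norm2Z -[leRHS]mulr1 ler_wpM2l//.
rewrite -(@ler_pXn2r _ 2)// ?nnegrE ?norm2_ge0// sqr_norm2E expr1n.
rewrite (bigD1 k)//= big1 ?addr0 => [|j jk]; rewrite !mxE !eqxx/=; last first.
  by rewrite (negbTE jk) expr0n.
by rewrite expr1n.
Qed.

Lemma norm2_le_coord x (r : R) : (forall k, `|x 0 k| <= r) -> norm2 x <= r *+ m.
Proof.
move=> h; apply: le_trans (norm2_le_sum x) _.
by rewrite -[in leRHS](card_ord m) -sumr_const; exact: ler_sum.
Qed.

Lemma convex_setE C : @convex_set R 'rV[R]_m C <->
  forall x y (t : R), C x -> C y -> 0 <= t <= 1 -> C (t *: x + (1 - t) *: y).
Proof.
split=> [cC x y t Cx Cy /andP[t0 t1]|h x y t].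
  by have := cC x y (Itv01 t0 t1); rewrite !inE => /(_ Cx Cy); rewrite /conv/=.
by rewrite !inE => Cx Cy; rewrite /conv/=; apply: h => //; rewrite ge0 le1.
Qed.

Lemma is_proj_dot C y p q :
  @convex_set R 'rV[R]_m C -> is_proj C y p -> C q -> dot (y - p) (q - p) <= 0.
Proof.
move=> cC [Cp pmin] Cq; rewrite leNgt; apply/negP => h.
have h2 : 0 < dot (q - p) (q - p).
  rewrite lt_def dot_ge0 andbT -sqr_norm2 sqrf_eq0; apply/eqP => /norm2_eq0 e.
  by move: h; rewrite e dotC dot0l ltxx.
(* The minimiser of the squared distance to y along the segment from p to q, cut off at 1. *)
pose t := Num.min 1 (dot (y - p) (q - p) / dot (q - p) (q - p)).
have t01 : 0 < t <= 1 by rewrite lt_min ltr01 divr_gt0//= ge_min lexx.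
have Ct : C (t *: q + (1 - t) *: p).
  have/convex_setE := cC; apply => //.
  by case/andP: t01 => /ltW -> ->.
have := pmin _ Ct; rewrite -(@ler_pXn2r _ 2)// ?nnegrE ?norm2_ge0//.
have -> : t *: q + (1 - t) *: p - y = t *: (q - p) - (y - p).
  by apply/rowP => k; rewrite !mxE; ring.
have -> : p - y = - (y - p) by rewrite opprB.
rewrite norm2N !sqr_norm2; move: (y - p) (q - p) @t h h2 t01 {Ct} => v w t h h2 t01.
rewrite dotBl !dotBr !dotZl !dotZr (dotC w v).
have : t * dot w w <= dot v w.
  by rewrite -ler_pdivlMr// ge_min lexx orbT.
case/andP: t01 => t0 t1 h3 h4.
have : t * (t * dot w w) <= t * dot v w by rewrite ler_pM2l.
have : 0 < t * dot v w by rewrite mulr_gt0.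
lra.
Qed.

(** The variational inequality tested at 0 reads |p|^2 <= <y, p>. *)
Lemma norm2_proj_le C y p :
  @convex_set R 'rV[R]_m C -> C 0 -> is_proj C y p -> norm2 p <= norm2 y.
Proof.
move=> cC C0 pr; have := is_proj_dot cC pr C0.
rewrite sub0r dotNr dotBl -sqr_norm2 => h.
have := dot_le y p; have := norm2_ge0 p; have := norm2_ge0 y; nra.
Qed.

Lemma convex_functionE C (h : 'rV[R]_m -> R) :
  @convex_function R 'rV[R]_m C h <->
  forall x y (t : R), C x -> C y -> 0 <= t <= 1 ->
    h (t *: x + (1 - t) *: y) <= t * h x + (1 - t) * h y.
Proof.
split=> [cC x y t Cx Cy /andP[t0 t1]|H t x y].
  by have := cC (Itv01 t0 t1) x y; rewrite !inE => /(_ Cx Cy); rewrite /conv/=.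
by rewrite !inE => Cx Cy; rewrite /conv/=; apply: H => //; rewrite ge0 le1.
Qed.

End EuclideanTheory.

(** * Blocks of action profiles *)

Section BlockTheory.
Variables (R : realType) (n : nat) (dim : 'I_n -> nat).
Implicit Types x y : profile R dim.

Lemma blockD x y i : block (x + y) i = block x i + block y i.
Proof. by apply/rowP => k; rewrite !mxE. Qed.

Lemma blockN x i : block (- x) i = - block x i.
Proof. by apply/rowP => k; rewrite !mxE. Qed.

Lemma blockB x y i : block (x - y) i = block x i - block y i.
Proof. by rewrite blockD blockN. Qed.

Lemma blockZ a x i : block (a *: x) i = a *: block x i.
Proof. by apply/rowP => k; rewrite !mxE. Qed.

Lemma block0 i : block (0 : profile R dim) i = 0.
Proof. by apply/rowP => k; rewrite !mxE. Qed.

Lemma blockE x i k : block x i 0 k = x 0 (tagnat.Rank i k).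
Proof. by rewrite !mxE. Qed.

Lemma sum_blockE (F : 'I_(\sum_i dim i) -> R) :
  \sum_a F a = \sum_i \sum_k F (tagnat.Rank i k).
Proof.
rewrite (reindex _ (onW_bij _ (@tagnat.rank_bij _ dim)))/= sig_big_dep/=.
by apply: eq_bigr => -[i k] _; rewrite tagnat.rankE.
Qed.

Lemma dot_block x y : dot x y = \sum_i dot (block x i) (block y i).
Proof.
rewrite /dot sum_blockE; apply: eq_bigr => i _; apply: eq_bigr => k _.
by rewrite !blockE.
Qed.

Lemma sqr_norm2_block x : norm2 x ^+ 2 = \sum_i norm2 (block x i) ^+ 2.
Proof. by rewrite sqr_norm2 dot_block; apply: eq_bigr => i _; rewrite sqr_norm2. Qed.

Lemma norm2_block_le x i : norm2 (block x i) <= norm2 x.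
Proof.
rewrite -(@ler_pXn2r _ 2)// ?nnegrE ?norm2_ge0// sqr_norm2_block (bigD1 i)//=.
by rewrite lerDl sumr_ge0// => j _; rewrite sqr_ge0.
Qed.

Lemma mxrow_block (y : forall i, 'rV[R]_(dim i)) i :
  block (mxrow y : profile R dim) i = y i.
Proof. exact: mxrowK. Qed.

End BlockTheory.

(** * Measurability, independence and Fubini *)

(* The open sublevel sets of h are countable unions of boxes with rational center and
   radius in the coordinates y. *)
Lemma measurable_fun_continuous_family (d : measure_display)
    (T : measurableType d) (R : realType) (K : finType) (y : K -> T -> R)
    (h : T -> R) :
  (forall k, measurable_fun setT (y k)) ->
  (forall w (e : R), 0 < e -> exists2 r : R, 0 < r &
     forall w', (forall k, `|y k w' - y k w| < r) -> `|h w' - h w| < e) ->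
  measurable_fun setT h.
Proof.
move=> my hc; apply: (measurability _ (RGenInftyO.measurableE R)).
move=> _ [_ [c ->] <-]; rewrite setTI.
set A := h @^-1` _.
pose box (q : {ffun K -> rat} * nat) : set T :=
  \bigcap_(k in setT) (y k @^-1` `]ratr (q.1 k) - q.2.+1%:R^-1, ratr (q.1 k) + q.2.+1%:R^-1[).
pose F q := if `[< box q `<=` A >] then box q else set0.
have -> : A = \bigcup_q F q.
  apply/seteqP; split=> [w Aw|w [q _]]; last first.
    by rewrite /F; case: asboolP => // sub /sub.
  have e0 : 0 < c - h w by rewrite subr_gt0; move: Aw; rewrite /A/= in_itv.
  have [r r0 hr] := hc w _ e0.
  (* Two points in a box of radius s around a common center differ by less than 2 s < r in each
     coordinate. *)
  pose j := Num.bound (2 / r); pose s : R := j.+1%:R^-1.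
  have s0 : 0 < s by rewrite invr_gt0.
  have sr : s + s < r.
    have : 2 / r < j.+1%:R.
      by apply: lt_trans (archi_boundP _) _; rewrite ?divr_ge0 ?ltW// ltr_nat.
    rewrite ltr_pdivrMr// => h1; have sJ : s * j.+1%:R = 1 by rewrite mulVf.
    have : s * 2 < s * (j.+1%:R * r) by rewrite ltr_pM2l.
    by rewrite mulrA sJ; lra.
  have /choice[q hq] : forall k, exists q : rat, ratr q \in `]y k w - s, y k w + s[.
    by move=> k; apply: rat_in_itvoo; lra.
  exists ([ffun k => q k], j) => //.
  have wbox : box ([ffun k => q k], j) w.
    move=> k _; have := hq k; rewrite /= !in_itv/= ffunE => /andP[? ?].
    by apply/andP; split; rewrite -/s; lra.
  rewrite /F asboolT// => w' bw'; rewrite /A/= in_itv/=.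
  have : `|h w' - h w| < c - h w.
    apply: hr => k; have := bw' k I; have := wbox k I.
    rewrite /= !in_itv/= ffunE -/s => /andP[? ?] /andP[? ?].
    by rewrite ltr_norml; apply/andP; split; lra.
  by rewrite ltr_norml => /andP[]; lra.
apply: countable_bigcupT_measurable; first exact: countableP.
move=> q; rewrite /F; case: asboolP => // _.
apply: fin_bigcap_measurable => // k _.
by rewrite -[X in measurable X]setTI; apply: my => //; exact: measurable_itv.
Qed.

(** * Measures given by a density *)

Section Density.
Context (d : measure_display) (T : measurableType d) (R : realType)
        (mu : {measure set T -> \bar R}) (g : T -> R).
Hypotheses (mg : measurable_fun setT g) (g0 : forall x, 0 <= g x).
Local Open Scope ereal_scope.

(** The two proofs are arguments of the term so that the measure structure declared below can be
    inferred from it. *)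
Definition mdensity (_ : measurable_fun setT g) (_ : forall x, (0 <= g x)%R)
    (A : set T) : \bar R := \int[mu]_(x in A) (g x)%:E.

Local Notation nu := (mdensity mg g0).

Let nu0 : nu set0 = 0.
Proof. by rewrite /mdensity integral_set0. Qed.

Let nu_ge0 A : 0 <= nu A.
Proof. by apply: integral_ge0 => x _; rewrite lee_fin. Qed.

Let nu_sigma : semi_sigma_additive nu.
Proof.
apply: semi_sigma_additive_nng_induced => [|x]; last by rewrite lee_fin.
exact/measurable_EFinP.
Qed.

HB.instance Definition _ := isMeasure.Build _ _ _ nu nu0 nu_ge0 nu_sigma.

End Density.

Section DensityIntegral.
Import HBNNSimple.

(** The measure [nu] is specified through its values only, so that the lemma covers both the normal
    law and the tilted measures [mdensity]. The formula holds for simple functions and passes to the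
    limit by monotone convergence. *)
Lemma ge0_integral_density (d : measure_display) (T : measurableType d)
    (R : realType) (mu nu : {measure set T -> \bar R}) (g : T -> R)
    (h : T -> \bar R) :
  measurable_fun setT g -> (forall x, 0 <= g x) ->
  (forall A, measurable A -> nu A = (\int[mu]_(x in A) (g x)%:E)%E) ->
  measurable_fun setT h -> (forall x, (0 <= h x)%E) ->
  (\int[nu]_x h x = \int[mu]_x (h x * (g x)%:E))%E.
Proof.
move=> mg g0 nuE mh h0.
pose f_ := nnsfun_approx measurableT mh.
transitivity (limn (fun n => \int[nu]_x (f_ n x)%:E)%E).
  rewrite -monotone_convergence//=.
  - apply: eq_integral => x /[!inE] xD; apply/esym/cvg_lim => //=.
    exact: cvg_nnsfun_approx.
  - by move=> n; exact/measurable_EFinP/measurable_funTS.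
  - by move=> n x _; rewrite lee_fin.
  - by move=> x _ a b ab; rewrite lee_fin//; exact/lefP/nd_nnsfun_approx.
transitivity (limn (fun n => \int[mu]_x ((f_ n x)%:E * (g x)%:E))%E); last first.
  rewrite -monotone_convergence//=.
  - apply: eq_integral => x /[!inE] xD; apply/cvg_lim => //=.
    by apply: cvgeZr => //; exact: cvg_nnsfun_approx.
  - move=> n; apply: emeasurable_funM; last exact/measurable_EFinP.
    exact/measurable_EFinP/measurable_funTS.
  - by move=> n x _; rewrite -EFinM lee_fin mulr_ge0.
  - move=> x _ a b ab; rewrite -!EFinM lee_fin ler_wpM2r//.
    exact/lefP/nd_nnsfun_approx.
congr (limn _); apply/funext => n.
under eq_integral do rewrite fimfunE -fsumEFin//.
rewrite ge0_integral_fsum//; last 2 first.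
  - by move=> r; exact/measurable_EFinP/measurableT_comp.
  - by move=> r x _; rewrite EFinM nnfun_muleindic_ge0.
under [RHS]eq_integral.
  move=> x xD; rewrite fimfunE -fsumEFin// muleC ge0_mule_fsumr; last first.
    by move=> r; rewrite EFinM nnfun_muleindic_ge0.
  over.
rewrite [RHS]ge0_integral_fsum//; last 2 first.
  - move=> r; apply: emeasurable_funM; first exact/measurable_EFinP.
    exact/measurable_EFinP/measurableT_comp.
  - by move=> r x _; rewrite mule_ge0//; [rewrite lee_fin|rewrite EFinM nnfun_muleindic_ge0].
apply: eq_fsbigr => r _.
rewrite integralZl_indic_nnsfun//= integral_indic// setIT nuE//.
under [RHS]eq_integral do rewrite EFinM muleCA.
have [r0|r0] := leP 0%R r; last first.
  rewrite preimage_nnfun0// integral_set0 mule0.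
  by under eq_integral do rewrite indic0 mule0 mule0; rewrite integral0.
rewrite ge0_integralZl//; last 2 first.
- apply: emeasurable_funM; first exact/measurable_EFinP.
  exact/measurable_EFinP/measurable_indic.
- by move=> x _; rewrite mule_ge0 ?lee_fin.
congr (_ * _)%E; rewrite integral_mkcond; apply: eq_integral => x _.
by rewrite patchE indicE; case: ifP => _; rewrite ?mule1 ?mule0.
Qed.

End DensityIntegral.

(** * Sigma-algebras generated by groups of samples *)

Section Independence.
Context (d : measure_display) (T : measurableType d) (R : realType)
        (P : probability T R) (I : choiceType) (Y : I -> T -> R).

(** The pi-system of events that constrain finitely many samples in [S]. It generates the
    sigma-algebra of these samples, and mutual independence speaks about it directly. *)
Definition cylinders (S : set I) : set (set T) :=
  [set A | exists2 J : {fset I}, [set` J] `<=` S &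
     exists2 B : I -> set R, (forall i, measurable (B i)) &
       A = \bigcap_(i in [set` J]) (Y i @^-1` B i)].

Lemma cylinder1 (S : set I) i (B : set R) : S i -> measurable B ->
  cylinders S (Y i @^-1` B).
Proof.
move=> Si mB; exists [fset i]%fset.
  by move=> j /=; rewrite inE => /eqP ->.
by exists (fun=> B) => //; rewrite set_fset1 bigcap_set1.
Qed.

Lemma cylinderT (S : set I) : cylinders S setT.
Proof.
exists fset0; first by move=> j /=; rewrite inE.
by exists (fun=> setT) => //; rewrite set_fset0 bigcap_set0.
Qed.

Lemma cylinders_setI (S : set I) : setI_closed (cylinders S).
Proof.
move=> _ _ [J1 J1S [B1 mB1 ->]] [J2 J2S [B2 mB2 ->]].
exists (J1 `|` J2)%fset; first by move=> i /=; rewrite inE => /orP[/J1S|/J2S].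
exists (fun i => (if i \in J1 then B1 i else setT) `&`
                 (if i \in J2 then B2 i else setT)).
  by move=> i; apply: measurableI; case: ifP.
apply/seteqP; split=> [w [h1 h2] i /=|w h].
  rewrite inE => ij; split; case: ifP => // k; first exact: h1.
  exact: h2.
by split=> i /= iJ; have := h i; rewrite /= inE iJ ?orbT => /(_ isT)[].
Qed.

Hypothesis mY : forall i, measurable_fun setT (Y i).
Hypothesis iY : mutually_independent P Y.

Lemma cylinders_measurable (S : set I) : cylinders S `<=` measurable.
Proof.
move=> _ [J _ [B mB ->]]; apply: fin_bigcap_measurable => // i _.
by rewrite -[X in measurable X]setTI; exact: mY.
Qed.

Lemma sigma_cylinders_measurable (S : set I) : <<s cylinders S >> `<=` measurable.
Proof.
apply: smallest_sub; last exact: cylinders_measurable.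
exact: sigma_algebra_measurable.
Qed.

Local Open Scope ereal_scope.

Lemma cylinders_indep (S1 S2 : set I) A B : S1 `&` S2 = set0 ->
  cylinders S1 A -> cylinders S2 B -> P (A `&` B) = P A * P B.
Proof.
move: A B => _ _ S12 [J1 J1S [B1 mB1 ->]] [J2 J2S [B2 mB2 ->]].
have J12 i : i \in J1 -> i \in J2 -> False.
  by move=> /J1S a /J2S b; have : (S1 `&` S2) i by []; rewrite S12.
pose B i := if i \in J1 then B1 i else B2 i.
have e1 : \bigcap_(i in [set` J1]) (Y i @^-1` B1 i) =
          \bigcap_(i in [set` J1]) (Y i @^-1` B i).
  by apply: eq_bigcapr => i /= iJ; rewrite /B iJ.
have e2 : \bigcap_(i in [set` J2]) (Y i @^-1` B2 i) =
          \bigcap_(i in [set` J2]) (Y i @^-1` B i).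
  apply: eq_bigcapr => i /= iJ; rewrite /B; case: ifP => // iJ1.
  by case: (J12 i).
have mB i : measurable (B i) by rewrite /B; case: ifP.
rewrite e1 e2 -bigcap_setU.
have -> : [set` J1] `|` [set` J2] = [set` (J1 `|` J2)%fset].
  by apply/seteqP; split=> i /=; rewrite inE => /orP.
rewrite !iY//.
rewrite (perm_big (J1 ++ J2)%SEQ)/=.
  by rewrite big_cat.
apply: uniq_perm.
- exact: fset_uniq.
- rewrite cat_uniq !fset_uniq/= andbT; apply/hasPn => i iJ2; apply/negP => iJ1.
  exact: (J12 i).
- by move=> i; rewrite mem_cat inE.
Qed.

(** The pi-lambda argument, used twice: first an event over [S1] is fixed among the cylinders and
    the event over [S2] is extended to the generated sigma-algebra, then the latter is fixed and the
    former extended. Each time a restriction of P is compared with a multiple of P. *)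
Lemma sigma_cylinders_indep (S1 S2 : set I) A B : S1 `&` S2 = set0 ->
  <<s cylinders S1 >> A -> <<s cylinders S2 >> B -> P (A `&` B) = P A * P B.
Proof.
move=> S12 sA sB.
have mA := sigma_cylinders_measurable sA.
have mB := sigma_cylinders_measurable sB.
(* [mscale] takes a nonnegative real factor, hence the passage through [fine], which is harmless for
   a probability. *)
have scaleE C D : measurable C ->
    mscale (NngNum (fine_ge0 (measure_ge0 P C))) P D = P C * P D.
  by move=> mC; rewrite /mscale/= fineK// fin_num_measure.
have step1 C : cylinders S1 C -> P (B `&` C) = P C * P B.
  move=> cC; have mC := cylinders_measurable cC.
  rewrite -[LHS]/(mrestr P mC B) -scaleE//.
  apply: (g_sigma_algebra_measure_unique (cylinders S2) _ (fun=> setT)) => //.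
  - exact: cylinders_measurable.
  - by move=> _; exact: cylinderT.
  - by rewrite bigcup_const.
  - exact: cylinders_setI.
  - by move=> D cD; rewrite [RHS]scaleE// -(cylinders_indep S12)// setIC.
  - by move=> k; rewrite /mrestr -ge0_fin_numE// fin_num_measure//; exact: measurableI.
rewrite muleC -scaleE// -[LHS]/(mrestr P mB A).
apply: (g_sigma_algebra_measure_unique (cylinders S1) _ (fun=> setT)) => //.
- exact: cylinders_measurable.
- by move=> _; exact: cylinderT.
- by rewrite bigcup_const.
- exact: cylinders_setI.
- by move=> D cD; rewrite [RHS]scaleE// muleC -step1// setIC.
- by move=> k; rewrite /mrestr -ge0_fin_numE// fin_num_measure//; exact: measurableI.
Qed.

(** Dependence on the samples in [S] alone is expressed as measurability on this copy of [T]; the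
    identity [toSub] is the measurable map from the original space. *)
Definition subT (S : set I) : Type := g_sigma_algebraType (cylinders S).

HB.instance Definition _ S := Measurable.on (subT S).

Definition toSub (S : set I) : T -> subT S := idfun.

Lemma measurable_toSub S : measurable_fun setT (toSub S).
Proof. by move=> _ A sA; rewrite setTI; exact: sigma_cylinders_measurable sA. Qed.

HB.instance Definition _ S :=
  isMeasurableFun.Build _ _ _ _ (toSub S) (@measurable_toSub S).

Lemma measurable_fun_sample S i : S i ->
  measurable_fun setT (Y i : subT S -> R).
Proof.
move=> Si _ B mB; rewrite setTI; apply: sub_sigma_algebra.
exact: cylinder1.
Qed.

Lemma measurable_fun_sub d' (T' : measurableType d') (S S' : set I) (h : T -> T') :
  S `<=` S' -> measurable_fun setT (h : subT S -> T') ->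
  measurable_fun setT (h : subT S' -> T').
Proof.
move=> SS mh _ B mB; have := mh measurableT B mB; rewrite !setTI.
apply: sub_smallest2r; first exact: smallest_sigma_algebra.
by move=> _ [J JS [C mC ->]]; exists J; [exact: subset_trans SS|exists C].
Qed.

Lemma measurable_fun_subW d' (T' : measurableType d') (S : set I) (h : T -> T') :
  measurable_fun setT (h : subT S -> T') -> measurable_fun setT h.
Proof.
move=> mh _ B mB; apply: (@sigma_cylinders_measurable S); exact: mh.
Qed.

(** The freezing principle, which replaces conditional expectations: by independence, the law of the
    diagonal map into the product of the two copies of [T] is the product of the two restrictions of
    P. *)
Lemma tonelli_indep (S1 S2 : set I) (h : subT S1 * subT S2 -> \bar R) :
  S1 `&` S2 = set0 -> measurable_fun setT h -> (forall x, 0 <= h x) ->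
  \int[P]_w h (w, w) = \int[P]_w \int[P]_w' h (w, w').
Proof.
move=> S12 mh h0.
pose P1 := distribution P (toSub S1); pose P2 := distribution P (toSub S2).
have mdiag : measurable_fun setT (fun w : T => (toSub S1 w, toSub S2 w)).
  by apply/measurable_fun_pairP; split; exact: measurable_toSub.
transitivity (\int[pushforward P (fun w : T => (toSub S1 w, toSub S2 w))]_x h x).
  by rewrite ge0_integral_pushforward.
transitivity (\int[P1 \x P2]_x h x).
  apply: eq_measure_integral => X mX _; symmetry.
  apply: (@product_measure_unique _ _ _ _ _ P1 P2) => // A B mA mB.
  rewrite /pushforward/= /P1 /P2 /distribution /pushforward.
  exact: sigma_cylinders_indep S12 mA mB.
rewrite fubini_tonelli1//= ge0_integral_distribution//=; last 2 first.
- exact: measurable_fun_fubini_tonelli_F.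
- by move=> x; apply: integral_ge0.
apply: eq_integral => w _; rewrite /fubini_F ge0_integral_distribution//.
by apply: measurableT_comp => //; exact: measurable_pair1.
Qed.

End Independence.

(** * Real expectations *)

Definition L1 (d : measure_display) (T : measurableType d) (R : realType)
    (P : {measure set T -> \bar R}) (X : T -> R) :=
  P.-integrable setT (EFin \o X).

Section RealExpectation.
Context (d : measure_display) (T : measurableType d) (R : realType)
        (P : probability T R).
Implicit Types X Y : T -> R.

Notation L1 := (L1 P).
Notation E X := (Rintegral P setT X).

Lemma L1_ext X Y : X =1 Y -> L1 X -> L1 Y.
Proof. by move=> /funext ->. Qed.

Lemma E_ext X Y : X =1 Y -> E X = E Y.
Proof. by move=> /funext ->. Qed.

Lemma L1_dom X Y : measurable_fun setT X -> L1 Y -> (forall w, `|X w| <= Y w) -> L1 X.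
Proof.
move=> mX iY XY; apply: le_integrable iY => //; first exact/measurable_EFinP.
by move=> w _ /=; rewrite lee_fin (le_trans (XY w))// ler_norm.
Qed.

Lemma L1_cst c : L1 (fun=> c).
Proof. exact: finite_measure_integrable_cst. Qed.

Lemma L1_bounded X c : measurable_fun setT X -> (forall w, `|X w| <= c) -> L1 X.
Proof. by move=> mX; apply: L1_dom => //; exact: L1_cst. Qed.

Lemma L1D X Y : L1 X -> L1 Y -> L1 (fun w => X w + Y w).
Proof. by move=> iX iY; have := integrableD measurableT iX iY. Qed.

Lemma L1Z c X : L1 X -> L1 (fun w => c * X w).
Proof. by move=> iX; have := integrableZl measurableT c iX. Qed.

Lemma L1N X : L1 X -> L1 (fun w => - X w).
Proof. by move=> iX; have := integrableN iX. Qed.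

Lemma L1B X Y : L1 X -> L1 Y -> L1 (fun w => X w - Y w).
Proof. by move=> iX iY; apply: L1D => //; exact: L1N. Qed.

Lemma L1_sum (I : Type) (s : seq I) (X : I -> T -> R) :
  (forall i, L1 (X i)) -> L1 (fun w => \sum_(i <- s) X i w).
Proof.
move=> iX; elim: s => [|i s IH].
  by apply: (L1_ext _ (L1_cst 0)) => w; rewrite big_nil.
by apply: (L1_ext _ (L1D (iX i) IH)) => w; rewrite big_cons.
Qed.

Lemma E_le X Y : L1 X -> L1 Y -> (forall w, X w <= Y w) -> E X <= E Y.
Proof. by move=> iX iY XY; apply: le_Rintegral. Qed.

Lemma E_ge0 X : (forall w, 0 <= X w) -> 0 <= E X.
Proof. by move=> X0; apply: Rintegral_ge0. Qed.

Lemma E_cst c : E (fun=> c) = c.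
Proof. by rewrite Rintegral_cst//= [X in fine X]probability_setT/= mulr1. Qed.

Lemma E_D X Y : L1 X -> L1 Y -> E (fun w => X w + Y w) = E X + E Y.
Proof. by move=> iX iY; rewrite RintegralD. Qed.

Lemma E_B X Y : L1 X -> L1 Y -> E (fun w => X w - Y w) = E X - E Y.
Proof. by move=> iX iY; rewrite RintegralB. Qed.

Lemma E_Z c X : L1 X -> E (fun w => c * X w) = c * E X.
Proof. by move=> iX; rewrite RintegralZl. Qed.

Lemma E_sum (I : Type) (s : seq I) (X : I -> T -> R) :
  (forall i, L1 (X i)) -> E (fun w => \sum_(i <- s) X i w) = \sum_(i <- s) E (X i).
Proof.
move=> iX; elim: s => [|i s IH].
  by rewrite big_nil -[RHS]E_cst; apply: E_ext => w; rewrite big_nil.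
rewrite big_cons -IH -E_D//; last exact: L1_sum.
by apply: E_ext => w; rewrite big_cons.
Qed.

Lemma normr_E_le X Y : L1 X -> L1 Y -> (forall w, `|X w| <= Y w) -> `|E X| <= E Y.
Proof.
move=> iX iY XY; apply: (le_trans (le_normr_Rintegral _ iX)) => //.
by apply: E_le => //; exact: integrable_norm.
Qed.

Lemma EFin_E X : L1 X -> ((E X)%:E = \int[P]_w (X w)%:E)%E.
Proof. by move=> iX; rewrite fineK//; exact: integrable_fin_num. Qed.

Lemma L1_lty X : measurable_fun setT X -> (forall w, 0 <= X w) ->
  (\int[P]_w (X w)%:E < +oo)%E -> L1 X.
Proof.
move=> mX X0 fin; apply/integrableP; split; first exact/measurable_EFinP.
by rewrite (eq_integral (fun w => (X w)%:E))// => w _; rewrite /= ger0_norm.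
Qed.

End RealExpectation.

(** * Expectations of functions of independent groups of samples *)

Section IndependentExpectations.
Context (d : measure_display) (T : measurableType d) (R : realType)
        (P : probability T R) (I : choiceType) (Y : I -> T -> R).
Hypothesis mY : forall i, measurable_fun setT (Y i).
Hypothesis iY : mutually_independent P Y.
Notation subT := (subT Y).
Notation E X := (Rintegral P setT X).

Lemma prod_indep_ge0 (S1 S2 : set I) (U V : T -> R) : S1 `&` S2 = set0 ->
  measurable_fun setT (U : subT S1 -> R) -> measurable_fun setT (V : subT S2 -> R) ->
  (forall w, 0 <= U w) -> (forall w, 0 <= V w) ->
  (\int[P]_w (U w * V w)%:E = \int[P]_w (U w)%:E * \int[P]_w (V w)%:E)%E.
Proof.
move=> S12 mU mV U0 V0.
pose h (x : subT S1 * subT S2) : \bar R := (U x.1 * V x.2)%:E.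
have mh : measurable_fun setT h.
  apply/measurable_EFinP; apply: measurable_funM.
    exact: (measurableT_comp mU (@measurable_fst _ _ _ _)).
  exact: (measurableT_comp mV (@measurable_snd _ _ _ _)).
have h0 x : (0 <= h x)%E by rewrite lee_fin mulr_ge0.
have := tonelli_indep mY iY S12 mh h0; rewrite /h/= => ->.
have mU' := measurable_fun_subW mY mU; have mV' := measurable_fun_subW mY mV.
under eq_integral => w _.
  under eq_integral do rewrite EFinM.
  rewrite ge0_integralZl//; last 3 first.
  - exact/measurable_EFinP.
  - by move=> w' _; rewrite lee_fin.
  - by rewrite lee_fin.
  over.
rewrite ge0_integralZr//.
- exact/measurable_EFinP.
- by move=> w _; rewrite lee_fin.
- by apply: integral_ge0 => w _; rewrite lee_fin.
Qed.

Lemma L1_prod_indep (S1 S2 : set I) (U V : T -> R) : S1 `&` S2 = set0 ->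
  measurable_fun setT (U : subT S1 -> R) -> measurable_fun setT (V : subT S2 -> R) ->
  (forall w, 0 <= U w) -> (forall w, 0 <= V w) -> L1 P U -> L1 P V ->
  L1 P (fun w => U w * V w) /\ E (fun w => U w * V w) = E U * E V.
Proof.
move=> S12 mU mV U0 V0 iU iV.
have mU' := measurable_fun_subW mY mU; have mV' := measurable_fun_subW mY mV.
have e := prod_indep_ge0 S12 mU mV U0 V0.
have i : L1 P (fun w => U w * V w).
  apply: L1_lty; first exact: measurable_funM.
  - by move=> w; rewrite mulr_ge0.
  - by rewrite e -!EFin_E// -EFinM ltry.
by split => //; apply: EFin_inj; rewrite EFinM !EFin_E.
Qed.

Lemma prod_seq_indep_ge0 (s : seq I) (phi : I -> R -> R) : uniq s ->
  (forall i, measurable_fun setT (phi i)) -> (forall i y, 0 <= phi i y) ->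
  (\int[P]_w (\prod_(i <- s) phi i (Y i w))%:E =
   \prod_(i <- s) \int[P]_w (phi i (Y i w))%:E)%E.
Proof.
move=> us mphi phi0; elim: s us => [_|i s IH /= /andP[nis us]].
  rewrite big_nil; under eq_integral do rewrite big_nil.
  by rewrite integral_cst//= -[RHS]mule1; congr (_ * _)%E; exact: probability_setT.
rewrite big_cons -IH//; under eq_integral do rewrite big_cons.
apply: (@prod_indep_ge0 [set i] [set j | j \in s]) => //.
- by apply/seteqP; split => // j [/= -> si]; rewrite si in nis.
- by apply: measurableT_comp => //; exact: measurable_fun_sample.
(* Sublists are quantified separately, since the sigma-algebra has to remain that of the whole list
   [s] while the product is built up. *)
- have : forall s' : seq I, (forall j, j \in s' -> j \in s) ->
    measurable_fun setT ((fun w => \prod_(j <- s') phi j (Y j w)) : subT [set j | j \in s] -> R).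
    elim=> [_|j s' IH' sub].
      rewrite (_ : (fun w => _) = (fun=> 1)); first exact: measurable_cst.
      by apply/funext => w; rewrite big_nil.
    rewrite (_ : (fun w => _) =
      (fun w => phi j (Y j w) * \prod_(j <- s') phi j (Y j w))); last first.
      by apply/funext => w; rewrite big_cons.
    apply: measurable_funM; last first.
      by apply: IH' => k ks; apply: sub; rewrite inE ks orbT.
    apply: measurableT_comp => //; apply: measurable_fun_sample => /=.
    by apply: sub; rewrite inE eqxx.
  exact.
- by move=> w; apply: prodr_ge0.
Qed.

(** The version for signed integrands; [H] is the conditional expectation given the samples in [S1].
    The dominating function depends on the second argument alone, so that adding it makes the
    integrand nonnegative and its mean, a constant, can be subtracted after [tonelli_indep]. *)
Lemma fubini_indep (S1 S2 : set I) (h : T -> T -> R) (g : T -> R) :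
  S1 `&` S2 = set0 ->
  measurable_fun setT (fun x : subT S1 * subT S2 => h x.1 x.2) ->
  measurable_fun setT (g : subT S2 -> R) -> L1 P g ->
  (forall w w', `|h w w'| <= g w') ->
  let H := fun w => E (h w) in
  [/\ measurable_fun setT H, L1 P H, L1 P (fun w => h w w),
      forall w, L1 P (h w) & E (fun w => h w w) = E H].
Proof.
move=> S12 mh mg ig hg H.
have mg' := measurable_fun_subW mY mg.
have mh1 w : measurable_fun setT (h w).
  apply: (@measurable_fun_subW _ _ _ _ _ mY _ _ S2).
  exact: (measurableT_comp mh (@measurable_pair1 _ _ (subT S1) (subT S2) w)).
have ih1 w : L1 P (h w) by apply: L1_dom ig _.
have mhd : measurable_fun setT (fun w => h w w).
  have md : measurable_fun setT (fun w : T => (toSub Y S1 w, toSub Y S2 w)).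
    by apply/measurable_fun_pairP; split; exact: measurable_toSub.
  exact: (measurableT_comp mh md).
have ihd : L1 P (fun w => h w w) by apply: L1_dom ig _.
pose k (x : subT S1 * subT S2) : \bar R := (h x.1 x.2 + g x.2)%:E.
have mk : measurable_fun setT k.
  apply/measurable_EFinP; apply: measurable_funD => //.
  exact: (measurableT_comp mg (@measurable_snd _ _ _ _)).
have k0 x : (0 <= k x)%E.
  by rewrite lee_fin; have := hg x.1 x.2; rewrite ler_norml => /andP[+ _]; lra.
have inner w : (\int[P]_w' k (w, w') = (H w + E g)%:E)%E.
  by rewrite /k/= -EFin_E; [rewrite E_D|exact: L1D].
have mH : measurable_fun setT H.
  have mK : measurable_fun setT (fun w : subT S1 => \int[P]_w' k (w, w'))%E.
    have := @measurable_fun_fubini_tonelli_F _ _ _ _ _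
      (distribution P (toSub Y S2)) k mk k0 => /(_ mY).
    apply: eq_measurable_fun => w _; rewrite /fubini_F ge0_integral_distribution//.
    exact: (measurableT_comp mk (@measurable_pair1 _ _ (subT S1) (subT S2) w)).
  apply: (@measurable_fun_subW _ _ _ _ _ mY _ _ S1).
  have -> : H = (fun w => fine (\int[P]_w' k (w, w'))%E - E g).
    by apply/funext => w; rewrite inner/= addrK.
  apply: measurable_funB; last exact: measurable_cst.
  by apply: measurableT_comp mK.
have Hb w : `|H w| <= E g by apply: normr_E_le.
have iH : L1 P H by apply: L1_bounded Hb.
split => //; have := tonelli_indep mY iY S12 mk k0.
under [X in _ = X -> _]eq_integral do rewrite inner.
rewrite /k/= -!EFin_E.
- by move=> [] ; rewrite !E_D//; [rewrite E_cst => /addIr|exact: L1_cst].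
- by apply: L1D => //; exact: L1_cst.
- exact: L1D.
Qed.

End IndependentExpectations.

(** * Laws of random vectors *)

Section Laws.
Variables (R : realType) (m : nat).

(** A pi-system that generates the product sigma-algebra on row vectors, so that finite laws are
    determined by their values on it. *)
Definition boxes : set (set 'rV[R]_m) :=
  [set A | exists2 B : 'I_m -> set R, (forall k, measurable (B k)) &
     A = [set v : 'rV[R]_m | forall k, B k (v 0 k)]].

Definition vecT : Type := g_sigma_algebraType boxes.

HB.instance Definition _ := Measurable.on vecT.

Lemma measurable_coord k : measurable_fun setT (fun v : vecT => v 0 k).
Proof.
move=> _ B mB; rewrite setTI; apply: sub_sigma_algebra.
exists (fun j => if j == k then B else setT); first by move=> j; case: ifP.
apply/seteqP; split=> [v Bv j /=|v /(_ k)]; last by rewrite eqxx.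
by case: eqP => // ->.
Qed.

Lemma measurable_continuous_vec (h : 'rV[R]_m -> R) :
  (forall v (e : R), 0 < e -> exists2 r : R, 0 < r &
     forall v', norm2 (v' - v) <= r -> `|h v' - h v| < e) ->
  measurable_fun setT (h : vecT -> R).
Proof.
move=> hc; apply: (measurable_fun_continuous_family measurable_coord) => v e e0.
have [r r0 hr] := hc v e e0.
have s0 : 0 < r / m.+1%:R by rewrite divr_gt0.
exists (r / m.+1%:R) => // v' h'; apply: hr.
apply: (@le_trans _ _ ((r / m.+1%:R) *+ m)).
  by apply: norm2_le_coord => k; rewrite !mxE ltW//; exact: h'.
rewrite -mulr_natr mulrAC ler_pdivrMr// ler_pM2l// ler_nat; exact: leqnSn.
Qed.

Lemma measurable_to_vec d (T : measurableType d) (Z : T -> 'rV[R]_m) :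
  (forall k, measurable_fun setT (fun w => Z w 0 k)) ->
  measurable_fun setT (Z : T -> vecT).
Proof.
move=> mZ; apply: (@measurability _ _ T vecT setT Z boxes) => //.
move=> _ [_ [B mB ->] <-]; rewrite setTI.
have -> : Z @^-1` [set v | forall k, B k (v 0 k)] =
    \bigcap_(k in setT) ((fun w => Z w 0 k) @^-1` B k).
  by apply/seteqP; split=> w /= h k => [_|]; exact: h.
apply: fin_bigcap_measurable => // k _.
by rewrite -[X in measurable X]setTI; exact: mZ.
Qed.

Lemma boxes_setI : setI_closed boxes.
Proof.
move=> _ _ [B mB ->] [C mC ->].
exists (fun k => B k `&` C k); first by move=> k; exact: measurableI.
by apply/seteqP; split=> [v [h1 h2] k|v h]; [split|split=> k; have [] := h k].
Qed.

(** The two vectors may live on different measure spaces, and finiteness of [mu1] replaces total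
    mass 1: in [cameron_martin] one side carries the tilted measure. *)
Lemma law_unique d1 d2 (T1 : measurableType d1) (T2 : measurableType d2)
    (mu1 : {measure set T1 -> \bar R}) (mu2 : {measure set T2 -> \bar R})
    (Z1 : T1 -> 'rV[R]_m) (Z2 : T2 -> 'rV[R]_m) (h : 'rV[R]_m -> \bar R) :
  (forall k, measurable_fun setT (fun w => Z1 w 0 k)) ->
  (forall k, measurable_fun setT (fun w => Z2 w 0 k)) ->
  (mu1 setT < +oo)%E ->
  (forall B : 'I_m -> set R, (forall k, measurable (B k)) ->
     mu1 [set w | forall k, B k (Z1 w 0 k)] = mu2 [set w | forall k, B k (Z2 w 0 k)]) ->
  measurable_fun setT (h : vecT -> \bar R) -> (forall v, (0 <= h v)%E) ->
  (\int[mu1]_w h (Z1 w) = \int[mu2]_w h (Z2 w))%E.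
Proof.
move=> /measurable_to_vec mZ1 /measurable_to_vec mZ2 fin eqB mh h0.
rewrite -(@ge0_integral_pushforward _ _ _ _ _ _ mZ1 mu1 setT h)//.
rewrite -(@ge0_integral_pushforward _ _ _ _ _ _ mZ2 mu2 setT h)//.
apply: eq_measure_integral => A mA _.
apply: (@measure_unique _ R vecT boxes (fun=> setT)) => //.
- exact: boxes_setI.
- by move=> _; exists (fun=> setT) => //; apply/seteqP; split.
- by rewrite bigcup_const.
- by move=> _ [B mB ->]; exact: eqB.
Qed.

End Laws.

(** * Gaussian vectors *)

Section GaussianLine.
Variable R : realType.
Notation mu := (@lebesgue_measure R).
Notation gam := (@normal_prob R 0 1).

(** Lebesgue measure is determined by its values on half-open intervals. *)
Lemma lebesgue_shift (h : R) (A : set R) : measurable A ->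
  mu ((fun y => y + h) @^-1` A) = mu A.
Proof.
move=> mA; have ms : measurable_fun setT (fun y : R => y + h).
  by apply: measurable_funD => //; exact: measurable_cst.
pose nu : {measure set (measurableTypeR R) -> \bar R} :=
  measure_function_pushforward__canonical__measure_function_Measure mu
    (ms : measurable_fun setT (_ : measurableTypeR R -> measurableTypeR R)).
symmetry; apply: (@lebesgue_measure_unique R nu) => // X [[a b] _ <-].
rewrite /nu/= /pushforward.
have -> : (fun y => y + h) @^-1` `]a, b] = `]a - h, b - h]%classic.
  apply/seteqP; split=> y /=; rewrite !in_itv/= => /andP[? ?];
    by apply/andP; split; lra.
rewrite !lebesgue_measure_itv/= !lte_fin ltrD2r; case: ifP => // _.
by rewrite -!EFinB; congr (_%:E); lra.
Qed.

Lemma lebesgue_opp (A : set R) : measurable A -> mu (-%R @^-1` A) = mu A.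
Proof.
move=> mA; have ms : measurable_fun setT (-%R : R -> R) by exact: measurable_funN.
pose nu : {measure set (measurableTypeR R) -> \bar R} :=
  measure_function_pushforward__canonical__measure_function_Measure mu
    (ms : measurable_fun setT (_ : measurableTypeR R -> measurableTypeR R)).
symmetry; apply: (@lebesgue_measure_unique R nu) => // X [[a b] _ <-].
rewrite /nu/= /pushforward.
have -> : -%R @^-1` `]a, b] = `[- b, - a[%classic.
  apply/seteqP; split=> y /=; rewrite !in_itv/= => /andP[? ?];
    by apply/andP; split; lra.
rewrite !lebesgue_measure_itv/= !lte_fin ltrN2; case: ifP => // _.
by rewrite -!EFinB; congr (_%:E); lra.
Qed.

Lemma ge0_integral_shift (h : R) (f : R -> \bar R) : measurable_fun setT f ->
  (forall y, (0 <= f y)%E) -> (\int[mu]_y f (y + h)%R = \int[mu]_y f y)%E.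
Proof.
move=> mf f0; have ms : measurable_fun setT (fun y : R => y + h).
  by apply: measurable_funD => //; exact: measurable_cst.
rewrite -(@ge0_integral_pushforward _ _ (measurableTypeR R) (measurableTypeR R)
  _ _ ms mu setT f)//.
by apply: eq_measure_integral => A mA _; exact: lebesgue_shift.
Qed.

Lemma ge0_integral_opp (f : R -> \bar R) : measurable_fun setT f ->
  (forall y, (0 <= f y)%E) -> (\int[mu]_y f (- y)%R = \int[mu]_y f y)%E.
Proof.
move=> mf f0; have ms : measurable_fun setT (-%R : R -> R) by exact: measurable_funN.
rewrite -(@ge0_integral_pushforward _ _ (measurableTypeR R) (measurableTypeR R)
  _ _ ms mu setT f)//.
by apply: eq_measure_integral => A mA _; exact: lebesgue_opp.
Qed.

Lemma ge0_integral_normal (f : R -> R) : measurable_fun setT f ->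
  (forall y, 0 <= f y) ->
  (\int[gam]_y (f y)%:E = \int[mu]_y (f y * normal_pdf 0 1 y)%:E)%E.
Proof.
move=> mf f0; rewrite (ge0_integral_density (g := normal_pdf 0 1) (mu := mu))//.
- exact: measurable_normal_pdf.
- by move=> y; exact: normal_pdf_ge0.
- exact/measurable_EFinP.
Qed.

Lemma normal_pdf01E (y : R) :
  normal_pdf 0 1 y = normal_peak 1 * expR (- (y ^+ 2) / 2).
Proof.
by rewrite normal_pdfE ?oner_neq0// /normal_fun subr0 expr1n.
Qed.

(** The weight turns the normal density at y into the density at y - h; translation invariance of
    Lebesgue measure does the rest. *)
Lemma gaussian_shift (h : R) (f : R -> R) : measurable_fun setT f ->
  (forall y, 0 <= f y) ->
  (\int[gam]_y (f y * expR (h * y - h ^+ 2 / 2))%:E = \int[gam]_y (f (y + h))%:E)%E.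
Proof.
move=> mf f0.
have mid : measurable_fun setT (fun y : R => y) by [].
have me : measurable_fun setT (fun y : R => expR (h * y - h ^+ 2 / 2)).
  by apply: measurableT_comp => //; apply: measurable_funB => //; exact: measurable_funM.
have ms : measurable_fun setT (fun y : R => y + h).
  by apply: measurable_funD => //; exact: measurable_cst.
have mp := @measurable_normal_pdf R 0 1.
rewrite !ge0_integral_normal; first last.
- by move=> y.
- exact: measurableT_comp.
- by move=> y; rewrite mulr_ge0// expR_ge0.
- exact: measurable_funM.
have pdf_shift y : expR (h * y - h ^+ 2 / 2) * normal_pdf 0 1 y = normal_pdf 0 1 (y - h).
  by rewrite !normal_pdf01E mulrCA -expRD; congr (_ * expR _); field.
transitivity (\int[mu]_y (f y * normal_pdf 0 1 (y - h))%:E)%E.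
  by apply: eq_integral => y _; rewrite -mulrA pdf_shift.
have mfs : measurable_fun setT (fun y => (f y * normal_pdf 0 1 (y - h))%:E).
  apply/measurable_EFinP; apply: measurable_funM => //.
  apply: measurableT_comp => //.
  by apply: measurable_funD => //; exact: measurable_cst.
have fs0 y : (0 <= (f y * normal_pdf 0 1 (y - h))%:E)%E.
  by rewrite lee_fin mulr_ge0// normal_pdf_ge0.
rewrite -(ge0_integral_shift h mfs fs0).
by apply: eq_integral => y _; rewrite addrK.
Qed.

Lemma gaussian_opp (f : R -> R) : measurable_fun setT f -> (forall y, 0 <= f y) ->
  (\int[gam]_y (f (- y))%:E = \int[gam]_y (f y)%:E)%E.
Proof.
move=> mf f0.
have ms : measurable_fun setT (-%R : R -> R) by exact: measurable_funN.
have mp := @measurable_normal_pdf R 0 1.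
rewrite !ge0_integral_normal//; last exact: measurableT_comp.
have mfp : measurable_fun setT (fun y => (f y * normal_pdf 0 1 y)%:E).
  by apply/measurable_EFinP; exact: measurable_funM.
have fp0 y : (0 <= (f y * normal_pdf 0 1 y)%:E)%E.
  by rewrite lee_fin mulr_ge0// normal_pdf_ge0.
rewrite -(ge0_integral_opp mfp fp0).
by apply: eq_integral => y _; rewrite !normal_pdf01E sqrrN.
Qed.

Lemma normal_peakM (s : R) : 0 < s -> s * normal_peak s = normal_peak 1.
Proof.
move=> s0; rewrite /normal_peak expr1n mul1r -mulrnAr sqrtrM ?sqr_ge0//.
by rewrite sqrtr_sqr gtr0_norm// invfM mulVKf// gt_eqF.
Qed.

Lemma normal_pdf_scale (s y : R) : 0 < s ->
  expR ((1 - s ^- 2) / 2 * y ^+ 2) * normal_pdf 0 1 y = s * normal_pdf 0 s y.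
Proof.
move=> s0; have s1 : s != 0 by rewrite gt_eqF.
rewrite normal_pdf01E normal_pdfE// mulrCA -expRD [RHS]mulrA normal_peakM//.
rewrite /normal_fun subr0 -mulr_natr; congr (_ * expR _); field.
exact: s1.
Qed.

(** The integrand times the standard density is [s] times the centered normal density of standard
    deviation [s]. Parametrising the exponent by [s] gives exact values: s = 2 belongs to the
    exponent 3/8, and s close to 1 yields the second moment. *)
Lemma gaussian_exp_sqr (s : R) : 0 < s ->
  (\int[gam]_y (expR ((1 - s ^- 2) / 2 * y ^+ 2))%:E = s%:E)%E.
Proof.
move=> s0.
rewrite ge0_integral_normal; first last.
- by move=> y; exact: expR_ge0.
- by apply: measurableT_comp => //; apply: measurable_funM.
transitivity (\int[mu]_y (s%:E * (normal_pdf 0 s y)%:E))%E.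
  by apply: eq_integral => y _; rewrite -EFinM normal_pdf_scale.
rewrite ge0_integralZl//.
- by rewrite integral_normal_pdf mule1.
- apply/measurable_EFinP; exact: measurable_normal_pdf.
- by move=> y _; rewrite lee_fin normal_pdf_ge0.
- by rewrite lee_fin ltW.
Qed.

Lemma gaussian_mass : (\int[gam]_y 1%:E = 1)%E.
Proof. by rewrite integral_cst// [X in (_ * X)%E]probability_setT mule1. Qed.

End GaussianLine.

(** Marginal laws and independence of the coordinates in a single formula, which reduces sign
    changes and shifts of the vector to one-dimensional integrals. *)
Definition std_gaussian (d : measure_display) (T : measurableType d)
    (R : realType) (P : probability T R) (m : nat) (Z : T -> 'rV[R]_m) : Prop :=
  (forall k, measurable_fun setT (fun w => Z w 0 k)) /\
  (forall phi : 'I_m -> R -> R, (forall k, measurable_fun setT (phi k)) ->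
     (forall k y, 0 <= phi k y) ->
     (\int[P]_w (\prod_k phi k (Z w 0 k))%:E =
      \prod_k \int[normal_prob 0 1]_y (phi k y)%:E)%E).

Lemma prod_indic (R : realType) (m : nat) (B : 'I_m -> set R) (y : 'I_m -> R) :
  \prod_k \1_(B k) (y k) = (`[< forall k, B k (y k) >]%:R : R).
Proof.
case: asboolP => [h|/existsNP[k h]]; last first.
  by rewrite (bigD1 k)//= indicE memNset// mul0r.
by apply: big1 => k _; rewrite indicE mem_set.
Qed.

Section GaussianVector.
Context (d : measure_display) (T : measurableType d) (R : realType)
        (P : probability T R) (m : nat).
Implicit Types Z : T -> 'rV[R]_m.
Notation gam := (@normal_prob R 0 1).
Notation E X := (Rintegral P setT X).

Lemma box_measurable Z (B : 'I_m -> set R) :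
  (forall k, measurable_fun setT (fun w => Z w 0 k)) ->
  (forall k, measurable (B k)) -> measurable [set w | forall k, B k (Z w 0 k)].
Proof.
move=> mZ mB.
have -> : [set w | forall k, B k (Z w 0 k)] =
    \bigcap_(k in setT) ((fun w => Z w 0 k) @^-1` B k).
  by apply/seteqP; split=> w /= h k => [_|]; exact: h.
apply: fin_bigcap_measurable => // k _.
by rewrite -[X in measurable X]setTI; exact: mZ.
Qed.

Lemma prob_boxE Z (B : 'I_m -> set R) :
  (forall k, measurable_fun setT (fun w => Z w 0 k)) ->
  (forall k, measurable (B k)) ->
  P [set w | forall k, B k (Z w 0 k)] =
  (\int[P]_w (\prod_k \1_(B k) (Z w 0 k))%:E)%E.
Proof.
move=> mZ mB; rewrite -[X in P X]setIT -integral_indic//; last exact: box_measurable.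
apply: eq_integral => w _; rewrite prod_indic indicE.
by case: asboolP => h; [rewrite mem_set|rewrite memNset].
Qed.

Lemma std_gaussian_opp Z : std_gaussian P Z -> std_gaussian P (fun w => - Z w).
Proof.
move=> [mZ hZ]; split=> [k|phi mphi phi0].
  rewrite (_ : (fun w => _) = (fun w => - Z w 0 k)); last by apply/funext => w; rewrite mxE.
  exact: measurable_funN.
under eq_integral do under eq_bigr do rewrite mxE.
rewrite (hZ (fun k y => phi k (- y)))//; last first.
  move=> k; apply: measurableT_comp => //; exact: measurable_funN.
by apply: eq_bigr => k _; rewrite gaussian_opp.
Qed.

Lemma std_gaussian_law Z1 Z2 (h : 'rV[R]_m -> \bar R) :
  std_gaussian P Z1 -> std_gaussian P Z2 ->
  measurable_fun setT (h : vecT R m -> \bar R) -> (forall v, (0 <= h v)%E) ->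
  (\int[P]_w h (Z1 w) = \int[P]_w h (Z2 w))%E.
Proof.
move=> [mZ1 hZ1] [mZ2 hZ2]; apply: law_unique => //.
  by rewrite -ge0_fin_numE// fin_num_measure.
move=> B mB; apply: etrans (prob_boxE mZ1 mB) _.
apply: etrans _ (esym (prob_boxE mZ2 mB)).
have mI k : measurable_fun setT (\1_(B k) : R -> R) by exact: measurable_indic.
have I0 k (y : R) : 0 <= \1_(B k) y :> R by [].
by rewrite (hZ1 _ mI I0) (hZ2 _ mI I0).
Qed.

(** The density of the law of Z + h with respect to the law of Z, for a standard Gaussian Z. *)
Definition tilt (h v : 'rV[R]_m) : R := expR (dot h v - norm2 h ^+ 2 / 2).

Lemma tiltE h v : tilt h v = \prod_k expR (h 0 k * v 0 k - h 0 k ^+ 2 / 2).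
Proof.
rewrite /tilt -expR_sum; congr expR.
by rewrite sqr_norm2E mulr_suml -sumrB.
Qed.

(* Cameron-Martin: on boxes both sides factor into one-dimensional shifts. *)
Lemma cameron_martin Z (a : 'rV[R]_m) (h : 'rV[R]_m -> \bar R) :
  std_gaussian P Z ->
  measurable_fun setT (h : vecT R m -> \bar R) -> (forall v, (0 <= h v)%E) ->
  (\int[P]_w (h (Z w) * (tilt a (Z w))%:E) = \int[P]_w h (Z w + a)%R)%E.
Proof.
move=> [mZ hZ] mh h0.
have mt k : measurable_fun setT (fun y : R => expR (a 0 k * y - a 0 k ^+ 2 / 2)).
  by apply: measurableT_comp => //; apply: measurable_funB => //; exact: measurable_funM.
have mg : measurable_fun setT (fun w => tilt a (Z w)).
  rewrite (_ : (fun w => _) =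
    (fun w => \prod_k expR (a 0 k * Z w 0 k - a 0 k ^+ 2 / 2))); last first.
    by apply/funext => w; rewrite tiltE.
  apply: measurable_prod => k _; exact: (measurableT_comp (mt k) (mZ k)).
have g0 w : 0 <= tilt a (Z w) by exact: expR_ge0.
have mZa k : measurable_fun setT (fun w => (Z w + a) 0 k).
  rewrite (_ : (fun w => _) = (fun w => Z w 0 k + a 0 k)); last first.
    by apply/funext => w; rewrite mxE.
  by apply: measurable_funD => //; exact: measurable_cst.
have eqB (B : 'I_m -> set R) : (forall k, measurable (B k)) ->
   mdensity P mg g0 [set w | forall k, B k (Z w 0 k)] =
   P [set w | forall k, B k ((Z w + a) 0 k)].
  move=> mB; rewrite prob_boxE// /mdensity integral_mkcond.
  transitivity (\int[P]_w (\prod_k (\1_(B k) (Z w 0 k) *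
       expR (a 0 k * Z w 0 k - a 0 k ^+ 2 / 2)))%:E)%E.
    apply: eq_integral => w _; rewrite big_split/= -tiltE prod_indic patchE.
    by case: asboolP => hB; [rewrite mem_set// mul1r|rewrite memNset// mul0r].
  rewrite (hZ (fun k y => \1_(B k) y * expR (a 0 k * y - a 0 k ^+ 2 / 2))); first last.
  - by move=> k y; rewrite mulr_ge0// expR_ge0.
  - by move=> k; apply: measurable_funM => //; exact: measurable_indic.
  under eq_bigr do rewrite gaussian_shift//.
  under [RHS]eq_integral do under eq_bigr do rewrite mxE.
  rewrite (hZ (fun k y => \1_(B k) (y + a 0 k)))// => k.
  apply: (measurableT_comp (measurable_indic (mB k))).
  by apply: measurable_funD => //; exact: measurable_cst.
rewrite -(ge0_integral_density (nu := mdensity P mg g0))//; last first.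
  exact: (measurableT_comp mh (measurable_to_vec mZ)).
apply: (law_unique (mu1 := mdensity P mg g0) (mu2 := P)) => //.
(* The tilted measure is finite: its total mass is its value on the box that is the whole space. *)
have := eqB (fun=> setT) (fun=> measurableT).
rewrite (_ : [set w | _] = setT); last by apply/seteqP; split.
move=> eT; apply: (@le_lt_trans _ _ (P setT)); first by rewrite -eT.
by rewrite -ge0_fin_numE// fin_num_measure.
Qed.

(** Extends an identity for nonnegative functions to real ones by positive and negative parts. The
    weight [g] is 1 when both vectors have the same law and the tilt when the second one is a shift
    of the first. *)
Lemma transfer_real (Z1 Z2 : T -> 'rV[R]_m) (g : T -> R) (Phi : 'rV[R]_m -> R) :
  (forall k, measurable_fun setT (fun w => Z1 w 0 k)) ->
  (forall k, measurable_fun setT (fun w => Z2 w 0 k)) ->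
  measurable_fun setT g -> (forall w, 0 <= g w) ->
  (forall h : 'rV[R]_m -> \bar R, measurable_fun setT (h : vecT R m -> \bar R) ->
     (forall v, (0 <= h v)%E) ->
     (\int[P]_w (h (Z1 w) * (g w)%:E) = \int[P]_w h (Z2 w))%E) ->
  measurable_fun setT (Phi : vecT R m -> R) ->
  L1 P (fun w => Phi (Z1 w) * g w) ->
  L1 P (fun w => Phi (Z2 w)) /\
  E (fun w => Phi (Z2 w)) = E (fun w => Phi (Z1 w) * g w).
Proof.
move=> mZ1 mZ2 mg g0 H mPhi iPhi.
pose pos v := Num.max (Phi v) 0; pose neg v := Num.max (- Phi v) 0.
have mpos : measurable_fun setT (pos : vecT R m -> R).
  by apply: measurable_maxr => //; exact: measurable_cst.
have mneg : measurable_fun setT (neg : vecT R m -> R).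
  by apply: measurable_maxr; [exact: measurable_funN|exact: measurable_cst].
have pos0 v : 0 <= pos v by rewrite le_max lexx orbT.
have neg0 v : 0 <= neg v by rewrite le_max lexx orbT.
have PhiE v : Phi v = pos v - neg v.
  by rewrite /pos /neg; case: (leP (Phi v) 0); case: (leP (- Phi v) 0); lra.
have posle v : `|pos v| <= `|Phi v| by rewrite ger0_norm// ge_max ler_norm normr_ge0.
have negle v : `|neg v| <= `|Phi v|.
  by rewrite ger0_norm// ge_max normr_ge0 andbT -normrN ler_norm.
have main (q : 'rV[R]_m -> R) : measurable_fun setT (q : vecT R m -> R) ->
    (forall v, 0 <= q v) -> (forall v, `|q v| <= `|Phi v|) ->
  [/\ L1 P (fun w => q (Z1 w) * g w), L1 P (fun w => q (Z2 w)) &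
      E (fun w => q (Z2 w)) = E (fun w => q (Z1 w) * g w)].
  move=> mq q0 qPhi.
  have mqg : measurable_fun setT (fun w => q (Z1 w) * g w).
    apply: measurable_funM => //.
    exact: (measurableT_comp mq (measurable_to_vec mZ1)).
  have e := H (fun v => (q v)%:E).
  have {e} : (\int[P]_w ((q (Z1 w))%:E * (g w)%:E) = \int[P]_w (q (Z2 w))%:E)%E.
    by apply: e => //; exact/measurable_EFinP.
  under eq_integral do rewrite -EFinM.
  move=> e.
  have i1 : L1 P (fun w => q (Z1 w) * g w).
    apply: le_integrable iPhi => //; first exact/measurable_EFinP.
    by move=> w _; rewrite lee_fin !normrM ler_wpM2r.
  have i2 : L1 P (fun w => q (Z2 w)).
    apply: L1_lty => //; first exact: (measurableT_comp mq (measurable_to_vec mZ2)).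
    by rewrite -e -EFin_E// ltry.
  by split => //; apply: EFin_inj; rewrite !EFin_E.
have [ip1 ip2 ep] := main _ mpos pos0 posle.
have [in1 in2 en] := main _ mneg neg0 negle.
have e1 : (fun w => Phi (Z2 w)) = (fun w => pos (Z2 w) - neg (Z2 w)).
  by apply/funext => w.
have e2 : (fun w => Phi (Z1 w) * g w) =
    (fun w => pos (Z1 w) * g w - neg (Z1 w) * g w).
  by apply/funext => w; rewrite PhiE mulrBl.
by rewrite e1 e2 !E_B// ep en; split => //; exact: L1B.
Qed.

End GaussianVector.

(** * Elementary estimates of the exponential *)

Section ExpBounds.
Variable R : realType.
Implicit Types y t : R.

Lemma expR_ge_sqr y : 0 <= y -> y ^+ 2 <= 4 * expR y.
Proof.
move=> y0; have h := @expR_ge1Dx R (y / 2).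
have -> : expR y = expR (y / 2) ^+ 2 by rewrite expr2 -expRD; congr expR; field.
have : (1 + y / 2) ^+ 2 <= expR (y / 2) ^+ 2.
  by rewrite ler_pXn2r// ?nnegrE ?expR_ge0//; lra.
nra.
Qed.

(** Apply exp y >= 1 + y at y and at -y; the latter gives exp y - 1 <= y exp y. *)
Lemma expR_remainder y : `|expR y - 1 - y| <= y ^+ 2 * expR `|y|.
Proof.
have h1 := @expR_ge1Dx R y; have h2 := @expR_ge1Dx R (- y).
have e1 : expR y * expR (- y) = 1 by rewrite -expRD subrr expR0.
have p1 := expR_gt0 y; rewrite ger0_norm; last by lra.
have h3 : expR y - 1 <= y * expR y by nra.
have [y0|y0] := leP 0 y; first by rewrite ger0_norm//; nra.
have h4 : 1 <= expR `|y| by rewrite -[leLHS]expR0 ler_expR.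
have : y ^+ 2 <= y ^+ 2 * expR `|y| by rewrite ler_peMr// sqr_ge0.
nra.
Qed.

(** Young's inequality. The coefficient of t^2 is 3/8 because exp (3/8 |Z|^2) has a finite mean. *)
Lemma expR_linear_le (b t : R) : expR (b * t) <= expR (2 / 3 * b ^+ 2) * expR (3 / 8 * t ^+ 2).
Proof. by rewrite -expRD ler_expR; have := sqr_ge0 (t - 4 / 3 * b); nra. Qed.

(** Here [y0] stands for <a, v> with |a| = [al] and |v| = [t]. This is the first-order expansion in
    s of the tilt by s a, with a remainder of order s^2 whose factor has a finite Gaussian mean. *)
Lemma tilt_remainder (al t y0 s : R) : 0 <= al -> 0 <= t -> `|y0| <= al * t ->
  0 < s <= 1 ->
  `|expR (s * y0 - s ^+ 2 * al ^+ 2 / 2) - 1 - s * y0| <=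
  s ^+ 2 * ((4 + al ^+ 2) * expR (2 * (al * t + al ^+ 2))).
Proof.
move=> al0 t0 hy /andP[s0 s1]; pose b : R := al * t + al ^+ 2.
have b0 : 0 <= b by rewrite addr_ge0 ?sqr_ge0// mulr_ge0.
set y := s * y0 - _.
have yb : `|y| <= s * b.
  rewrite /y (le_trans (ler_normB _ _))// normrM gtr0_norm//.
  rewrite (ger0_norm (x := s ^+ 2 * _ / 2)); last by rewrite divr_ge0// mulr_ge0// sqr_ge0.
  rewrite /b mulrDr lerD//; first by rewrite ler_pM2l.
  have := sqr_ge0 al; nra.
have s2 : s ^+ 2 <= 1 by nra.
have e1 : y ^+ 2 * expR `|y| <= s ^+ 2 * (4 * expR (2 * b)).
  have y2 : y ^+ 2 <= s ^+ 2 * b ^+ 2.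
    by rewrite -exprMn -real_normK ?num_real// ler_pXn2r// nnegrE ?mulr_ge0// ltW.
  have ey : expR `|y| <= expR b by rewrite ler_expR (le_trans yb)// ler_piMl.
  have := expR_ge_sqr b0; have -> : expR (2 * b) = expR b * expR b.
    by rewrite -expRD; congr expR; ring.
  move=> b2; apply: (@le_trans _ _ (s ^+ 2 * b ^+ 2 * expR b)).
    by rewrite ler_pM// ?sqr_ge0 ?expR_ge0.
  rewrite -mulrA ler_wpM2l ?sqr_ge0// mulrA ler_wpM2r// expR_ge0//.
have -> : expR y - 1 - s * y0 = (expR y - 1 - y) - s ^+ 2 * al ^+ 2 / 2.
  by rewrite {3}/y; ring.
rewrite (le_trans (ler_normB _ _))// (ger0_norm (x := s ^+ 2 * _ / 2)); last first.
  by rewrite divr_ge0// mulr_ge0// sqr_ge0.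
have e2 : 1 <= expR (2 * b) by rewrite -[leLHS]expR0 ler_expR mulr_ge0.
have e3 : s ^+ 2 * al ^+ 2 / 2 <= s ^+ 2 * (al ^+ 2 * expR (2 * b)).
  rewrite -mulrA ler_wpM2l ?sqr_ge0//; have := sqr_ge0 al; nra.
have := expR_remainder y; rewrite -/b; lra.
Qed.

End ExpBounds.

Lemma ler_dist_norm2 (R : realType) m (x y : 'rV[R]_m) :
  `|norm2 x - norm2 y| <= norm2 (x - y).
Proof.
have h1 := ler_norm2D (x - y) y; have h2 := ler_norm2D (y - x) x.
rewrite !subrK in h1 h2; rewrite (norm2_sub y) in h2.
by rewrite ler_norml; apply/andP; split; lra.
Qed.

Lemma measurable_vec_lip (R : realType) m (h : 'rV[R]_m -> R) (C : R) :
  (forall v v', `|h v - h v'| <= C * norm2 (v - v')) ->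
  measurable_fun setT (h : vecT R m -> R).
Proof.
move=> hl; apply: measurable_continuous_vec => v e e0.
have C1 : 0 < `|C| + 1 by rewrite ltr_wpDl.
exists (e / (2 * (`|C| + 1))); first by rewrite divr_gt0 ?mulr_gt0.
move=> v' h'; apply: (le_lt_trans (hl _ _)).
apply: (@le_lt_trans _ _ ((`|C| + 1) * norm2 (v' - v))).
  by rewrite ler_wpM2r ?norm2_ge0// (le_trans (ler_norm C))// lerDl.
apply: (@le_lt_trans _ _ (e / 2)); last by lra.
move: h'; rewrite -(ler_pM2l C1) => /le_trans; apply.
by rewrite le_eqVlt; apply/orP; left; apply/eqP; field; rewrite gt_eqF.
Qed.

Lemma measurable_norm2 (R : realType) m : measurable_fun setT (@norm2 R m : vecT R m -> R).
Proof. by apply: (@measurable_vec_lip _ _ _ 1) => v v'; rewrite mul1r ler_dist_norm2. Qed.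

Lemma measurable_dot (R : realType) m (a : 'rV[R]_m) :
  measurable_fun setT (dot a : vecT R m -> R).
Proof.
apply: (@measurable_vec_lip _ _ _ (norm2 a)) => v v'.
by rewrite -dotBr normr_dot_le.
Qed.

(** * Moments, tails and derivatives under Gaussian vectors *)

Section GaussianMoments.
Context (d : measure_display) (T : measurableType d) (R : realType)
        (P : probability T R) (m : nat) (Z : T -> 'rV[R]_m).
Hypothesis gZ : std_gaussian P Z.
Notation E X := (Rintegral P setT X).
Let mZ := gZ.1.

Lemma measurable_vec_comp (h : 'rV[R]_m -> R) :
  measurable_fun setT (h : vecT R m -> R) -> measurable_fun setT (fun w => h (Z w)).
Proof. by move=> mh; exact: (measurableT_comp mh (measurable_to_vec mZ)). Qed.

(** 3/8 = (1 - 2^-2) / 2 is the exponent that belongs to s = 2 in [gaussian_exp_sqr], and each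
    coordinate contributes a factor 2. *)
Lemma gaussian_expsq :
  L1 P (fun w => expR (3 / 8 * norm2 (Z w) ^+ 2)) /\
  E (fun w => expR (3 / 8 * norm2 (Z w) ^+ 2)) = 2 ^+ m.
Proof.
have me : measurable_fun setT (fun y : R => expR ((1 - 2 ^- 2) / 2 * y ^+ 2)).
  by apply: measurableT_comp => //; apply: measurable_funM.
have ex w : expR (3 / 8 * norm2 (Z w) ^+ 2) =
    \prod_k expR ((1 - 2 ^- 2) / 2 * (Z w 0 k) ^+ 2).
  rewrite -expR_sum sqr_norm2E mulr_sumr; congr expR.
  by apply: eq_bigr => k _; congr (_ * _); field.
have h : (\int[P]_w (expR (3 / 8 * norm2 (Z w) ^+ 2))%:E = (2 ^+ m)%:E)%E.
  under eq_integral do rewrite ex.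
  rewrite (gZ.2 (fun k y => expR ((1 - 2 ^- 2) / 2 * y ^+ 2)))//.
  under eq_bigr do rewrite gaussian_exp_sqr//.
  by rewrite prodEFin prodr_const card_ord.
have i : L1 P (fun w => expR (3 / 8 * norm2 (Z w) ^+ 2)).
  apply: L1_lty; last by rewrite h ltry.
  - apply: measurableT_comp => //; apply: measurable_funM => //.
    by apply: measurable_funX; exact: measurable_vec_comp (@measurable_norm2 R m).
  - by move=> w; exact: expR_ge0.
by split => //; apply: EFin_inj; rewrite EFin_E.
Qed.

Lemma gaussian_dom (h : 'rV[R]_m -> R) (C : R) :
  measurable_fun setT (h : vecT R m -> R) ->
  (forall v, `|h v| <= C * expR (3 / 8 * norm2 v ^+ 2)) -> L1 P (fun w => h (Z w)).
Proof.
move=> mh hC; apply: (L1_dom _ (L1Z C gaussian_expsq.1)) => //.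
exact: measurable_vec_comp.
Qed.

(** With a = (1 - s^-2) / 2, the identity E exp (a Z_k^2) = s and 1 + y <= exp y give E Z_k^2 <= (s
    - 1) / a = 2 s^2 / (s + 1), which tends to 1 as s decreases to 1. *)
Lemma gaussian_coord_sqr k :
  L1 P (fun w => Z w 0 k ^+ 2) /\ E (fun w => Z w 0 k ^+ 2) <= 1.
Proof.
have main (s : R) : 1 < s -> L1 P (fun w => Z w 0 k ^+ 2) /\
    E (fun w => Z w 0 k ^+ 2) <= 2 * s ^+ 2 / (s + 1).
  move=> s1; have s0 : 0 < s by lra.
  pose a : R := (1 - s ^- 2) / 2.
  have a0 : 0 < a.
    rewrite divr_gt0// subr_gt0 invf_lt1 ?exprn_gt0//; nra.
  have me : measurable_fun setT (fun y : R => expR (a * y ^+ 2)).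
    by apply: measurableT_comp => //; apply: measurable_funM.
  have h : (\int[P]_w (expR (a * Z w 0 k ^+ 2))%:E = s%:E)%E.
    have := gZ.2 (fun j y => if j == k then expR (a * y ^+ 2) else 1).
    rewrite (bigD1 k)//= eqxx gaussian_exp_sqr// big1 ?mule1 => [|j jk]; last first.
      by rewrite (negbTE jk) gaussian_mass.
    move=> <-.
    - apply: eq_integral => w _; rewrite (bigD1 k)//= eqxx big1 ?mulr1// => j jk.
      by rewrite (negbTE jk).
    - by move=> j; case: (j == k) => //; exact: measurable_cst.
    - by move=> j y; case: (j == k) => //; exact: expR_ge0.
  have i : L1 P (fun w => expR (a * Z w 0 k ^+ 2)).
    apply: L1_lty; last by rewrite h ltry.
    - exact: (measurableT_comp me (mZ k)).
    - by move=> w; exact: expR_ge0.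
  have Es : E (fun w => expR (a * Z w 0 k ^+ 2)) = s.
    by apply: EFin_inj; rewrite EFin_E.
  have i2 : L1 P (fun w => Z w 0 k ^+ 2).
    apply: (L1_dom _ (L1Z a^-1 i)); first by apply: measurable_funX.
    move=> w; rewrite ger0_norm ?sqr_ge0// mulrC ler_pdivlMr//.
    have := @expR_ge1Dx R (a * Z w 0 k ^+ 2); lra.
  split=> //; rewrite ler_pdivlMr; last by lra.
  have h2 : a * E (fun w => Z w 0 k ^+ 2) <= s - 1.
    rewrite -Es -E_Z// -[X in _ - X](E_cst P) -E_B//; last exact: L1_cst.
    apply: E_le; [exact: L1Z|by apply: L1B => //; exact: L1_cst|].
    by move=> w; have := @expR_ge1Dx R (a * Z w 0 k ^+ 2); lra.
  have ae : a * (2 * s ^+ 2) = s ^+ 2 - 1.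
    by rewrite /a; field; rewrite gt_eqF.
  have h3 : (s ^+ 2 - 1) * E (fun w => Z w 0 k ^+ 2) <= 2 * s ^+ 2 * (s - 1).
    have : 2 * s ^+ 2 * (a * E (fun w => Z w 0 k ^+ 2)) <= 2 * s ^+ 2 * (s - 1).
      by apply: ler_wpM2l => //; rewrite mulr_ge0// sqr_ge0.
    by rewrite -ae; lra.
  have s10 : 0 < s - 1 by lra.
  by rewrite -(ler_pM2r s10); move: h3; lra.
have [i _] := main 2 ltac:(lra); split=> //.
apply/ler_addgt0Pr => t t0; pose s : R := 1 + t / 2.
have s1 : 1 < s by rewrite /s; lra.
apply: (le_trans (main s s1).2); rewrite ler_pdivrMr /s; nra.
Qed.

Lemma gaussian_norm_sqr :
  L1 P (fun w => norm2 (Z w) ^+ 2) /\ E (fun w => norm2 (Z w) ^+ 2) <= m%:R.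
Proof.
have e : (fun w => norm2 (Z w) ^+ 2) = (fun w => \sum_k Z w 0 k ^+ 2).
  by apply/funext => w; rewrite sqr_norm2E.
have i k := (gaussian_coord_sqr k).1.
rewrite e; split; first exact: L1_sum.
rewrite E_sum// -[in leRHS](card_ord m) -sumr_const.
by apply: ler_sum => k _; exact: (gaussian_coord_sqr k).2.
Qed.

Definition tailind (rho : R) (v : 'rV[R]_m) : R := \1_[set v | rho <= norm2 v] v.

Lemma measurable_tailind rho : measurable_fun setT (tailind rho : vecT R m -> R).
Proof.
apply: measurable_indic; have := @measurable_norm2 R m measurableT `[rho, +oo[%classic.
rewrite setTI => /(_ (measurable_itv _)); congr (measurable _).
by apply/seteqP; split=> v /=; rewrite in_itv/= andbT.
Qed.

Lemma tailindE rho v : tailind rho v = (rho <= norm2 v)%R%:R.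
Proof.
rewrite /tailind indicE; case: (leP rho (norm2 v)) => h; first by rewrite mem_set.
by rewrite memNset//= => h'; move: h; rewrite ltNge h'.
Qed.

(** Bound |v|^2 by 8 exp (|v|^2 / 8) and write 1/8 = 3/8 - 1/4: since |v| >= rho on the tail, the
    part with -1/4 produces exp (- rho^2 / 4). *)
Lemma gaussian_tail (rho : R) : 0 <= rho ->
  L1 P (fun w => norm2 (Z w) ^+ 2 * tailind rho (Z w)) /\
  E (fun w => norm2 (Z w) ^+ 2 * tailind rho (Z w)) <=
    8 * 2 ^+ m * expR (- (rho ^+ 2 / 4)).
Proof.
move=> rho0.
have bnd (v : 'rV[R]_m) : `|norm2 v ^+ 2 * tailind rho v| <=
    8 * expR (- (rho ^+ 2 / 4)) * expR (3 / 8 * norm2 v ^+ 2).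
  rewrite tailindE ger0_norm; last by rewrite mulr_ge0 ?sqr_ge0.
  case: (boolP (rho <= norm2 v)) => h /=; last by rewrite mulr0 !mulr_ge0 ?expR_ge0.
  have h1 := @expR_ge1Dx R (norm2 v ^+ 2 / 8).
  rewrite mulr1 -mulrA -expRD.
  have : expR (norm2 v ^+ 2 / 8) <= expR (- (rho ^+ 2 / 4) + 3 / 8 * norm2 v ^+ 2).
    rewrite ler_expR; have : rho ^+ 2 <= norm2 v ^+ 2.
      by rewrite ler_pXn2r// nnegrE norm2_ge0.
    lra.
  lra.
have i : L1 P (fun w => norm2 (Z w) ^+ 2 * tailind rho (Z w)).
  apply: (gaussian_dom (h := fun v => norm2 v ^+ 2 * tailind rho v)) bnd.
  apply: measurable_funM; last exact: measurable_tailind.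
  by apply: measurable_funX; exact: measurable_norm2.
split=> //; apply: (@le_trans _ _
  (E (fun w => 8 * expR (- (rho ^+ 2 / 4)) * expR (3 / 8 * norm2 (Z w) ^+ 2)))).
  apply: E_le => //; first by apply: L1Z; exact: gaussian_expsq.1.
  by move=> w; exact: le_trans (ler_norm _) (bnd _).
rewrite E_Z; last exact: gaussian_expsq.1.
by rewrite gaussian_expsq.2 -mulrA (mulrC (expR _)) mulrA.
Qed.

(** The inequality y^2 <= 4 exp y at y = 3/8 |v|^2 gives the constant 256/9, rounded up to 32. *)
Lemma gaussian_norm_four :
  L1 P (fun w => norm2 (Z w) ^+ 4) /\ E (fun w => norm2 (Z w) ^+ 4) <= 32 * 2 ^+ m.
Proof.
have bnd (v : 'rV[R]_m) : `|norm2 v ^+ 4| <= 32 * expR (3 / 8 * norm2 v ^+ 2).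
  rewrite ger0_norm ?exprn_ge0 ?norm2_ge0//.
  have h0 : 0 <= 3 / 8 * norm2 v ^+ 2 by rewrite mulr_ge0// sqr_ge0.
  have := expR_ge_sqr h0; have -> : norm2 v ^+ 4 = (norm2 v ^+ 2) ^+ 2 by rewrite -exprM.
  have := expR_ge0 (3 / 8 * norm2 v ^+ 2); lra.
have i : L1 P (fun w => norm2 (Z w) ^+ 4).
  apply: (gaussian_dom (h := fun v => norm2 v ^+ 4)) bnd.
  by apply: measurable_funX; exact: measurable_norm2.
split=> //; apply: (@le_trans _ _ (E (fun w => 32 * expR (3 / 8 * norm2 (Z w) ^+ 2)))).
  apply: E_le => //; first by apply: L1Z; exact: gaussian_expsq.1.
  by move=> w; exact: le_trans (ler_norm _) (bnd _).
by rewrite E_Z ?gaussian_expsq.2//; exact: gaussian_expsq.1.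
Qed.

(* By Cameron-Martin, the left-hand side is the derivative at 0 of
   [s |-> E (h (Z + s a))]. *)
Lemma gaussian_derivative_le (h : 'rV[R]_m -> R) (C : R) (a : 'rV[R]_m) (A : R) :
  (forall v v', `|h v - h v'| <= C * norm2 (v - v')) ->
  (forall s : R, 0 < s <= 1 ->
     E (fun w => h (Z w + s *: a)) - E (fun w => h (Z w)) <= s * A) ->
  L1 P (fun w => h (Z w) * dot a (Z w)) /\ E (fun w => h (Z w) * dot a (Z w)) <= A.
Proof.
move=> hl hA; pose al : R := norm2 a; pose K0 : R := `|h 0| + `|C|.
have al0 : 0 <= al := norm2_ge0 a.
have mh := measurable_vec_lip hl.
have hb v : `|h v| <= K0 * expR (norm2 v).
  have := hl v 0; rewrite subr0 => h1.
  have h2 : `|h v| <= `|h 0| + `|C| * norm2 v.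
    rewrite -lerBlDl (le_trans (lerB_dist _ _))// (le_trans h1)//.
    by rewrite ler_wpM2r ?norm2_ge0// ler_norm.
  apply: (le_trans h2); rewrite mulrDl.
  have e1 := @expR_ge1Dx R (norm2 v); have t0 := norm2_ge0 v.
  by apply: lerD; [rewrite ler_peMr//; lra|rewrite ler_wpM2l//; lra].
(* The constant of the remainder [rem] after exponentials of multiples of |v| have been traded for
   exp (3/8 |v|^2); in 2 al + 1 the first summand comes from the tilt and the second from the growth
   of [h]. *)
pose K : R := K0 * ((4 + al ^+ 2) * expR (2 * al ^+ 2)) * expR (2 / 3 * (2 * al + 1) ^+ 2).
have K00 : 0 <= K0 by rewrite addr_ge0.
have rem (s : R) v : 0 < s <= 1 ->
    `|h v * tilt (s *: a) v - h v - s * (h v * dot a v)| <=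
    s ^+ 2 * (K * expR (3 / 8 * norm2 v ^+ 2)).
  move=> s01; have -> : h v * tilt (s *: a) v - h v - s * (h v * dot a v) =
      h v * (tilt (s *: a) v - 1 - s * dot a v) by ring.
  rewrite normrM /tilt dotZl norm2Z (gtr0_norm (x := s)) ?(andP s01).1// exprMn.
  apply: (le_trans (ler_pM (normr_ge0 _) (normr_ge0 _) (hb v)
    (tilt_remainder al0 (norm2_ge0 v) (normr_dot_le a v) s01))).
  rewrite mulrCA ler_wpM2l ?sqr_ge0// /K -!mulrA ler_wpM2l//.
  rewrite mulrCA ler_wpM2l ?addr_ge0 ?sqr_ge0// -/al.
  have -> : expR (2 * (al * norm2 v + al ^+ 2)) =
      expR (2 * al ^+ 2) * expR (2 * al * norm2 v).
    by rewrite -expRD; congr expR; ring.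
  rewrite mulrCA ler_wpM2l ?expR_ge0// -expRD.
  by have := expR_linear_le (2 * al + 1) (norm2 v); rewrite -!expRD !ler_expR; lra.
have mdot : measurable_fun setT ((fun v => h v * dot a v) : vecT R m -> R).
  by apply: measurable_funM => //; exact: measurable_dot.
have ih : L1 P (fun w => h (Z w)).
  apply: (gaussian_dom (h := h) (C := K0 * expR (2 / 3 * 1 ^+ 2))) => // v.
  apply: (le_trans (hb v)); rewrite -mulrA ler_wpM2l//.
  by have := expR_linear_le 1 (norm2 v); rewrite mul1r.
have idot : L1 P (fun w => h (Z w) * dot a (Z w)).
  apply: (gaussian_dom (h := fun v => h v * dot a v)
    (C := K0 * (al * expR (2 / 3 * 2 ^+ 2)))) => // v.
  rewrite normrM; apply: (le_trans (ler_pM (normr_ge0 _) (normr_ge0 _) (hb v)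
    (normr_dot_le a v))).
  rewrite -!mulrA ler_wpM2l// mulrCA ler_wpM2l//.
  apply: (@le_trans _ _ (expR (2 * norm2 v))); last first.
    by have := expR_linear_le 2 (norm2 v); rewrite -!expRD !ler_expR; lra.
  have -> : expR (2 * norm2 v) = expR (norm2 v) * expR (norm2 v).
    by rewrite -expRD; congr expR; ring.
  rewrite ler_wpM2l ?expR_ge0//; have := @expR_ge1Dx R (norm2 v); lra.
have mtilt b : measurable_fun setT (fun v : vecT R m => tilt b v).
  have mb : measurable_fun setT (fun v : vecT R m => dot b v - norm2 b ^+ 2 / 2).
    by apply: measurable_funB; [exact: measurable_dot|exact: measurable_cst].
  exact: (measurableT_comp (@measurable_expR R) mb).
split=> //; pose M : R := K * 2 ^+ m.
have K1 : 0 <= K by rewrite !mulr_ge0 ?expR_ge0// addr_ge0// sqr_ge0.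
have M0 : 0 <= M by rewrite mulr_ge0// exprn_ge0.
(* Tilting by s a amounts to shifting Z by s a, so the assumed bound s A on the increment controls s
   E (h <a, Z>) up to s^2 M. Division by s leaves an error that vanishes with s. *)
have step (s : R) : 0 < s <= 1 -> E (fun w => h (Z w) * dot a (Z w)) <= A + s * M.
  move=> s01; have s0 := (andP s01).1.
  pose X w := h (Z w) * tilt (s *: a) (Z w) - h (Z w) - s * (h (Z w) * dot a (Z w)).
  have iM : L1 P (fun w => s ^+ 2 * (K * expR (3 / 8 * norm2 (Z w) ^+ 2))).
    by apply: L1Z; apply: L1Z; exact: gaussian_expsq.1.
  have mX : measurable_fun setT X.
    rewrite /X; apply: measurable_funB; last first.
      apply: measurable_funM; first exact: measurable_cst.
      exact: (measurable_vec_comp mdot).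
    apply: measurable_funB; last exact: measurable_vec_comp.
    apply: measurable_funM; first exact: measurable_vec_comp.
    exact: (measurable_vec_comp (mtilt _)).
  have iX : L1 P X by apply: (L1_dom mX iM) => w; exact: rem.
  have iT : L1 P (fun w => h (Z w) * tilt (s *: a) (Z w)).
    apply: (L1_ext _ (L1D (L1D iX ih) (L1Z s idot))) => w.
    by rewrite /X; ring.
  have mZa k : measurable_fun setT (fun w => (Z w + s *: a) 0 k).
    rewrite (_ : (fun w => _) = (fun w => Z w 0 k + (s *: a) 0 k)); last first.
      by apply/funext => w; rewrite mxE.
    by apply: measurable_funD => //; exact: measurable_cst.
  have [_ eT] := @transfer_real _ T R P m Z (fun w => Z w + s *: a)
    (fun w => tilt (s *: a) (Z w)) h mZ
    mZa (measurable_vec_comp (mtilt _)) (fun w => expR_ge0 _)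
    (fun h' mh' h'0 => cameron_martin _ gZ mh' h'0) mh iT.
  have EX : `|E X| <= s ^+ 2 * M.
    apply: (le_trans (normr_E_le iX iM (fun w => rem s (Z w) s01))).
    rewrite E_Z; last by apply: L1Z; exact: gaussian_expsq.1.
    by rewrite E_Z ?gaussian_expsq.2//; exact: gaussian_expsq.1.
  have eX : E X = E (fun w => h (Z w + s *: a)) - E (fun w => h (Z w))
                  - s * E (fun w => h (Z w) * dot a (Z w)).
    by rewrite /X E_B ?E_B ?E_Z ?eT//; [exact: L1B|exact: L1Z].
  have := hA s s01; move: EX; rewrite eX ler_norml => /andP[h1 _] h2.
  have : s * E (fun w => h (Z w) * dot a (Z w)) <= s * (A + s * M) by lra.
  by rewrite ler_pM2l.
apply/ler_addgt0Pr => e e0; pose s : R := Num.min 1 (e / (M + 1)).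
have M1 : 0 < M + 1 by lra.
have s0 : 0 < s by rewrite lt_min ltr01 divr_gt0.
have s01 : 0 < s <= 1 by rewrite s0 ge_min lexx.
apply: (le_trans (step s s01)); rewrite lerD2l.
have : s <= e / (M + 1) by rewrite ge_min lexx orbT.
rewrite ler_pdivlMr//; nra.
Qed.

End GaussianMoments.

(** * Gaussian smoothing of a convex function *)

Section Smoothing.
Context (d : measure_display) (T : measurableType d) (R : realType)
        (P : probability T R) (m : nat).
Implicit Types Z : T -> 'rV[R]_m.
Notation E X := (Rintegral P setT X).

Lemma std_gaussian_law_real Z1 Z2 (h : 'rV[R]_m -> R) :
  std_gaussian P Z1 -> std_gaussian P Z2 ->
  measurable_fun setT (h : vecT R m -> R) -> L1 P (fun w => h (Z1 w)) ->
  L1 P (fun w => h (Z2 w)) /\ E (fun w => h (Z2 w)) = E (fun w => h (Z1 w)).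
Proof.
move=> g1 g2 mh ih.
have e : (fun w => h (Z1 w)) = (fun w => h (Z1 w) * 1).
  by apply/funext => w; rewrite mulr1.
rewrite e in ih *.
apply: (transfer_real g1.1 g2.1 _ _ _ mh ih) => // k mk k0.
rewrite (std_gaussian_law g2 g1)//.
by apply: eq_integral => w _; rewrite mule1.
Qed.

Lemma gaussian_lip_L1 Z (h : 'rV[R]_m -> R) (C : R) : std_gaussian P Z ->
  (forall v v', `|h v - h v'| <= C * norm2 (v - v')) -> L1 P (fun w => h (Z w)).
Proof.
move=> gZ hl; have [i _] := gaussian_norm_sqr gZ.
apply: (L1_dom _ (L1D (L1_cst P (`|h 0| + `|C|)) (L1Z `|C| i))).
  exact: (measurable_vec_comp gZ (measurable_vec_lip hl)).
move=> w; have := hl (Z w) 0; rewrite subr0 => h1.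
have h2 : `|h (Z w)| <= `|h 0| + C * norm2 (Z w).
  by rewrite -lerBlDl (le_trans (lerB_dist _ _)).
have h3 := ler_norm C; have h4 := normr_ge0 C.
have h5 : C * norm2 (Z w) <= `|C| * norm2 (Z w) by rewrite ler_wpM2r ?norm2_ge0.
have h6 : norm2 (Z w) <= 1 + norm2 (Z w) ^+ 2 by nra.
have h7 : `|C| * norm2 (Z w) <= `|C| * (1 + norm2 (Z w) ^+ 2) by rewrite ler_wpM2l.
lra.
Qed.

(* The Gaussian smoothing of [phi] is convex along the segment from [x] to [y]
   up to a tail error, and it dominates [phi] at [x]. *)
Lemma smoothing_le Z (phi : 'rV[R]_m -> R) (G u rho K : R) (x y : 'rV[R]_m) :
  std_gaussian P Z -> 0 <= G -> 0 < u -> 1 <= rho -> 0 <= K ->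
  (forall v v', `|phi v - phi v'| <= G * norm2 (v - v')) ->
  (forall z s, norm2 z < rho -> 0 <= s <= 1 ->
     phi ((1 - s) *: x + s *: y + u *: z) <=
     (1 - s) * phi (x + u *: z) + s * phi (y + u *: z)) ->
  (forall z, norm2 z < rho -> 2 * phi x <= phi (x + u *: z) + phi (x - u *: z)) ->
  (forall z, norm2 z < rho ->
     phi (y + u *: z) + phi (y - u *: z) <= 2 * phi y + 2 * K * (u ^+ 2 * norm2 z ^+ 2)) ->
  phi x - phi y - K * u ^+ 2 * m%:R
    - 2 * G * norm2 (x - y) * E (fun w => norm2 (Z w) ^+ 2 * tailind rho (Z w)) <=
  E (fun w => (phi (x + u *: Z w) - phi (x - u *: Z w)) / (2 * u) * dot (Z w) (x - y)).
Proof.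
move=> gZ G0 u0 rho1 K0 lip conv mid sm.
pose c : R := G * norm2 (x - y); pose v0 := x - y.
have c0 : 0 <= c by rewrite mulr_ge0// norm2_ge0.
have u1 : u != 0 by rewrite gt_eqF.
have lipx (p : 'rV[R]_m) (v v' : 'rV[R]_m) :
    `|phi (p + u *: v) - phi (p + u *: v')| <= G * u * norm2 (v - v').
  apply: (le_trans (lip _ _)); rewrite -mulrA ler_wpM2l//.
  have -> : p + u *: v - (p + u *: v') = u *: (v - v').
    by apply/rowP => k; rewrite !mxE; ring.
  by rewrite norm2Z gtr0_norm.
pose h (v : 'rV[R]_m) := phi (x + u *: v); pose hy (v : 'rV[R]_m) := phi (y + u *: v).
pose tau (v : 'rV[R]_m) := tailind rho v.
have tauN v : tau (- v) = tau v by rewrite /tau !tailindE norm2N.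
have tauP v : (tau v = 1) \/ (tau v = 0 /\ norm2 v < rho).
  rewrite /tau tailindE; case: (leP rho (norm2 v)) => hv; [left|right] => //.
pose q (v : 'rV[R]_m) := (hy v - h v) * (1 - tau v).
have mtau : measurable_fun setT (tau : vecT R m -> R) := @measurable_tailind R m rho.
have mh := measurable_vec_lip (lipx x); have mhy := measurable_vec_lip (lipx y).
have mq : measurable_fun setT (q : vecT R m -> R).
  apply: measurable_funM; first exact: measurable_funB.
  by apply: measurable_funB => //; exact: measurable_cst.
have hyx v : `|hy v - h v| <= c.
  apply: (le_trans (lip _ _)); rewrite ler_wpM2l// norm2_sub.
  by have -> : x + u *: v - (y + u *: v) = x - y by apply/rowP => k; rewrite !mxE; ring.
have itau : L1 P (fun w => tau (Z w)).
  apply: (@L1_bounded _ _ _ _ _ 1); first exact: (measurable_vec_comp gZ mtau).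
  by move=> w; case: (tauP (Z w)) => [->|[-> _]]; rewrite ?normr1 ?normr0.
have qb v : `|q v| <= c.
  rewrite /q; case: (tauP v) => [->|[-> _]]; first by rewrite subrr mulr0 normr0.
  by rewrite subr0 mulr1.
have iq : L1 P (fun w => q (Z w)).
  by apply: (@L1_bounded _ _ _ _ _ c) => //; exact: (measurable_vec_comp gZ mq).
have ih : L1 P (fun w => h (Z w)) by exact: gaussian_lip_L1 (lipx x).
pose A : R := E (fun w => q (Z w)) + c * E (fun w => tau (Z w)).
(* Shifting Z by - s (x - y) / u moves x + u Z by the fraction s of the way towards y + u Z, so that
   convexity along this segment applies. *)
have hA (s : R) : 0 < s <= 1 ->
    E (fun w => h (Z w + s *: - (u^-1 *: v0))) - E (fun w => h (Z w)) <= s * A.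
  move=> /andP[s0 s1]; rewrite /A.
  have eq_s w : h (Z w + s *: - (u^-1 *: v0)) =
      phi ((1 - s) *: x + s *: y + u *: Z w).
    congr phi; rewrite /v0; apply/rowP => k; rewrite !mxE; field.
    exact: u1.
  have lips (v v' : 'rV[R]_m) :
      `|h (v + s *: - (u^-1 *: v0)) - h (v' + s *: - (u^-1 *: v0))| <=
      G * u * norm2 (v - v').
    apply: (le_trans (lipx x _ _)); rewrite le_eqVlt; apply/orP; left; apply/eqP.
    by congr (_ * norm2 _); apply/rowP => k; rewrite !mxE; ring.
  have is1 : L1 P (fun w => h (Z w + s *: - (u^-1 *: v0))).
    exact: gaussian_lip_L1 lips.
  rewrite -E_B// -E_Z// -E_D//; last exact: L1Z.
  rewrite -E_Z; last by apply: L1D => //; exact: L1Z.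
  apply: E_le; first exact: L1B.
    by apply: L1Z; apply: L1D => //; exact: L1Z.
  move=> w; rewrite -/(h _) eq_s /q.
  case: (tauP (Z w)) => [->|[-> zr]].
    rewrite subrr mulr0 add0r mulr1.
    apply: (le_trans (ler_norm _)); apply: (le_trans (lip _ _)).
    have -> : (1 - s) *: x + s *: y + u *: Z w - (x + u *: Z w) = - (s *: (x - y)).
      by apply/rowP => k; rewrite !mxE; ring.
    rewrite norm2N norm2Z gtr0_norm// /c; lra.
  have := conv (Z w) s zr; rewrite (ltW s0) s1 => /(_ isT); rewrite /h /hy; lra.
have [idot le1] := gaussian_derivative_le gZ (lipx x) hA.
have gN := std_gaussian_opp gZ.
have idv : L1 P (fun w => h (Z w) * dot v0 (Z w)).
  apply: (L1_ext _ (L1Z (- u) idot)) => w; rewrite dotNl dotZl /h.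
  by field.
have Eidv : E (fun w => h (Z w) * dot v0 (Z w)) =
    - u * E (fun w => phi (x + u *: Z w) * dot (- (u^-1 *: v0)) (Z w)).
  rewrite -E_Z//; apply: E_ext => w; rewrite dotNl dotZl /h; field.
  exact: u1.
have mhd : measurable_fun setT ((fun v => h v * dot v0 v) : vecT R m -> R).
  by apply: measurable_funM => //; exact: measurable_dot.
have [idN EdN] := std_gaussian_law_real gZ gN mhd idv.
(* Since -Z is again standard Gaussian, both halves of the central difference have the same mean,
   which reduces it to the derivative just estimated. *)
have target : E (fun w => (phi (x + u *: Z w) - phi (x - u *: Z w)) / (2 * u)
                          * dot (Z w) (x - y)) =
    - E (fun w => phi (x + u *: Z w) * dot (- (u^-1 *: v0)) (Z w)).
  transitivity (E (fun w => (2 * u)^-1 * (h (Z w) * dot v0 (Z w) +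
                             h (- Z w) * dot v0 (- Z w)))).
    apply: E_ext => w; rewrite /h dotNr (dotC (Z w)) -/v0 scalerN; field.
    exact: u1.
  rewrite E_Z; last exact: L1D.
  rewrite E_D// EdN Eidv; field; exact: u1.
rewrite target lerNr; apply: (le_trans le1).
have [iqN EqN] := std_gaussian_law_real gZ gN mq iq.
have [inn Enn] := gaussian_norm_sqr gZ.
have itt : L1 P (fun w => norm2 (Z w) ^+ 2 * tau (Z w)).
  by have [] := gaussian_tail gZ (rho := rho) ltac:(lra).
(* Here 1 <= rho enters: on the tail 1 <= |Z|^2, so that a single tail moment covers all error
   terms. *)
have Etau : E (fun w => tau (Z w)) <= E (fun w => norm2 (Z w) ^+ 2 * tau (Z w)).
  apply: E_le => // w; rewrite /tau tailindE; case: (boolP (rho <= norm2 (Z w))) => hz /=; last by rewrite mulr0.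
  rewrite mulr1; have : rho ^+ 2 <= norm2 (Z w) ^+ 2.
    by rewrite ler_pXn2r// nnegrE ?norm2_ge0//; lra.
  have := norm2_ge0 (Z w); nra.
(* Averaging over Z and -Z pairs the values: [mid] bounds the pair around x from below and [sm] the
   pair around y from above, both without first-order terms. *)
have Eq : E (fun w => q (Z w)) <=
    phi y - phi x + K * u ^+ 2 * E (fun w => norm2 (Z w) ^+ 2) + c * E (fun w => tau (Z w)).
  have -> : E (fun w => q (Z w)) = E (fun w => 2^-1 * (q (Z w) + q (- Z w))).
    by rewrite E_Z; [rewrite E_D// EqN; field|exact: L1D].
  rewrite -E_Z// -[X in X + _ + _](E_cst P) -E_D//; last exact: L1Z.
  2: exact: L1_cst.
  rewrite -E_Z// -E_D//; last exact: L1Z.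
  2: by apply: L1D; [exact: L1_cst|exact: L1Z].
  apply: E_le; first by apply: L1Z; exact: L1D.
    by apply: L1D; [apply: L1D; [exact: L1_cst|exact: L1Z]|exact: L1Z].
  move=> w; rewrite /q tauN.
  have Kn : 0 <= K * u ^+ 2 * norm2 (Z w) ^+ 2.
    by apply: mulr_ge0 (sqr_ge0 _); apply: mulr_ge0 (sqr_ge0 _).
  case: (tauP (Z w)) => [->|[-> zr]].
    have := lip y x; rewrite norm2_sub -/c ler_norml => /andP[h1 h2].
    rewrite subrr !mulr0 addr0 mulr0; lra.
  have := mid _ zr; have := sm _ zr; rewrite /h /hy !scalerN; lra.
have Kn : K * u ^+ 2 * E (fun w => norm2 (Z w) ^+ 2) <= K * u ^+ 2 * m%:R.
  by rewrite ler_wpM2l// mulr_ge0// sqr_ge0.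
have ct : c * E (fun w => tau (Z w)) <= c * E (fun w => norm2 (Z w) ^+ 2 * tau (Z w)).
  by rewrite ler_wpM2l.
rewrite /A; move: ct; rewrite /c /tau in Eq *; lra.
Qed.

End Smoothing.

(** * Smooth and strongly convex functions on a convex set *)

Section UnitInterval.
Variable R : realType.
Implicit Types g D : R -> R.

(** Differentiability relative to the unit interval, one-sided at its ends, as it arises on segments
    that may end on the boundary of a convex set. *)
Definition der01 g D := forall t : R, 0 <= t <= 1 -> forall e : R, 0 < e ->
  exists2 r : R, 0 < r & forall s : R, 0 <= s <= 1 -> `|s - t| < r ->
    `|g s - g t - D t * (s - t)| <= e * `|s - t|.

(** Mean value inequality by a supremum argument: the bound with slope c + e holds on a maximal
    initial interval, and differentiability at the end of this interval would prolong it if that end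
    were below 1. *)
Lemma der01_le g D (c : R) : der01 g D -> (forall t, 0 <= t <= 1 -> D t <= c) ->
  g 1 - g 0 <= c.
Proof.
move=> gD Dc; apply/ler_addgt0Pr => e e0.
pose S := [set t : R | 0 <= t <= 1 /\ forall s : R, 0 <= s <= t -> g s - g 0 <= (c + e) * s].
have S0 : S 0.
  split=> [|s /andP[s0 s0']]; first by rewrite lexx ler01.
  have -> : s = 0 by lra.
  by rewrite subrr mulr0.
have supS : has_sup S by split; [exists 0|exists 1 => t [/andP[]]].
pose tau := sup S.
have tau01 : 0 <= tau <= 1.
  rewrite (ub_le_sup supS.2 S0)/=; apply: ge_sup; first by exists 0.
  by move=> t [/andP[]].
have /andP[tau0 tau1] := tau01.
have [r r0 hr] := gD tau tau01 e e0.
have up (s : R) : 0 <= s <= 1 -> tau <= s -> s - tau < r -> g s <= g tau + (c + e) * (s - tau).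
  move=> s01 ts sr; have h0 : 0 <= s - tau by lra.
  have := hr s s01; rewrite ger0_norm// => /(_ sr); rewrite ler_norml => /andP[_].
  have := Dc _ tau01; nra.
have Stau (s : R) : 0 <= s <= tau -> g s - g 0 <= (c + e) * s.
  move=> /andP[s0]; rewrite le_eqVlt => /orP[/eqP ->|st].
    have [t [t01 tS] tr] := sup_adherent r0 supS.
    have tt : t <= tau by apply: (ub_le_sup supS.2); split.
    have h0 : 0 <= tau - t by lra.
    have := hr t t01; rewrite distrC ger0_norm// -/tau => /(_ ltac:(rewrite -/tau in tr; lra)).
    rewrite ler_norml => /andP[+ _]; have := Dc _ tau01.
    have := tS t; rewrite lexx (andP t01).1 => /(_ isT); nra.
  have d0 : 0 < tau - s by rewrite subr_gt0.
  have [t [t01 tS] tr] := sup_adherent d0 supS.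
  by apply: tS; rewrite s0/=; rewrite -/tau in tr; lra.
have [t1|t1] := ltP tau 1; last first.
  have e1 : tau = 1 by lra.
  by have := Stau 1; rewrite e1 ler01 lexx => /(_ isT); lra.
pose s := Num.min 1 (tau + r / 2).
have s1 : s <= 1 by rewrite ge_min lexx.
have sr : s <= tau + r / 2 by rewrite ge_min lexx orbT.
have ts : tau < s by rewrite lt_min t1/=; lra.
have : S s.
  split=> [|s' /andP[s'0 s's]]; first by apply/andP; split; lra.
  have [h|h] := leP s' tau; first by apply: Stau; rewrite s'0.
  have := up s' ltac:(apply/andP; split; lra) (ltW h) ltac:(lra).
  by have := Stau tau ltac:(apply/andP; split; lra); lra.
by move=> /(ub_le_sup supS.2); rewrite -/tau; lra.
Qed.

Lemma der01_sub g1 D1 g2 D2 : der01 g1 D1 -> der01 g2 D2 ->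
  der01 (fun t => g1 t - g2 t) (fun t => D1 t - D2 t).
Proof.
move=> h1 h2 t t01 e e0; have e2 : 0 < e / 2 by lra.
have [r1 r10 k1] := h1 t t01 _ e2; have [r2 r20 k2] := h2 t t01 _ e2.
exists (Num.min r1 r2); first by rewrite lt_min r10.
move=> s s01; rewrite lt_min => /andP[s1 s2].
have := k1 s s01 s1; have := k2 s s01 s2.
rewrite !ler_norml => /andP[? ?] /andP[? ?]; apply/andP; split; lra.
Qed.

Lemma der01_quad (a b : R) : der01 (fun t => a * t + b * t ^+ 2) (fun t => a + 2 * b * t).
Proof.
move=> t t01 e e0; have b0 : 0 < `|b| + 1 by rewrite ltr_wpDl.
exists (e / (`|b| + 1)); first by rewrite divr_gt0.
move=> s s01; rewrite ltr_pdivlMr// => st.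
have -> : a * s + b * s ^+ 2 - (a * t + b * t ^+ 2) - (a + 2 * b * t) * (s - t) =
  b * (s - t) * (s - t) by ring.
rewrite !normrM ler_wpM2r//; have := normr_ge0 (s - t); nra.
Qed.

End UnitInterval.

(** * Gradients relative to a convex set *)

Section GradientTheory.
Variables (R : realType) (m : nat) (C : set 'rV[R]_m).
Hypothesis cC : @convex_set R 'rV[R]_m C.
Implicit Types (x y v : 'rV[R]_m) (h : 'rV[R]_m -> R) (gh : 'rV[R]_m -> 'rV[R]_m).

Lemma segment_in x y (t : R) : C x -> C y -> 0 <= t <= 1 -> C (x + t *: (y - x)).
Proof.
move=> Cx Cy t01; have := (convex_setE C).1 cC y x t Cy Cx t01.
by congr C; apply/rowP => k; rewrite !mxE; ring.
Qed.

Lemma der01_line h gh x v w :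
  (forall p, C p -> is_gradient C h p (gh p)) ->
  (forall t : R, 0 <= t <= 1 -> C (x + t *: v + w)) ->
  der01 (fun t => h (x + t *: v + w)) (fun t => dot (gh (x + t *: v + w)) v).
Proof.
move=> hg Cl t t01 e e0; have n1 : 0 < norm2 v + 1 by rewrite ltr_wpDl ?norm2_ge0.
have [r r0 hr] := hg _ (Cl t t01) _ (divr_gt0 e0 n1).
exists (r / (norm2 v + 1)); first by rewrite divr_gt0.
move=> s s01; rewrite ltr_pdivlMr// => st.
have e1 : x + s *: v + w - (x + t *: v + w) = (s - t) *: v.
  by apply/rowP => k; rewrite !mxE; ring.
have := hr _ (Cl s s01); rewrite e1 norm2Z dotZr (mulrC (dot _ _)) => k.
have s0 := normr_ge0 (s - t); have v0 := norm2_ge0 v.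
apply: (le_trans (k ltac:(nra))).
rewrite mulrAC ler_pdivrMr//; have : 0 <= e * `|s - t| by rewrite mulr_ge0// ltW.
nra.
Qed.

(** Along the segment from x to y, the function minus its quadratic bound has a nonpositive
    derivative. *)
Lemma smooth_upper h gh (L : R) x y : C x -> C y ->
  (forall p, C p -> is_gradient C h p (gh p)) ->
  (forall p q, C p -> C q -> norm2 (gh p - gh q) <= L * norm2 (p - q)) ->
  h y <= h x + dot (gh x) (y - x) + L / 2 * norm2 (y - x) ^+ 2.
Proof.
move=> Cx Cy hg hL; pose v := y - x.
have Cl (t : R) : 0 <= t <= 1 -> C (x + t *: v + 0).
  by move=> t01; rewrite addr0; exact: segment_in.
have := der01_sub (der01_line hg Cl)
  (der01_quad (dot (gh x) v) (L / 2 * norm2 v ^+ 2)).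
move=> /der01_le -/(_ 0); have -> : x + 1 *: v + 0 = y by rewrite addr0 scale1r addrC subrK.
have -> : x + 0 *: v + 0 = x by rewrite scale0r !addr0.
rewrite -/v; suff : forall t : R, 0 <= t <= 1 -> dot (gh (x + t *: v + 0)) v
   - (dot (gh x) v + 2 * (L / 2 * norm2 v ^+ 2) * t) <= 0.
  by move=> h1 /(_ h1); lra.
move=> t t01; rewrite addr0.
have Ct : C (x + t *: v) by exact: segment_in.
have := dot_le (gh (x + t *: v) - gh x) v; rewrite dotBl.
have := hL _ _ Ct Cx; have -> : x + t *: v - x = t *: v.
  by apply/rowP => k; rewrite !mxE; ring.
rewrite norm2Z ger0_norm ?(andP t01).1//; have := norm2_ge0 v.
have := norm2_ge0 (gh (x + t *: v) - gh x); nra.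
Qed.

(** The derivative of the central difference along the segment from y to x compares gradients at
    points that are 2 w apart. Thus a central difference is Lipschitz in its center, with a constant
    proportional to |w|. *)
Lemma central_difference_le h gh (L : R) x y w : 0 <= L ->
  C (x + w) -> C (x - w) -> C (y + w) -> C (y - w) ->
  (forall p, C p -> is_gradient C h p (gh p)) ->
  (forall p q, C p -> C q -> norm2 (gh p - gh q) <= L * norm2 (p - q)) ->
  (h (x + w) - h (x - w)) - (h (y + w) - h (y - w)) <= 2 * L * norm2 w * norm2 (x - y).
Proof.
move=> L0 Cxp Cxm Cyp Cym hg hL; pose v := x - y.
have Cp (t : R) : 0 <= t <= 1 -> C (y + t *: v + w).
  move=> t01; have := segment_in Cyp Cxp t01; congr C.
  by apply/rowP => k; rewrite !mxE; ring.
have Cm (t : R) : 0 <= t <= 1 -> C (y + t *: v + - w).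
  move=> t01; have := segment_in Cym Cxm t01; congr C.
  by apply/rowP => k; rewrite !mxE; ring.
have := der01_sub (der01_line hg Cp) (der01_line hg Cm).
move=> /der01_le -/(_ (2 * L * norm2 w * norm2 (x - y))).
rewrite !scale1r !scale0r !addr0; have -> : y + v = x by rewrite addrC subrK.
apply=> t t01; rewrite -dotBl; apply: (le_trans (dot_le _ _)).
rewrite ler_wpM2r ?norm2_ge0//; apply: (le_trans (hL _ _ (Cp t t01) (Cm t t01))).
have -> : y + t *: v + w - (y + t *: v - w) = 2 *: w.
  by apply/rowP => k; rewrite !mxE; ring.
by rewrite norm2Z ger0_norm// mulrCA mulrA.
Qed.

(** Divide strong convexity on the segment by t and let t tend to 0. The constant [K] makes the
    error of the gradient and the term of order t fit into e' together. *)
Lemma strong_gradient h g x y : strongly_convex_on C 1 h ->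
  C x -> C y -> is_gradient C h x g ->
  h x + dot g (y - x) + 1 / 2 * norm2 (y - x) ^+ 2 <= h y.
Proof.
move=> sc Cx Cy hg; set v := y - x; have n0 := norm2_ge0 v.
pose K := norm2 v + norm2 v ^+ 2 + 1.
have K0 : 0 < K by rewrite /K; nra.
apply/ler_addgt0Pr => e' e'0; pose e := e' / K; have e0 : 0 < e by rewrite divr_gt0.
have eK : e * K = e' by rewrite divfK// gt_eqF.
have [r r0 hr] := hg e e0.
pose t := Num.min (Num.min 1 e) (r / (2 * K)).
have t0 : 0 < t by rewrite !lt_min ltr01 e0 divr_gt0// mulr_gt0.
have t1 : t <= 1 by rewrite !ge_min lexx.
have te : t <= e by rewrite !ge_min lexx orbT.
have tr : t * norm2 v < r.
  have : t <= r / (2 * K) by rewrite !ge_min lexx !orbT.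
  rewrite ler_pdivlMr; last by rewrite mulr_gt0.
  by rewrite /K; nra.
have Ct : C (x + t *: v) by apply: segment_in => //; apply/andP; split=> //; exact: ltW.
have ev : x + t *: v - x = t *: v by apply/rowP => k; rewrite !mxE; ring.
have := hr _ Ct; rewrite ev norm2Z gtr0_norm// => /(_ tr).
rewrite dotZr ler_norml => /andP[h1 _].
have := sc y x t Cy Cx; rewrite (ltW t0) t1 => /(_ isT).
have -> : t *: y + (1 - t) *: x = x + t *: v.
  by apply/rowP => k; rewrite !mxE; ring.
rewrite -/v => h2.
have : t * (dot g v + 1 / 2 * norm2 v ^+ 2 - e * norm2 v - t / 2 * norm2 v ^+ 2) <=
       t * (h y - h x) by lra.
rewrite ler_pM2l// => h3.
have : t / 2 * norm2 v ^+ 2 <= e * norm2 v ^+ 2 by have := sqr_ge0 (norm2 v); nra.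
have : e * norm2 v + e * norm2 v ^+ 2 <= e' by rewrite -eK /K; nra.
lra.
Qed.

Lemma strong_monotone h gx gy x y : strongly_convex_on C 1 h -> C x -> C y ->
  is_gradient C h x gx -> is_gradient C h y gy ->
  norm2 (x - y) ^+ 2 <= dot (gx - gy) (x - y).
Proof.
move=> sc Cx Cy hx hy.
have := strong_gradient sc Cx Cy hx; have := strong_gradient sc Cy Cx hy.
rewrite (norm2_sub y) dotBl -(opprB y x) !dotNr; lra.
Qed.

(** Minimality is stated on the segment because the minimiser will range over a smaller set than the
    one to which the gradient is relative. *)
Lemma gradient_argmin h g x y : is_gradient C h x g -> C x -> C y ->
  (forall t : R, 0 <= t <= 1 -> h x <= h (x + t *: (y - x))) -> 0 <= dot g (y - x).
Proof.
move=> hg Cx Cy hmin; set v := y - x in hmin *; have n0 := norm2_ge0 v.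
rewrite -oppr_le0; apply/ler_addgt0Pr => e' e'0; rewrite add0r.
have K0 : 0 < norm2 v + 1 by lra.
pose e := e' / (norm2 v + 1); have e0 : 0 < e by rewrite divr_gt0.
have eK : e * (norm2 v + 1) = e' by rewrite divfK// gt_eqF.
have [r r0 hr] := hg e e0.
pose t := Num.min 1 (r / (2 * (norm2 v + 1))).
have t0 : 0 < t by rewrite !lt_min ltr01 divr_gt0// mulr_gt0.
have t1 : t <= 1 by rewrite !ge_min lexx.
have tr : t * norm2 v < r.
  have : t <= r / (2 * (norm2 v + 1)) by rewrite !ge_min lexx !orbT.
  by rewrite ler_pdivlMr ?mulr_gt0//; nra.
have t01 : 0 <= t <= 1 by rewrite ltW.
have Ct : C (x + t *: v) by apply: segment_in.
have ev : x + t *: v - x = t *: v by apply/rowP => k; rewrite !mxE; ring.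
have := hr _ Ct; rewrite ev norm2Z gtr0_norm// => /(_ tr).
rewrite dotZr ler_norml => /andP[_ h1]; have := hmin t t01 => h2.
have : t * (- dot g v) <= t * (e * norm2 v) by lra.
rewrite ler_pM2l//; have : e * norm2 v <= e' by rewrite -eK; nra.
lra.
Qed.

Lemma is_gradientZ h g x (a : R) : is_gradient C h x g ->
  is_gradient C (fun y => a * h y) x (a *: g).
Proof.
move=> hg e e0; have a1 : 0 < `|a| + 1 by rewrite ltr_wpDl.
have [r r0 hr] := hg _ (divr_gt0 e0 a1); exists r => // y Cy yr.
have := hr y Cy yr; set q := h y - h x - dot g (y - x) => hq.
have -> : a * h y - a * h x - dot (a *: g) (y - x) = a * q by rewrite dotZl /q; ring.
rewrite normrM; have : (`|a| + 1) * `|q| <= e * norm2 (y - x).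
  by have := ler_wpM2l (ltW a1) hq; rewrite mulrA mulrCA mulfV ?gt_eqF// mulr1.
have := normr_ge0 q; lra.
Qed.

Lemma is_gradientD h1 g1 h2 g2 x : is_gradient C h1 x g1 -> is_gradient C h2 x g2 ->
  is_gradient C (fun y => h1 y + h2 y) x (g1 + g2).
Proof.
move=> hg1 hg2 e e0; have e2 : 0 < e / 2 by lra.
have [r1 r10 k1] := hg1 _ e2; have [r2 r20 k2] := hg2 _ e2.
exists (Num.min r1 r2); first by rewrite lt_min r10.
move=> y Cy; rewrite lt_min => /andP[y1 y2].
have := k1 y Cy y1; have := k2 y Cy y2; rewrite dotDl.
rewrite !ler_norml => /andP[? ?] /andP[? ?]; apply/andP; split; lra.
Qed.

Lemma is_gradient_affine (b : 'rV[R]_m) (c : R) x :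
  is_gradient C (fun y => dot b y + c) x b.
Proof.
move=> e e0; exists 1 => // y _ _; rewrite dotBr.
have -> : dot b y + c - (dot b x + c) - (dot b y - dot b x) = 0 by ring.
by rewrite normr0 mulr_ge0 ?norm2_ge0// ltW.
Qed.

End GradientTheory.

(** * One step of mirror descent *)

Section MirrorStep.
Variables (R : realType) (m : nat) (C C' : set 'rV[R]_m).
Hypotheses (cC : @convex_set R 'rV[R]_m C) (cC' : @convex_set R 'rV[R]_m C')
  (CC : C' `<=` C).
Variables (psi : 'rV[R]_m -> R) (gpsi : 'rV[R]_m -> 'rV[R]_m) (eta : R).
Hypotheses (eta0 : 0 < eta) (sc : strongly_convex_on C 1 psi)
  (gP : forall y, C y -> is_gradient C psi y (gpsi y)).

Definition mirror_step g x x' :=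
  is_argmin C' (fun y => dot g (y - x) + eta^-1 * bregman psi gpsi y x) x'.

(** Up to an affine function the objective is psi / eta, so this is its first-order optimality
    condition. *)
Lemma mirror_step_opt g x x' y : C x -> mirror_step g x x' -> C' y ->
  0 <= dot (g + eta^-1 *: (gpsi x' - gpsi x)) (y - x').
Proof.
move=> Cx [C'x' xmin] C'y; pose b := g - eta^-1 *: gpsi x.
pose c := - dot g x - eta^-1 * (psi x - dot (gpsi x) x).
have h1 : is_gradient C (fun y => eta^-1 * psi y + (dot b y + c)) x'
    (eta^-1 *: gpsi x' + b).
  by apply: is_gradientD; [apply/is_gradientZ/gP/CC|exact: is_gradient_affine].
have := gradient_argmin cC h1 (CC C'x') (CC C'y); rewrite /b.
have -> : eta^-1 *: gpsi x' + (g - eta^-1 *: gpsi x) =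
    g + eta^-1 *: (gpsi x' - gpsi x).
  by apply/rowP => k; rewrite !mxE; ring.
apply=> t t01; have := xmin _ (segment_in cC' C'x' C'y t01).
have e z : dot g (z - x) + eta^-1 * bregman psi gpsi z x =
    eta^-1 * psi z + (dot (g - eta^-1 *: gpsi x) z + c).
  by rewrite /bregman /c !dotBr dotBl dotZl; ring.
by rewrite !e.
Qed.

(** Split x - y at x'. The part x' - y is handled by optimality and the three-point identity of the
    Bregman divergence; Young's inequality for the part x - x' is paid by D(x'|x) >= |x' - x|^2 /
    2. *)
Lemma mirror_step_le g x x' y : C x -> mirror_step g x x' -> C' y ->
  dot g (x - y) <= eta^-1 * (bregman psi gpsi y x - bregman psi gpsi y x')
                   + eta / 2 * norm2 g ^+ 2.
Proof.
move=> Cx st C'y; have C'x' : C' x' := st.1; have Cx' := CC C'x'.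
have h1 := mirror_step_opt Cx st C'y.
have h2 := strong_gradient cC sc Cx Cx' (gP Cx).
have e1 : dot g (x - y) = dot g (x - x') + dot g (x' - y).
  by rewrite -dotDr; congr dot; rewrite addrA subrK.
have h3 : dot g (x - x') <= eta / 2 * norm2 g ^+ 2 + eta^-1 * (1 / 2 * norm2 (x' - x) ^+ 2).
  apply: (le_trans (dot_le _ _)); rewrite (norm2_sub x).
  have ei : 0 <= eta^-1 by rewrite invr_ge0 ltW.
  have := mulr_ge0 ei (sqr_ge0 (eta * norm2 g - norm2 (x' - x))).
  have -> : eta^-1 * (eta * norm2 g - norm2 (x' - x)) ^+ 2 =
      eta * norm2 g ^+ 2 - 2 * (norm2 g * norm2 (x' - x)) + eta^-1 * norm2 (x' - x) ^+ 2.
    by field; exact: lt0r_neq0.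
  lra.
have h4 : dot g (x' - y) <=
    eta^-1 * (bregman psi gpsi y x - bregman psi gpsi y x' - bregman psi gpsi x' x).
  have -> : bregman psi gpsi y x - bregman psi gpsi y x' - bregman psi gpsi x' x =
      dot (gpsi x' - gpsi x) (y - x').
    by rewrite /bregman !dotBl !dotBr; ring.
  by move: h1; rewrite dotDl dotZl -(opprB x' y) !dotNr; lra.
have h5 : eta^-1 * (1 / 2 * norm2 (x' - x) ^+ 2) <= eta^-1 * bregman psi gpsi x' x.
  by apply: ler_wpM2l; [rewrite invr_ge0 ltW|rewrite /bregman; lra].
rewrite e1; move: h3 h4 h5; rewrite !mulrBr; lra.
Qed.

(** Optimality tested at y = x, which therefore has to lie in C'; in the run this is granted from
    time 1 on. *)
Lemma mirror_step_length g x x' : C' x -> mirror_step g x x' ->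
  norm2 (x' - x) <= eta * norm2 g.
Proof.
move=> C'x st; have C'x' : C' x' := st.1.
have h1 := mirror_step_opt (CC C'x) st C'x.
have h2 := strong_monotone cC sc (CC C'x') (CC C'x) (gP (CC C'x')) (gP (CC C'x)).
have h3 := dot_le g (x - x'); rewrite (norm2_sub x) in h3.
have n0 := norm2_ge0 (x' - x).
have h4 : eta^-1 * norm2 (x' - x) ^+ 2 <= norm2 g * norm2 (x' - x).
  have : eta^-1 * norm2 (x' - x) ^+ 2 <= eta^-1 * dot (gpsi x' - gpsi x) (x' - x).
    by rewrite ler_wpM2l// invr_ge0 ltW.
  by move: h1 h3; rewrite -(opprB x' x) !dotNr dotDl dotZl; lra.
have [->|n1] := eqVneq (norm2 (x' - x)) 0; first by rewrite mulr_ge0 ?norm2_ge0// ltW.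
have np : 0 < norm2 (x' - x) by rewrite lt_def n1.
by move: h4; rewrite expr2 mulrA ler_pM2r// mulrC ler_pdivrMr// mulrC.
Qed.

(** Serves measurability: with [gpsi] continuous, the new point depends continuously on the old one
    and on the estimate. *)
Lemma mirror_step_lip g x x' h y y' : C x -> C y ->
  mirror_step g x x' -> mirror_step h y y' ->
  norm2 (x' - y') <= eta * norm2 (g - h) + norm2 (gpsi x - gpsi y).
Proof.
move=> Cx Cy sx sy; have C'x' : C' x' := sx.1; have C'y' : C' y' := sy.1.
have h1 := mirror_step_opt Cx sx C'y'; have h2 := mirror_step_opt Cy sy C'x'.
have h3 := strong_monotone cC sc (CC C'x') (CC C'y') (gP (CC C'x')) (gP (CC C'y')).
have n0 := norm2_ge0 (x' - y'); have ei : 0 < eta^-1 by rewrite invr_gt0.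
have h4 : norm2 (x' - y') ^+ 2 <=
    dot (gpsi x - gpsi y) (x' - y') - eta * dot (g - h) (x' - y').
  have : 0 <= eta * (dot (g + eta^-1 *: (gpsi x' - gpsi x)) (y' - x') +
                     dot (h + eta^-1 *: (gpsi y' - gpsi y)) (x' - y')).
    by rewrite mulr_ge0 ?addr_ge0// ltW.
  rewrite -(opprB x' y') dotNr !dotDl !dotZl !dotNl !mulrDr !mulrN !mulrDr !mulrA.
  rewrite mulfV ?gt_eqF// !mul1r.
  by move: h3; rewrite !dotBl; lra.
have h5 := dot_le (gpsi x - gpsi y) (x' - y').
have h6 := normr_dot_le (g - h) (x' - y').
have h7 : - dot (g - h) (x' - y') <= norm2 (g - h) * norm2 (x' - y').
  by apply: le_trans h6; rewrite -normrN ler_norm.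
have [->|n1] := eqVneq (norm2 (x' - y')) 0.
  by rewrite addr_ge0 ?norm2_ge0// mulr_ge0 ?norm2_ge0// ltW.
have np : 0 < norm2 (x' - y') by rewrite lt_def n1.
rewrite -(ler_pM2r np) -expr2; apply: (le_trans h4).
have : eta * (- dot (g - h) (x' - y')) <= eta * (norm2 (g - h) * norm2 (x' - y')).
  by rewrite ler_pM2l.
by move: h5; lra.
Qed.

End MirrorStep.

(** * Shrunken sets and projections onto the symmetric sets *)

Section ShrinkAndProject.
Variables (R : realType) (m : nat) (C : set 'rV[R]_m).
Hypotheses (cC : @convex_set R 'rV[R]_m C) (C0 : C 0).
Variables (delta u : R).
Hypotheses (d01 : 0 < delta < 1) (u0 : 0 < u).

Lemma shrink_sub : shrink delta C `<=` C.
Proof.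
move=> _ [y Cy <-]; have /andP[d0 d1] := d01.
have := (convex_setE C).1 cC y 0 (1 - delta) Cy C0.
by rewrite scaler0 addr0; apply; apply/andP; split; lra.
Qed.

Lemma shrink_convex : @convex_set R 'rV[R]_m (shrink delta C).
Proof.
apply/convex_setE => _ _ t [x Cx <-] [y Cy <-] t01.
exists (t *: x + (1 - t) *: y); first exact: (convex_setE C).1.
by apply/rowP => k; rewrite !mxE; ring.
Qed.

Lemma shrink_add x w : shrink delta C x -> C w -> C (x + delta *: w).
Proof.
move=> [y Cy <-] Cw; have /andP[d0 d1] := d01.
have := (convex_setE C).1 cC y w (1 - delta) Cy Cw.
by rewrite opprB addrCA subrr addr0; apply; apply/andP; split; lra.
Qed.

(** The strict inequality provides an admissible radius above |y|, whether or not the supremum is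
    attained. *)
Lemma in_inradius y : norm2 y < inradius C -> C y.
Proof.
move=> h; pose S := [set r | 0 < r /\ ball2 r `<=` C].
have [S0|/nonemptyPn S0] := pselect (S !=set0); last first.
  by move: h; rewrite /inradius -/S S0 sup0 ltNge norm2_ge0.
have [r [r0 rC] yr] := sup_gt S0 h.
by apply: rC; rewrite /ball2/= ltW.
Qed.

Lemma sym_setP x q : sym_set C x u q <-> C (x + u *: q) /\ C (x - u *: q).
Proof.
have u1 : u != 0 by rewrite gt_eqF.
split=> [[[y Cy <-] [y' Cy' e]]|[h1 h2]].
  split; first by rewrite scalerA mulfV// scale1r addrC subrK.
  have -> : u *: (u^-1 *: (y - x)) = x - y'.
    by rewrite -e scalerN scalerA mulfV// scale1r opprB.
  by rewrite opprB addrC subrK.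
split; [exists (x + u *: q)|exists (x - u *: q)] => //.
  by rewrite addrAC subrr add0r scalerA mulVf// scale1r.
by rewrite addrAC subrr add0r scalerN opprK scalerA mulVf// scale1r.
Qed.

Lemma sym_set_convex x : @convex_set R 'rV[R]_m (sym_set C x u).
Proof.
apply/convex_setE => p q t /sym_setP[p1 p2] /sym_setP[q1 q2] t01.
apply/sym_setP; split.
  have := (convex_setE C).1 cC _ _ t p1 q1 t01.
  by congr C; apply/rowP => k; rewrite !mxE; ring.
have := (convex_setE C).1 cC _ _ t p2 q2 t01.
by congr C; apply/rowP => k; rewrite !mxE; ring.
Qed.

Lemma sym_set0 x : C x -> sym_set C x u 0.
Proof. by move=> Cx; apply/sym_setP; rewrite scaler0 subr0 addr0. Qed.

(** Vectors shorter than delta times the inradius can be added to a point of the shrunken set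
    without leaving C, so y is already in the symmetric set. *)
Lemma sym_proj_id x y p : shrink delta C x ->
  u * norm2 y < delta * inradius C -> is_proj (sym_set C x u) y p -> p = y.
Proof.
move=> Cx yr [_ pmin]; have /andP[d0 _] := d01.
have aux (w : 'rV[R]_m) : norm2 w = norm2 y -> C (x + u *: w).
  move=> wy; have := shrink_add Cx (w := delta^-1 *: (u *: w)).
  rewrite (scalerA delta) mulfV ?gt_eqF// scale1r; apply; apply: in_inradius.
  rewrite !norm2Z wy !gtr0_norm ?invr_gt0//.
  by rewrite ltr_pdivrMl.
have : sym_set C x u y.
  by apply/sym_setP; split; [exact: aux|rewrite -scalerN; apply: aux; rewrite norm2N].
move=> /pmin; rewrite subrr norm20 => h.
apply/eqP; rewrite -subr_eq0; apply/eqP/norm2_eq0; apply/eqP.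
by rewrite eq_le h norm2_ge0.
Qed.

(** The point w = x' + (x' - x) / s is in C by the margin around x', and x' + u q / (1 + s) is a
    convex combination of x + u q and w; likewise with -q. *)
Lemma sym_set_scale x x' (s : R) q : shrink delta C x -> shrink delta C x' ->
  0 < s -> norm2 (x - x') < s * (delta * inradius C) ->
  sym_set C x u q -> sym_set C x' u ((1 + s)^-1 *: q).
Proof.
move=> Cx Cx' s0 xs /sym_setP[q1 q2]; have /andP[d0 _] := d01.
have s1 : 1 + s != 0 by rewrite gt_eqF//; lra.
have s2 : s != 0 by rewrite gt_eqF.
pose w := x' + s^-1 *: (x' - x).
have Cw : C w.
  have := shrink_add Cx' (w := delta^-1 *: (s^-1 *: (x' - x))).
  rewrite (scalerA delta) mulfV ?gt_eqF// scale1r; apply; apply: in_inradius.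
  rewrite !norm2Z norm2_sub !gtr0_norm ?invr_gt0//.
  by rewrite !ltr_pdivrMl.
have t01 : 0 <= (1 + s)^-1 <= 1.
  rewrite invr_ge0 invf_le1; last by lra.
  by apply/andP; split; lra.
apply/sym_setP; split.
  have := (convex_setE C).1 cC _ _ _ q1 Cw t01; congr C.
  by apply/rowP => k; rewrite !mxE; field; rewrite s1.
have := (convex_setE C).1 cC _ _ _ q2 Cw t01; congr C.
by apply/rowP => k; rewrite !mxE; field; rewrite s1.
Qed.

(** Each variational inequality is tested at the other projection, scaled by 1 / (1 + s) to make it
    admissible. The inclusions are hypotheses so that s = 0 is available when the two sets
    coincide. *)
Lemma sym_proj_stable x x' y y' p p' (s : R) : C x -> C x' -> 0 <= s ->
  (forall q, sym_set C x u q -> sym_set C x' u ((1 + s)^-1 *: q)) ->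
  (forall q, sym_set C x' u q -> sym_set C x u ((1 + s)^-1 *: q)) ->
  is_proj (sym_set C x u) y p -> is_proj (sym_set C x' u) y' p' ->
  norm2 (p - p') ^+ 2 <= norm2 (y - y') ^+ 2 + 8 * s * (norm2 y * norm2 y').
Proof.
move=> Cx Cx' s0 K1 K2 hp hp'; set la := (1 + s)^-1 in K1 K2.
have h1 := is_proj_dot (@sym_set_convex x) hp (K2 _ hp'.1).
have h2 := is_proj_dot (@sym_set_convex x') hp' (K1 _ hp.1).
have n1 := norm2_proj_le (@sym_set_convex x) (sym_set0 Cx) hp.
have n2 := norm2_proj_le (@sym_set_convex x') (sym_set0 Cx') hp'.
have la1 : la * (1 + s) = 1 by rewrite mulVf// gt_eqF//; lra.
have la0 : 0 < la by rewrite invr_gt0; lra.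
have las : 0 <= 1 - la <= s by apply/andP; split; nra.
have a1 := dot_le (y - p) p'; have a2 := dot_le (y' - p') p.
have b1 := ler_norm2B y p; have b2 := ler_norm2B y' p'.
have p0 := norm2_ge0 p; have p0' := norm2_ge0 p'.
have y0 := norm2_ge0 y; have y0' := norm2_ge0 y'.
have c1 : dot (y - p) p' <= 2 * (norm2 y * norm2 y').
  apply: (le_trans a1); apply: (@le_trans _ _ ((norm2 y + norm2 y) * norm2 y')); last by lra.
  by rewrite ler_pM ?norm2_ge0//; lra.
have c2 : dot (y' - p') p <= 2 * (norm2 y * norm2 y').
  apply: (le_trans a2); apply: (@le_trans _ _ ((norm2 y' + norm2 y') * norm2 y)); last by lra.
  by rewrite ler_pM ?norm2_ge0//; lra.
have Q0 : 0 <= norm2 y * norm2 y' by rewrite mulr_ge0.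
have key : norm2 (p - p') ^+ 2 + dot (y - y') (p' - p) <=
    (1 - la) * (dot (y - p) p' + dot (y' - p') p).
  move: h1 h2; rewrite !dotBr !dotZr sqr_norm2 !dotBl !dotBr (dotC p' p).
  lra.
have e1 : (1 - la) * (dot (y - p) p' + dot (y' - p') p) <= s * (4 * (norm2 y * norm2 y')).
  have [h|h] := leP 0 (dot (y - p) p' + dot (y' - p') p); last first.
    apply: (@le_trans _ _ 0); first by nra.
    by rewrite mulr_ge0// mulr_ge0.
  apply: (@le_trans _ _ (s * (dot (y - p) p' + dot (y' - p') p))); first by nra.
  by rewrite ler_wpM2l//; lra.
have e2 := normr_dot_le (y - y') (p' - p); rewrite (norm2_sub p') in e2.
move: e2; rewrite ler_norml => /andP[e2 _].
have := sqr_ge0 (norm2 (y - y') - norm2 (p - p')); lra.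
Qed.

End ShrinkAndProject.

(** * Lipschitz extension of the costs *)

Section McShane.
Variables (R : realType) (m : nat) (C : set 'rV[R]_m) (G : R) (h : 'rV[R]_m -> R).
Hypotheses (C0 : C !=set0) (G0 : 0 <= G) (hl : lipschitz2 C G h).

(** The largest G-Lipschitz function that agrees with h on C. *)
Definition mcshane (y : 'rV[R]_m) : R := inf [set h x + G * norm2 (y - x) | x in C].

Let lb y : has_inf [set h x + G * norm2 (y - x) | x in C].
Proof.
have [a Ca] := C0; split; first by exists (h a + G * norm2 (y - a)), a.
exists (h a - G * norm2 (y - a)) => _ [x Cx <-].
have := hl Ca Cx; rewrite ler_norml => /andP[_ h1].
have : norm2 (a - x) <= norm2 (y - a) + norm2 (y - x).
  by rewrite (norm2_sub y a); exact: ler_dist2D.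
by move=> /(ler_wpM2l G0); rewrite mulrDr; lra.
Qed.

Lemma mcshane_eq y : C y -> mcshane y = h y.
Proof.
move=> Cy; apply/eqP; rewrite eq_le; apply/andP; split.
  apply: (ge_inf (lb y).2); exists y => //.
  by rewrite subrr norm20 mulr0 addr0.
apply: lb_le_inf; first exact: (lb y).1.
move=> _ [x Cx <-]; have := hl Cy Cx; rewrite ler_norml => /andP[_]; lra.
Qed.

Lemma mcshane_lip y y' : `|mcshane y - mcshane y'| <= G * norm2 (y - y').
Proof.
have aux z z' : mcshane z - G * norm2 (z - z') <= mcshane z'.
  apply: lb_le_inf; first exact: (lb z').1.
  move=> _ [x Cx <-]; rewrite lerBlDr.
  apply: (@le_trans _ _ (h x + G * norm2 (z - x))).
    by apply: (ge_inf (lb z).2); exists x.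
  by have := ler_wpM2l G0 (ler_dist2D z' z x); rewrite mulrDr; lra.
have h1 := aux y y'; have h2 := aux y' y; rewrite (norm2_sub y') in h2.
by rewrite ler_norml; apply/andP; split; lra.
Qed.

End McShane.

Lemma compact_norm2_bounded (R : realType) (m m' : nat) (C : set 'rV[R]_m)
    (g : 'rV[R]_m -> 'rV[R]_m') :
  compact C -> {within C, continuous g} ->
  exists2 M : R, 0 < M & forall y, C y -> norm2 (g y) <= M.
Proof.
move=> kC cg; have := continuous_compact cg kC => /compact_bounded[M [Mr hM]].
pose M1 : R := `|M| + 1; have M1M : M < M1 by rewrite (le_lt_trans (ler_norm M))// ltrDl.
have M0 : 0 < M1 by rewrite ltr_wpDl.
(* The successor keeps the bound positive in dimension 0. *)
exists (M1 *+ m'.+1); first by rewrite pmulrn_rgt0.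
move=> y Cy; apply: (@le_trans _ _ (M1 *+ m')); last first.
  by rewrite mulrS lerDr ltW.
apply: norm2_le_coord => k; have := hM _ M1M (g y) => /(_ ltac:(by exists y)).
apply: le_trans; rewrite [leRHS]/Num.Def.normr/= mx_normrE.
by apply/bigmax_geP; right => /=; exists (0, k).
Qed.

(** * The run of the algorithm *)

(** Translates continuity for the sup norm of the topology into Euclidean norms, at the price of a
    dimensional factor. *)
Lemma within_continuous_norm2 (R : realType) (m m' : nat) (C : set 'rV[R]_m)
    (g : 'rV[R]_m -> 'rV[R]_m') : {within C, continuous g} ->
  forall x (e : R), C x -> 0 < e -> exists2 r : R, 0 < r &
    forall y, C y -> norm2 (y - x) < r -> norm2 (g y - g x) < e.
Proof.
move=> /subspace_continuousP cg x e Cx e0.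
have e1 : 0 < e / m'.+1%:R by rewrite divr_gt0.
have := cg x Cx => /cvgrPdist_lt /(_ _ e1).
rewrite /within/= /prop_near1/= => /nbhs_ballP[r /= r0 hr].
exists r => // y Cy yr.
have : `|g x - g y| < e / m'.+1%:R.
  apply: (hr y) => //; rewrite -ball_normE/=.
  rewrite [ltLHS]/Num.Def.normr/= mx_normrE; apply: bigmax_lt => //= -[i k] _ /=.
  by rewrite ord1; apply: le_lt_trans (normr_coord_le (x - y) k) _; rewrite norm2_sub.
move=> h; apply: (@le_lt_trans _ _ ((e / m'.+1%:R) *+ m')).
  apply: norm2_le_coord => k; apply: le_trans (ltW h).
  rewrite [leRHS]/Num.Def.normr/= mx_normrE; apply/bigmax_geP; right => /=.
  by exists (0, k) => //; rewrite !mxE distrC.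
rewrite -mulr_natr mulrAC ltr_pdivrMr// ltr_pM2l// ltr_nat; exact: leqnn.
Qed.

(** Triangle inequality and Jensen, the latter from the nonnegative variance of the norms. *)
Lemma sqr_norm2_avg (R : realType) (m n : nat) (a : 'I_n -> 'rV[R]_m) : (0 < n)%N ->
  norm2 (n%:R^-1 *: \sum_j a j) ^+ 2 <= n%:R^-1 * \sum_j norm2 (a j) ^+ 2.
Proof.
move=> n0; have nR : 0 < n%:R :> R by rewrite ltr0n.
rewrite norm2Z gtr0_norm ?invr_gt0// exprMn.
have h1 : norm2 (\sum_j a j) <= \sum_j norm2 (a j) by exact: norm2_sum.
have h2 : (\sum_j norm2 (a j)) ^+ 2 <= n%:R * \sum_j norm2 (a j) ^+ 2.
  pose c := n%:R^-1 * \sum_j norm2 (a j).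
  have : 0 <= \sum_j (norm2 (a j) - c) ^+ 2 by apply: sumr_ge0 => j _; exact: sqr_ge0.
  under eq_bigr do rewrite sqrrB.
  rewrite big_split/= sumrB sumrMnl -mulr_suml sumr_const card_ord.
  have -> : \sum_j norm2 (a j) = n%:R * c by rewrite /c mulrA mulfV ?gt_eqF// mul1r.
  move: (\sum_j norm2 (a j) ^+ 2) => S h; rewrite -subr_ge0.
  have -> : n%:R * S - (n%:R * c) ^+ 2 = n%:R * (S - n%:R * c * c *+ 2 + c ^+ 2 *+ n).
    by rewrite -[c ^+ 2 *+ n]mulr_natl; ring.
  by rewrite mulr_ge0// ltW.
apply: (@le_trans _ _ (n%:R^-1 ^+ 2 * (n%:R * \sum_j norm2 (a j) ^+ 2))).
  rewrite ler_wpM2l ?sqr_ge0//; apply: le_trans h2.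
  by rewrite ler_pXn2r// nnegrE ?norm2_ge0// sumr_ge0// => j _; exact: norm2_ge0.
by rewrite expr2 !mulrA -[_ * n%:R]mulrA mulVf ?gt_eqF// mulr1.
Qed.

Section Run.
Variables (R : realType) (n : nat) (dim : 'I_n -> nat).
Variables (X : forall i, set 'rV[R]_(dim i)) (Ri : 'I_n -> R) (G L : R)
  (f : 'I_n -> profile R dim -> R).
Variables (edge : rel 'I_n) (Delta : nat) (sigma : R).
Variables (psi : forall i, 'rV[R]_(dim i) -> R)
          (gpsi : forall i, 'rV[R]_(dim i) -> 'rV[R]_(dim i)).
Arguments X : clear implicits.
Arguments psi : clear implicits.
Arguments gpsi : clear implicits.
Variables (eta u delta : R) (x0 : profile R dim).
Variables (disp : measure_display) (Omega : measurableType disp)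
          (P : probability Omega R).
Variables (gauss : nat -> forall i, 'I_(dim i) -> {RV P >-> R})
          (noise : bool -> nat -> 'I_n -> {RV P >-> R}).
Arguments gauss : clear implicits.
Variables (arrivals : nat -> 'I_n -> 'I_n -> seq nat).
Variables (x z : nat -> Omega -> profile R dim)
          (Dmem : nat -> 'I_n -> 'I_n -> Omega -> R)
          (tau : nat -> 'I_n -> 'I_n -> int).

Hypothesis setting : constrained_convex_setting X Ri G L f.
Hypothesis mirror : mirror_maps X psi gpsi.
Hypothesis Xx0 : prod_set X x0.
Hypothesis smp : sampling sigma gauss noise.
Hypothesis run : zfo_run X f edge Delta psi gpsi eta u delta x0 gauss noise
          arrivals x z Dmem tau.
Hypotheses (eta0 : 0 < eta) (u0 : 0 < u) (delta01 : 0 < delta < 1) (G0 : 0 < G).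
Hypothesis rad0 : forall i, 0 < inradius (X i).

Let n0 : (0 < n)%N. Proof. by case: setting => -[]. Qed.
Let cX i : @convex_set R 'rV[R]_(dim i) (X i).
Proof. by case: setting => _ /(_ i)[]. Qed.
Let X0 i : X i 0.
Proof. by case: setting => _ /(_ i)[_ _ /interior_subset]. Qed.
Let cS i : @convex_set R 'rV[R]_(dim i) (shrink delta (X i)).
Proof. exact: shrink_convex. Qed.
Let subS i : shrink delta (X i) `<=` X i.
Proof. exact: shrink_sub. Qed.
Let flip j : lipschitz2 (prod_set X) G (f j).
Proof. by case: setting => _ _ _ /(_ j)[]. Qed.

Notation Y := (sample gauss noise).
Notation dq := (diff_quotient f u noise x z).
Notation grad := (gradient_estimate z Dmem tau).

Definition gvec t w : profile R dim := mxrow (fun i => \row_k gauss t i k w).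

Lemma block_gvec t w i : block (gvec t w) i = \row_k gauss t i k w.
Proof. exact: mxrow_block. Qed.

Lemma step_mirror t w i : mirror_step (shrink delta (X i)) (psi i) (gpsi i) eta
  (grad t i w) (block (x t w) i) (block (x t.+1 w) i).
Proof. exact: (run_step run). Qed.

Lemma x_shrink t w i : (0 < t)%N -> shrink delta (X i) (block (x t w) i).
Proof. by case: t => // t _; exact: (step_mirror t w i).1. Qed.

Lemma x_in t w : prod_set X (x t w).
Proof.
case: t => [|t] i; first by rewrite (run_init run); exact: Xx0.
by apply: subS; exact: x_shrink.
Qed.

Lemma proj_z t w i : is_proj (sym_set (X i) (block (x t w) i) u)
  (block (gvec t w) i) (block (z t w) i).
Proof. by rewrite block_gvec; exact: (run_perturb run). Qed.

Lemma xz_in t w (b : bool) : prod_set X (x t w + (if b then u else - u) *: z t w).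
Proof.
move=> i; have [/sym_setP -/(_ u0)[h1 h2] _] := proj_z t w i.
by rewrite blockD blockZ; case: b => //; rewrite scaleNr.
Qed.

Lemma z_block_le t w i : norm2 (block (z t w) i) <= norm2 (block (gvec t w) i).
Proof.
apply: (norm2_proj_le _ _ (proj_z t w i)); first exact: sym_set_convex.
by apply: sym_set0 => //; exact: x_in.
Qed.

Lemma z_le t w : norm2 (z t w) <= norm2 (gvec t w).
Proof.
rewrite -(@ler_pXn2r _ 2)// ?nnegrE ?norm2_ge0// !sqr_norm2_block.
by apply: ler_sum => i _; rewrite ler_pXn2r// ?nnegrE ?norm2_ge0// z_block_le.
Qed.

Lemma z_eq_gvec t w : (0 < t)%N ->
  (forall i, u * norm2 (gvec t w) < delta * inradius (X i)) -> z t w = gvec t w.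
Proof.
move=> t0 h; apply/mxrowP => i; rewrite -/(block _ _) -/(block (gvec t w) i).
apply: (sym_proj_id (@cX i) delta01 u0 (x_shrink w i t0) _ (proj_z t w i)).
by apply: le_lt_trans (h i); rewrite ler_pM2l// norm2_block_le.
Qed.

(** By strong induction on t: a message that arrives at t carries a pair kept by its sender at an
    earlier time, and otherwise the agent's own previous pair is used. *)
Lemma memory_spec t i j w :
  (tau t i j = -1 /\ Dmem t i j w = 0) \/
  (exists s : nat, [/\ (s <= t)%N, tau t i j = s%:Z & Dmem t i j w = dq s j w]).
Proof.
elim/ltn_ind: t i j => t IH i j.
have [->|ji] := eqVneq j i.
  right; exists t; have [-> ->] := run_own run t i w; split => //.
have [[k _ hc] _] := run_adopt run t w ji.
have prev p : p = previous_pair Dmem tau t i j w ->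
    p = (0, -1) \/ (exists2 s : nat, (s <= t)%N & p = (dq s j w, s%:Z)).
  move=> ->; case: (t) IH => [|t'] IH; first by left.
  rewrite /previous_pair /pair_at; case: (IH t' (ltnSn _) i j) => [[-> ->]|]; first by left.
  move=> [s [st -> ->]]; right; exists s => //; exact: leqW.
have : (Dmem t i j w, tau t i j) = (0, -1) \/
    (exists2 s : nat, (s <= t)%N & (Dmem t i j w, tau t i j) = (dq s j w, s%:Z)).
  move: hc; rewrite /candidate; case E: (arrivals t i k) => [|a l].
    exact: prev.
  rewrite -E => -[s sa]; rewrite /pair_at => ->.
  have st := run_causal run sa.
  case: (IH s st k j) => [[-> ->]|]; first by left.
  move=> [s' [s's -> ->]]; right; exists s' => //; exact: leq_trans s's (ltnW st).
case=> [[-> ->]|[s st [-> ->]]]; first by left.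
by right; exists s.
Qed.

Definition term s i j w : 'rV[R]_(dim i) := dq s j w *: block (z s w) i.

Definition delayed t i j w : 'rV[R]_(dim i) :=
  if tau t i j is Posz s then term s i j w else 0.

Lemma delayedE t i j w : Dmem t i j w *: z_at z i (tau t i j) w = delayed t i j w.
Proof.
rewrite /delayed; case: (memory_spec t i j w) => [[-> ->]|[s [_ -> ->]]] //.
by rewrite scale0r.
Qed.

Lemma gradE t i w : grad t i w = n%:R^-1 *: \sum_j delayed t i j w.
Proof.
by rewrite /gradient_estimate; congr (_ *: _); apply: eq_bigr => j _; exact: delayedE.
Qed.

(** The time stamps are not random, so [memory_spec] may be read at an arbitrary sample point. *)
Lemma tau_le t i j s : tau t i j = Posz s -> (s <= t)%N.
Proof.
move=> e; case: (memory_spec t i j point) => [[]|[s' []]]; rewrite e// => s't [->].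
by [].
Qed.

(** After time B every estimate stems from a time s >= 1, at which x(s) lies in the shrunken set. *)
Lemma tau_delay t i j : exists s : nat,
  (t <= Bmax edge Delta)%N \/
  [/\ tau t i j = Posz s, (0 < s)%N, (s <= t)%N & (t - s <= gdist edge i j + Delta)%N].
Proof.
case: (leqP t (Bmax edge Delta)) => tB; first by exists 0%N; left.
have h := run_delay run t i j.
have hB : (gdist edge i j + Delta <= Bmax edge Delta)%N.
  rewrite /Bmax leq_add2r.
  apply: leq_trans (leq_bigmax (F := fun i => \max_j gdist edge i j) i).
  exact: (leq_bigmax (F := fun j => gdist edge i j) j).
case: (memory_spec t i j point) => [[e _]|[s [st e _]]].
  by rewrite e in h; lia.
by exists s; right; rewrite e in h; split => //; lia.
Qed.

(** * Filtration of the samples and adaptedness of the run *)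

Definition stime (a : sample_index dim) : nat :=
  match a with inl (t, _) => t | inr (_, t, _) => t end.

Definition past t : set (sample_index dim) := [set a | (stime a < t)%N].
Definition fresh t : set (sample_index dim) :=
  [set a | exists k : {i : 'I_n & 'I_(dim i)}, a = inl (t, k)].
(** These samples determine x(t) and z(t) but exclude the noises of time t, which are thereby
    independent of both. *)
Definition pastg t : set (sample_index dim) := past t `|` fresh t.

Lemma mY a : measurable_fun setT (Y a).
Proof. by case: a => [[t k]|[[b t] i]] /=; exact: measurable_funP. Qed.

Let iY : mutually_independent P Y := sample_indep smp.

Lemma past_le t t' : (t <= t')%N -> past t `<=` past t'.
Proof. by move=> tt a /= h; exact: leq_trans h tt. Qed.

Lemma pastg_past t : pastg t `<=` past t.+1.
Proof.
move=> a [|[k ->]]; last exact: ltnSn.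
by rewrite /past/= => h; rewrite ltnS ltnW.
Qed.

Notation meas S h := (measurable_fun setT (h : subT Y S -> R)).

Lemma meas_gauss t i k : meas (fresh t) (fun w => gauss t i k w).
Proof.
have := @measurable_fun_sample _ _ R _ Y (fresh t)
  (inl (t, Tagged (fun i => 'I_(dim i)) k) : sample_index dim).
by apply; exists (Tagged (fun i => 'I_(dim i)) k).
Qed.

Lemma meas_noise t b j : meas (past t.+1) (fun w => noise b t j w).
Proof.
have := @measurable_fun_sample _ _ R _ Y (past t.+1) (inr (b, t, j) : sample_index dim).
apply; exact: ltnSn.
Qed.

Let norm2_le_card m (v : 'rV[R]_m) (r : R) : 0 < r -> (forall k, `|v 0 k| < r) ->
  norm2 v < r * (m.+1)%:R.
Proof.
move=> r0 h; apply: (@le_lt_trans _ _ (r *+ m)).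
  by apply: norm2_le_coord => k; exact: ltW.
by rewrite mulr_natr ltr_pMn2l.
Qed.

(** The projection is only implicitly defined, but by [sym_proj_stable] it depends continuously on
    x(t) and on the Gaussian vector. *)
Lemma meas_z_block t i (k : 'I_(dim i)) :
  (forall a, meas (past t) (fun w => x t w 0 a)) ->
  meas (pastg t) (fun w => block (z t w) i 0 k).
Proof.
move=> mx.
pose y (a : 'I_(dim i) + 'I_(dim i)) (w : subT Y (pastg t)) : R :=
  match a with inl a => block (x t w) i 0 a | inr a => gauss t i a w end.
apply: (measurable_fun_continuous_family (y := y)) => [[a|a]|w e e0].
- have -> : y (inl a) = (fun w => x t w 0 (tagnat.Rank i a)).
    by apply/funext => w; rewrite /y blockE.
  by apply: (measurable_fun_sub _ (mx _)) => s; left.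
- by apply: (measurable_fun_sub _ (@meas_gauss t i a)) => s; right.
pose q := block (gvec t w) i; pose c := norm2 q.
have c0 : 0 <= c by exact: norm2_ge0.
(* Chosen such that 8 s |q| |q'| <= e^2 / 4 as soon as |q'| <= c + 1. *)
pose s : R := e ^+ 2 / (32 * (c + 1) ^+ 2).
have s0 : 0 < s.
  by rewrite divr_gt0// ?exprn_gt0// mulr_gt0// exprn_gt0//; lra.
have /andP[d0 d1] := delta01.
pose M : R := Num.min (Num.min 1 (e / 2)) (s * (delta * inradius (X i))).
have M0 : 0 < M.
  by rewrite !lt_min ltr01 divr_gt0//= mulr_gt0// mulr_gt0// rad0.
have M1 : M <= 1 by rewrite !ge_min lexx.
have Me : M <= e / 2 by rewrite !ge_min lexx orbT.
have Ms : M <= s * (delta * inradius (X i)) by rewrite !ge_min lexx !orbT.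
exists (M / (dim i).+1%:R); first by rewrite divr_gt0.
move=> w' hw'.
have small (v : 'rV[R]_(dim i)) : (forall k, `|v 0 k| < M / (dim i).+1%:R) -> norm2 v < M.
  move=> hv; have := norm2_le_card (divr_gt0 M0 (ltr0Sn R (dim i))) hv.
  by rewrite divfK.
pose q' := block (gvec t w') i.
have hq : norm2 (q - q') < M.
  rewrite norm2_sub; apply: small => l; have := hw' (inr l).
  by rewrite /= /q /q' !block_gvec !mxE.
have hx : norm2 (block (x t w) i - block (x t w') i) < M.
  rewrite norm2_sub; apply: small => l; have := hw' (inl l).
  by rewrite /= !mxE.
have stable : norm2 (block (z t w) i - block (z t w') i) ^+ 2 <=
    norm2 (q - q') ^+ 2 + 8 * s * (norm2 q * norm2 q').
  (* At time 0 the profile may lack the margin required by [sym_set_scale], but it is constant, so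
     that the two symmetric sets coincide and s = 0 is admissible. *)
  have [t0|t0] := posnP t.
    have h0 : norm2 (block (z t w) i - block (z t w') i) ^+ 2 <=
       norm2 (q - q') ^+ 2 + 8 * 0 * (norm2 q * norm2 q').
      have xe : x t w = x t w' by rewrite t0 !(run_init run).
      apply: (sym_proj_stable (@cX i) u0 (x_in t w i) (x_in t w' i) (lexx 0) _ _
        (proj_z t w i) (proj_z t w' i)) => p; rewrite addr0 invr1 scale1r xe.
      - by [].
      - by [].
    apply: (le_trans h0); rewrite mulr0 mul0r addr0 lerDl.
    by apply: mulr_ge0; [apply: mulr_ge0 => //; exact: ltW|rewrite mulr_ge0 ?norm2_ge0].
  apply: (sym_proj_stable (@cX i) u0 (x_in t w i) (x_in t w' i) (ltW s0) _ _
        (proj_z t w i) (proj_z t w' i)) => p.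
  - apply: (sym_set_scale (@cX i) delta01 u0) => //; try exact: x_shrink.
    exact: lt_le_trans hx Ms.
  - apply: (sym_set_scale (@cX i) delta01 u0) => //; try exact: x_shrink.
    by rewrite norm2_sub; exact: lt_le_trans hx Ms.
have q'1 : norm2 q' <= c + 1.
  have := ler_norm2D q (q' - q); rewrite addrC subrK => h.
  by apply: (le_trans h); rewrite -/c lerD2l norm2_sub ltW// (lt_le_trans hq).
have b1 : 8 * s * (norm2 q * norm2 q') <= e ^+ 2 / 4.
  apply: (@le_trans _ _ (8 * s * ((c + 1) * (c + 1)))).
    apply: ler_wpM2l; first by apply: mulr_ge0 => //; exact: ltW.
    by apply: ler_pM; rewrite ?norm2_ge0// -/c; lra.
  rewrite /s le_eqVlt; apply/orP; left; apply/eqP; field.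
  by rewrite gt_eqF//; lra.
have b2 : norm2 (q - q') ^+ 2 <= e ^+ 2 / 4.
  have -> : e ^+ 2 / 4 = (e / 2) ^+ 2 by field.
  rewrite ler_pXn2r// ?nnegrE ?norm2_ge0//; first by lra.
  lra.
apply: (@le_lt_trans _ _ (norm2 (block (z t w) i - block (z t w') i))).
  rewrite norm2_sub; apply: le_trans (normr_coord_le _ k).
  by rewrite !mxE.
rewrite -(@ltr_pXn2r _ 2)// ?nnegrE ?norm2_ge0 ?(ltW e0)//.
have := exprn_gt0 2 e0; lra.
Qed.

(* Extending the local costs outside of X keeps all compositions measurable. *)
Definition fext j : profile R dim -> R := mcshane (prod_set X) G (f j).

Let X_ne : prod_set X !=set0. Proof. by exists x0. Qed.

Lemma fext_eq j p : prod_set X p -> fext j p = f j p.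
Proof. by move=> Xp; apply: mcshane_eq => //; exact: ltW. Qed.

Lemma fext_lip j p q : `|fext j p - fext j q| <= G * norm2 (p - q).
Proof. by apply: mcshane_lip => //; exact: ltW. Qed.

Lemma observationE b t j w : observation f u noise x z b t j w =
  fext j (x t w + (if b then u else - u) *: z t w) + noise b t j w.
Proof. by rewrite /observation fext_eq//; exact: xz_in. Qed.

Lemma meas_coord_comp d' (T' : measurableType d') (h : profile R dim -> R) (C : R)
    (V : T' -> profile R dim) :
  (forall v v', `|h v - h v'| <= C * norm2 (v - v')) ->
  (forall a, measurable_fun setT (fun w => V w 0 a)) ->
  measurable_fun setT (fun w => h (V w)).
Proof.
move=> hl mV; exact: (measurableT_comp (measurable_vec_lip hl) (measurable_to_vec mV)).
Qed.

Lemma meas_z t a : (forall a, meas (past t) (fun w => x t w 0 a)) ->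
  meas (pastg t) (fun w => z t w 0 a).
Proof.
move=> mx; have := @meas_z_block t (tagnat.sig1 a) (tagnat.sig2 a) mx.
rewrite (_ : (fun w => _) = (fun w => z t w 0 a))//.
by apply/funext => w; rewrite blockE tagnat.sig2K.
Qed.

Lemma meas_dq t j : (forall a, meas (past t) (fun w => x t w 0 a)) ->
  meas (past t.+1) (fun w => dq t j w).
Proof.
move=> mx.
have mobs b : meas (past t.+1) (fun w => observation f u noise x z b t j w).
  rewrite (_ : (fun w => _) = (fun w => fext j (x t w + (if b then u else - u) *: z t w)
     + noise b t j w)); last by apply/funext => w; rewrite observationE.
  apply: measurable_funD; last exact: meas_noise.
  apply: (meas_coord_comp (fext_lip j)) => a.
  rewrite (_ : (fun w => _) = (fun w => x t w 0 a + (if b then u else - u) * z t w 0 a));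
    last by apply/funext => w; rewrite !mxE.
  apply: measurable_funD.
    by apply: (measurable_fun_sub _ (mx a)); exact: past_le.
  apply: measurable_funM; first exact: measurable_cst.
  by apply: (measurable_fun_sub _ (meas_z a mx)); exact: pastg_past.
rewrite /diff_quotient; apply: measurable_funM; last exact: measurable_cst.
by apply: measurable_funB; exact: mobs.
Qed.

(** [run_meas] concerns the whole sigma-algebra, whereas independence needs measurability for the
    samples drawn before t. In the induction the mirror step enters as a continuous function of x(t)
    and of the estimate. *)
Lemma meas_x t a : meas (past t) (fun w => x t w 0 a).
Proof.
elim/ltn_ind: t a => -[|t] IH a.
  rewrite (_ : (fun w => _) = (fun=> x0 0 a)); first exact: measurable_cst.
  by apply/funext => w; rewrite (run_init run).
pose i := tagnat.sig1 a; pose k := tagnat.sig2 a.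
have -> : (fun w => x t.+1 w 0 a) = (fun w => block (x t.+1 w) i 0 k).
  by apply/funext => w; rewrite blockE tagnat.sig2K.
have mt : forall a, meas (past t.+1) (fun w => x t w 0 a).
  by move=> b; apply: (measurable_fun_sub _ (IH t (ltnSn t) b)); exact: past_le.
have mg (l : 'I_(dim i)) : meas (past t.+1) (fun w => grad t i w 0 l).
  rewrite (_ : (fun w => _) = (fun w => n%:R^-1 * \sum_j delayed t i j w 0 l)); last first.
    by apply/funext => w; rewrite gradE mxE summxE.
  apply: measurable_funM; first exact: measurable_cst.
  apply: measurable_sum => j; rewrite /delayed.
  case E : (tau t i j) => [s|s]; last first.
    rewrite (_ : (fun w => _) = (fun=> 0)); first exact: measurable_cst.
    by apply/funext => w; rewrite mxE.
  have st := tau_le E.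
  rewrite (_ : (fun w => _) = (fun w => dq s j w * block (z s w) i 0 l)); last first.
    by apply/funext => w; rewrite mxE.
  have ms : forall a, meas (past s) (fun w => x s w 0 a) by move=> b; exact: IH.
  apply: measurable_funM.
    by apply: (measurable_fun_sub _ (meas_dq j ms)); exact: past_le.
  apply: (measurable_fun_sub _ (meas_z_block l ms)) => b /pastg_past.
  exact: past_le.
pose y (b : 'I_(dim i) + 'I_(dim i)) (w : subT Y (past t.+1)) : R :=
  match b with inl b => block (x t w) i 0 b | inr b => grad t i w 0 b end.
apply: (measurable_fun_continuous_family (y := y)) => [[b|b]|w e e0].
- have -> : y (inl b) = (fun w => x t w 0 (tagnat.Rank i b)).
    by apply/funext => w; rewrite /y blockE.
  exact: mt.
- exact: mg.
have [gradP contP scP] := mirror i.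
have e2 : 0 < e / 2 by lra.
have [r r0 hr] := within_continuous_norm2 contP (x_in t w i) e2.
pose M : R := Num.min r (e / (2 * eta)).
have M0 : 0 < M by rewrite lt_min r0 divr_gt0// mulr_gt0.
exists (M / (dim i).+1%:R); first by rewrite divr_gt0.
move=> w' hw'.
have small (v : 'rV[R]_(dim i)) : (forall k, `|v 0 k| < M / (dim i).+1%:R) -> norm2 v < M.
  move=> hv; have := norm2_le_card (divr_gt0 M0 (ltr0Sn R (dim i))) hv.
  by rewrite divfK.
have hg : norm2 (grad t i w' - grad t i w) < M.
  by apply: small => l; have := hw' (inr l); rewrite /= !mxE.
have hx : norm2 (block (x t w') i - block (x t w) i) < M.
  by apply: small => l; have := hw' (inl l); rewrite /= !mxE.
apply: (@le_lt_trans _ _ (norm2 (block (x t.+1 w') i - block (x t.+1 w) i))).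
  by apply: le_trans (normr_coord_le _ k); rewrite !mxE.
have hl := mirror_step_lip (@cX i) (@cS i) (@subS i) eta0 scP gradP
  (x_in t w' i) (x_in t w i) (step_mirror t w' i) (step_mirror t w i).
apply: (le_lt_trans hl).
have h1 : eta * norm2 (grad t i w' - grad t i w) <= e / 2.
  have : norm2 (grad t i w' - grad t i w) <= e / (2 * eta).
    by rewrite ltW// (lt_le_trans hg)// ge_min lexx orbT.
  by rewrite ler_pdivlMr ?mulr_gt0//; lra.
have h2 : norm2 (gpsi i (block (x t w') i) - gpsi i (block (x t w) i)) < e / 2.
  by apply: hr; [exact: x_in|rewrite (lt_le_trans hx)// ge_min lexx].
lra.
Qed.

(** * Second moments of the estimates *)

Hypotheses (L0 : 0 < L) (sigma0 : 0 < sigma).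

Notation dd := (\sum_i dim i)%N.
Notation E Z := (Rintegral P setT Z).

Definition Rb : R := Num.sqrt (\sum_i Ri i ^+ 2).

Hypothesis small_u : 11 * (32 * 2 ^+ dd) * G ^+ 2 * u ^+ 2 <= 3 / 20 * sigma ^+ 2.

Lemma norm2_in p : prod_set X p -> norm2 p <= Rb.
Proof.
move=> Xp; rewrite -[norm2 p]ger0_norm ?norm2_ge0// -sqrtr_sqr.
apply: ler_wsqrtr; rewrite sqr_norm2_block; apply: ler_sum => i _.
case: setting => _ _ /(_ i)[Ri0 XR] _ _.
by rewrite ler_pXn2r// ?nnegrE ?norm2_ge0 ?(ltW Ri0)//; exact: (XR _ (Xp i)).
Qed.

Lemma Rb_ge0 : 0 <= Rb. Proof. exact: sqrtr_ge0. Qed.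

Lemma gvecE t w a : gvec t w 0 a = gauss t (tagnat.sig1 a) (tagnat.sig2 a) w.
Proof. by rewrite mxE mxE. Qed.

Lemma gauss_law t i k (phi : R -> R) : measurable_fun setT phi ->
  (forall y, 0 <= phi y) ->
  (\int[P]_w (phi (gauss t i k w))%:E = \int[normal_prob 0 1]_y (phi y)%:E)%E.
Proof.
move=> mphi phi0.
have mg : @measurable_fun _ _ Omega (measurableTypeR R) setT (gauss t i k).
  by move=> _ A mA; exact: (@measurable_funP _ _ _ _ setT (gauss t i k) measurableT A mA).
have mE : @measurable_fun _ _ (measurableTypeR R) _ setT (fun y : R => (phi y)%:E).
  exact/measurable_EFinP.
have := ge0_integral_pushforward mg P measurableT mE (fun y _ => phi0 y).
rewrite preimage_setT => <-.
apply: eq_measure_integral => A mA _; exact: (gaussP smp).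
Qed.

Lemma gvec_gaussian t : std_gaussian P (gvec t).
Proof.
split=> [a|phi mphi phi0].
  rewrite (_ : (fun w => _) = gauss t (tagnat.sig1 a) (tagnat.sig2 a)).
    exact: measurable_funP.
  by apply/funext => w; rewrite gvecE.
pose idx (a : 'I_dd) : sample_index dim := inl (t, tagnat.sig a).
pose phi' (s : sample_index dim) : R -> R :=
  match s with inl (_, k) => phi (tagnat.rank k) | inr _ => fun=> 1 end.
have uq : uniq [seq idx a | a <- index_enum 'I_dd].
  rewrite map_inj_uniq ?index_enum_uniq// => a b [] /tagnat.sig_inj; exact.
have mphi' s : measurable_fun setT (phi' s).
  by case: s => [[t' k]|[[b t'] i]] //=; exact: measurable_cst.
have phi'0 s y : 0 <= phi' s y by case: s => [[t' k]|[[b t'] i]] /=.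
have := prod_seq_indep_ge0 mY iY uq mphi' phi'0; rewrite !big_map => h.
transitivity (\int[P]_w (\prod_(j <- index_enum 'I_dd) phi' (idx j) (Y (idx j) w))%:E)%E.
  apply: eq_integral => w _; congr (_%:E); apply: eq_bigr => a _.
  by rewrite /= tagnat.sigK gvecE.
under eq_integral do rewrite -(big_map idx xpredT (fun s => phi' s (Y s _))).
rewrite h; apply: eq_bigr => a _; rewrite /= tagnat.sigK.
by rewrite gauss_law.
Qed.

Lemma noise_sq b t j : L1 P (fun w => noise b t j w ^+ 2) /\
  E (fun w => noise b t j w ^+ 2) <= sigma ^+ 2.
Proof.
have m1 : measurable_fun setT (noise b t j) by exact: measurable_funP.
have h : (\int[P]_w (noise b t j w ^+ 2)%:E <= (sigma ^+ 2)%:E)%E.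
  have := noise_var smp b t j.
  rewrite /variance unlock/= (noise_mean smp) /= unlock.
  apply: le_trans; rewrite le_eqVlt; apply/orP; left; apply/eqP.
  by apply: eq_integral => w _; rewrite expr2 -[noise b t j w]subr0.
have i : L1 P (fun w => noise b t j w ^+ 2).
  apply: L1_lty; [exact: measurable_funX|by move=> w; exact: sqr_ge0|].
  exact: le_lt_trans h (ltry _).
by split=> //; rewrite -lee_fin EFin_E.
Qed.

Lemma noise_L1 b t j : L1 P (noise b t j).
Proof.
apply: (L1_dom _ (L1D (L1_cst P 1) (noise_sq b t j).1)).
  exact: measurable_funP.
move=> w /=; have := sqr_ge0 (`|noise b t j w| - 1); rewrite sqrrB expr1n mulr1.
rewrite real_normK ?num_real//; have := sqr_ge0 (noise b t j w); nra.
Qed.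

Lemma noise_E b t j : E (noise b t j) = 0.
Proof. apply: EFin_inj; rewrite EFin_E; last exact: noise_L1.
by have := noise_mean smp b t j; rewrite unlock. Qed.

(** Formed with the extended costs, so that Gaussian directions of any length are allowed. *)
Definition cdiff j (p v : profile R dim) : R :=
  (fext j (p + u *: v) - fext j (p - u *: v)) / (2 * u).

Lemma cdiff_le j p v : `|cdiff j p v| <= G * norm2 v.
Proof.
rewrite /cdiff normrM normfV (gtr0_norm (x := 2 * u)) ?mulr_gt0// ler_pdivrMr ?mulr_gt0//.
apply: (le_trans (fext_lip _ _ _)).
have -> : p + u *: v - (p - u *: v) = (2 * u) *: v.
  by apply/rowP => k; rewrite !mxE; ring.
by rewrite norm2Z gtr0_norm ?mulr_gt0//; lra.
Qed.

Definition perturb t j w : R := (noise true t j w - noise false t j w) / (2 * u).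

Lemma dqE t j w : dq t j w = cdiff j (x t w) (z t w) + perturb t j w.
Proof.
rewrite /diff_quotient !observationE /cdiff /perturb scaleNr; field.
exact: lt0r_neq0.
Qed.

Lemma sqr_norm2_gvec t w i : norm2 (block (gvec t w) i) ^+ 2 = \sum_k gauss t i k w ^+ 2.
Proof. by rewrite sqr_norm2E; apply: eq_bigr => k _; rewrite block_gvec mxE. Qed.

Lemma noise_gauss b t j t' i k :
  L1 P (fun w => noise b t j w ^+ 2 * gauss t' i k w ^+ 2) /\
  E (fun w => noise b t j w ^+ 2 * gauss t' i k w ^+ 2) <= sigma ^+ 2.
Proof.
pose a : sample_index dim := inr (b, t, j).
pose c : sample_index dim := inl (t', Tagged (fun i => 'I_(dim i)) k).
have [ig Eg] := gaussian_coord_sqr (gvec_gaussian t') (tagnat.Rank i k).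
have eg : (fun w => gvec t' w 0 (tagnat.Rank i k) ^+ 2) = (fun w => gauss t' i k w ^+ 2).
  by apply/funext => w; rewrite -blockE block_gvec mxE.
rewrite eg in ig Eg.
have [ie Ee] := noise_sq b t j.
have [ip Ep] := L1_prod_indep mY iY (S1 := [set a]) (S2 := [set c])
  (U := fun w => noise b t j w ^+ 2) (V := fun w => gauss t' i k w ^+ 2)
  ltac:(by apply/seteqP; split => // s [/= -> ])
  (measurable_funX 2 (@measurable_fun_sample _ _ R _ Y [set a] a erefl))
  (measurable_funX 2 (@measurable_fun_sample _ _ R _ Y [set c] c erefl))
  (fun w => sqr_ge0 _) (fun w => sqr_ge0 _) ie ig.
split=> //; rewrite Ep.
have := E_ge0 P (fun w => sqr_ge0 (noise b t j w)).
have := E_ge0 P (fun w => sqr_ge0 (gauss t' i k w)); nra.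
Qed.

(** Bound on the second moment of an estimate, per coordinate of z^i. Its factor is 5/4 = 11/10 +
    3/20: 11/10 for the noise, after (A + p)^2 <= 11 A^2 + 11/10 p^2, and 3/20 for the smooth part,
    by [small_u]. *)
Definition Vc : R := 5 / 4 * sigma ^+ 2 / u ^+ 2.

Lemma Vc_ge0 : 0 <= Vc.
Proof. by apply: divr_ge0; [apply: mulr_ge0 => //; exact: sqr_ge0|exact: sqr_ge0]. Qed.

Lemma meas_term s i j k : measurable_fun setT (fun w => term s i j w 0 k).
Proof.
rewrite (_ : (fun w => _) = (fun w => dq s j w * block (z s w) i 0 k)); last first.
  by apply/funext => w; rewrite mxE.
apply: measurable_funM.
  exact: (measurable_fun_subW mY (meas_dq j (@meas_x s))).
exact: (measurable_fun_subW mY (meas_z_block k (@meas_x s))).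
Qed.

Lemma measurable_norm2_comp d' (T' : measurableType d') m (V : T' -> 'rV[R]_m) :
  (forall k, measurable_fun setT (fun w => V w 0 k)) ->
  measurable_fun setT (fun w => norm2 (V w)).
Proof.
move=> mV; exact: (measurableT_comp (@measurable_norm2 R m) (measurable_to_vec mV)).
Qed.

Lemma term_sq s i j : L1 P (fun w => norm2 (term s i j w) ^+ 2) /\
  E (fun w => norm2 (term s i j w) ^+ 2) <= Vc * (dim i)%:R.
Proof.
have u2 : 0 < u ^+ 2 by rewrite exprn_gt0.
pose N w : R := \sum_k (noise true s j w ^+ 2 * gauss s i k w ^+ 2
                      + noise false s j w ^+ 2 * gauss s i k w ^+ 2).
(* The fourth power combines the Lipschitz bound of the central difference with |z^i|^2; in contrast
   to the noise part, it has no factor 1 / u^2. *)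
pose Bd w : R := 11 / 20 / u ^+ 2 * N w + 11 * G ^+ 2 * norm2 (gvec s w) ^+ 4.
have iN : L1 P N.
  by apply: L1_sum => k; apply: L1D; exact: (noise_gauss _ _ _ _ _).1.
have EN : E N <= 2 * sigma ^+ 2 * (dim i)%:R.
  rewrite /N E_sum => [|k]; last by apply: L1D; exact: (noise_gauss _ _ _ _ _).1.
  rewrite mulr_natr -[in leRHS](card_ord (dim i)) -sumr_const; apply: ler_sum => k _.
  rewrite E_D; [|exact: (noise_gauss _ _ _ _ _).1..].
  have := (noise_gauss true s j s k).2; have := (noise_gauss false s j s k).2; lra.
have [i4 E4] := gaussian_norm_four (gvec_gaussian s).
have iB : L1 P Bd by apply: L1D; exact: L1Z.
have bnd w : norm2 (term s i j w) ^+ 2 <= Bd w.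
  rewrite /term norm2Z exprMn real_normK ?num_real// dqE.
  pose A := cdiff j (x s w) (z s w); pose e1 := noise true s j w; pose e2 := noise false s j w.
  pose g := norm2 (gvec s w); pose q := norm2 (block (gvec s w) i).
  have hA : A ^+ 2 <= G ^+ 2 * g ^+ 2.
    rewrite -exprMn -real_normK ?num_real// ler_pXn2r// ?nnegrE//.
      by apply: (le_trans (cdiff_le _ _ _)); rewrite ler_pM2l// z_le.
    by rewrite mulr_ge0 ?norm2_ge0// ltW.
  have hp : perturb s j w ^+ 2 <= (e1 ^+ 2 + e2 ^+ 2) / (2 * u ^+ 2).
    rewrite /perturb -/e1 -/e2 ler_pdivlMr ?mulr_gt0//.
    have -> : ((e1 - e2) / (2 * u)) ^+ 2 * (2 * u ^+ 2) = (e1 - e2) ^+ 2 / 2.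
      by field; exact: lt0r_neq0.
    have := sqr_ge0 (e1 + e2); nra.
  have hd : (A + perturb s j w) ^+ 2 <= 11 / 10 * perturb s j w ^+ 2 + 11 * A ^+ 2.
    have := sqr_ge0 (10 * A - perturb s j w); nra.
  have hq : norm2 (block (z s w) i) ^+ 2 <= q ^+ 2.
    by rewrite ler_pXn2r// ?nnegrE ?norm2_ge0// z_block_le.
  have qg : q ^+ 2 <= g ^+ 2.
    by rewrite ler_pXn2r// ?nnegrE ?norm2_ge0// norm2_block_le.
  have q0 := sqr_ge0 q.
  have eN : N w = (e1 ^+ 2 + e2 ^+ 2) * q ^+ 2.
    rewrite /N /q sqr_norm2_gvec mulr_sumr; apply: eq_bigr => k _.
    by rewrite /e1 /e2; ring.
  apply: (@le_trans _ _ ((11 / 10 * ((e1 ^+ 2 + e2 ^+ 2) / (2 * u ^+ 2))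
                          + 11 * (G ^+ 2 * g ^+ 2)) * q ^+ 2)).
    apply: ler_pM => //; rewrite ?sqr_ge0//; apply: (le_trans hd); lra.
  have e3 : 11 / 20 / u ^+ 2 * N w = 11 / 10 * ((e1 ^+ 2 + e2 ^+ 2) / (2 * u ^+ 2)) * q ^+ 2.
    by rewrite eN; field; exact: lt0r_neq0.
  rewrite /Bd e3 mulrDl lerD2l -/g.
  have -> : g ^+ 4 = g ^+ 2 * g ^+ 2 by rewrite -exprD.
  have : 11 * (G ^+ 2 * g ^+ 2) * q ^+ 2 <= 11 * (G ^+ 2 * g ^+ 2) * g ^+ 2.
    by apply: ler_wpM2l => //; apply: mulr_ge0 => //; apply: mulr_ge0; exact: sqr_ge0.
  lra.
have mT : measurable_fun setT (fun w => norm2 (term s i j w) ^+ 2).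
  by apply: measurable_funX; apply: measurable_norm2_comp => k; exact: meas_term.
have iT : L1 P (fun w => norm2 (term s i j w) ^+ 2).
  by apply: (L1_dom mT iB) => w; rewrite ger0_norm ?sqr_ge0.
split=> //; apply: (le_trans (E_le iT iB bnd)).
rewrite /Bd E_D ?E_Z//; [|exact: L1Z..].
have h1 : 11 / 20 / u ^+ 2 * E N <= 11 / 20 / u ^+ 2 * (2 * sigma ^+ 2 * (dim i)%:R).
  by apply: ler_wpM2l => //; rewrite divr_ge0 ?ltW.
have h2 : 11 * G ^+ 2 * E (fun w => norm2 (gvec s w) ^+ 4) <=
    3 / 20 * sigma ^+ 2 / u ^+ 2.
  rewrite ler_pdivlMr//; apply: le_trans small_u.
  have : 11 * G ^+ 2 * E (fun w => norm2 (gvec s w) ^+ 4) <=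
         11 * G ^+ 2 * (32 * 2 ^+ dd).
    by apply: ler_wpM2l => //; rewrite mulr_ge0// sqr_ge0.
  by move=> /(ler_wpM2r (ltW u2)); lra.
have d1 : 1 <= (dim i)%:R :> R by rewrite ler1n; case: setting => -[_ /(_ i)].
have w0 : 0 <= sigma ^+ 2 / u ^+ 2 by rewrite divr_ge0 ?sqr_ge0 ?ltW.
have h3 : sigma ^+ 2 / u ^+ 2 <= sigma ^+ 2 / u ^+ 2 * (dim i)%:R by rewrite ler_peMr.
rewrite /Vc; lra.
Qed.

Lemma delayed_sq t i j : L1 P (fun w => norm2 (delayed t i j w) ^+ 2) /\
  E (fun w => norm2 (delayed t i j w) ^+ 2) <= Vc * (dim i)%:R.
Proof.
rewrite /delayed; case: (tau t i j) => s; first exact: term_sq.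
have e : (fun w : Omega => norm2 (0 : 'rV[R]_(dim i)) ^+ 2) = (fun=> 0).
  by apply/funext => w; rewrite norm20 expr0n.
rewrite e E_cst; split; first exact: L1_cst.
by rewrite mulr_ge0// Vc_ge0.
Qed.

Lemma meas_grad t i k : measurable_fun setT (fun w => grad t i w 0 k).
Proof.
rewrite (_ : (fun w => _) = (fun w => n%:R^-1 * \sum_j delayed t i j w 0 k)); last first.
  by apply/funext => w; rewrite gradE mxE summxE.
apply: measurable_funM; first exact: measurable_cst.
apply: measurable_sum => j; rewrite /delayed; case: (tau t i j) => s.
  exact: meas_term.
rewrite (_ : (fun w => _) = (fun=> 0)); first exact: measurable_cst.
by apply/funext => w; rewrite mxE.
Qed.

Lemma grad_sq t i : L1 P (fun w => norm2 (grad t i w) ^+ 2) /\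
  E (fun w => norm2 (grad t i w) ^+ 2) <= Vc * (dim i)%:R.
Proof.
have nR : 0 < n%:R :> R by rewrite ltr0n.
pose Bd w := n%:R^-1 * \sum_j norm2 (delayed t i j w) ^+ 2.
have iB : L1 P Bd by apply: L1Z; apply: L1_sum => j; exact: (delayed_sq t i j).1.
have bnd w : norm2 (grad t i w) ^+ 2 <= Bd w by rewrite gradE; exact: sqr_norm2_avg.
have iT : L1 P (fun w => norm2 (grad t i w) ^+ 2).
  apply: (L1_dom _ iB) => [|w]; last by rewrite ger0_norm ?sqr_ge0.
  by apply: measurable_funX; apply: measurable_norm2_comp => k; exact: meas_grad.
split=> //; apply: (le_trans (E_le iT iB bnd)).
rewrite /Bd E_Z; last by apply: L1_sum => j; exact: (delayed_sq t i j).1.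
rewrite E_sum; last by move=> j; exact: (delayed_sq t i j).1.
rewrite ler_pdivrMl// mulr_natl -[in leRHS](card_ord n) -sumr_const.
by apply: ler_sum => j _; exact: (delayed_sq t i j).2.
Qed.

Lemma measurable_dot_fun d' (T' : measurableType d') m (V W : T' -> 'rV[R]_m) :
  (forall k, measurable_fun setT (fun w => V w 0 k)) ->
  (forall k, measurable_fun setT (fun w => W w 0 k)) ->
  measurable_fun setT (fun w => dot (V w) (W w)).
Proof.
move=> mV mW; rewrite /dot; apply: measurable_sum => k.
by apply: measurable_funM; [exact: mV|exact: mW].
Qed.

(** * Expected drift towards a point of the shrunken set *)

Variables (xt : profile R dim) (rho : R).

Definition Sset (p : profile R dim) := forall i, shrink delta (X i) (block p i).

Hypotheses (rho1 : 1 <= rho) (rad : forall i, u * rho <= delta * inradius (X i))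
  (Sxt : Sset xt).

Lemma Sset_in p : Sset p -> prod_set X p.
Proof. by move=> Sp i; apply: subS; exact: Sp. Qed.

Lemma Sset_add p v : Sset p -> norm2 v < rho -> prod_set X (p + u *: v).
Proof.
move=> Sp vr i; have /andP[d0 d1] := delta01; rewrite blockD blockZ.
have -> : u *: block v i = delta *: ((u / delta) *: block v i).
  by rewrite scalerA mulrC divfK// gt_eqF.
apply: (shrink_add (@cX i) delta01) => //; apply: in_inradius.
rewrite norm2Z gtr0_norm ?divr_gt0// mulrAC ltr_pdivrMr//.
rewrite [ltRHS]mulrC; apply: lt_le_trans (rad i); rewrite ltr_pM2l//.
exact: le_lt_trans (norm2_block_le _ _) vr.
Qed.

Lemma Sset_sub p v : Sset p -> norm2 v < rho -> prod_set X (p - u *: v).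
Proof. by move=> Sp vr; rewrite -scalerN; apply: Sset_add => //; rewrite norm2N. Qed.

Lemma dist_xt p : prod_set X p -> norm2 (p - xt) <= 2 * Rb.
Proof.
move=> Xp; have := norm2_in Xp; have := norm2_in (Sset_in Sxt).
have := ler_norm2B p xt; lra.
Qed.

Lemma dot_xt p (v : profile R dim) i : prod_set X p ->
  `|dot (block v i) (block p i - block xt i)| <= norm2 v * (2 * Rb).
Proof.
move=> Xp; apply: (le_trans (normr_dot_le _ _)).
apply: ler_pM; rewrite ?norm2_ge0 ?norm2_block_le// -blockB.
exact: le_trans (norm2_block_le _ _) (dist_xt Xp).
Qed.

(** The contribution of agents i and j to the drift towards [xt], as a function of a frozen base
    point and direction. *)
Definition hij i j (p v : profile R dim) : R :=
  cdiff j p v * dot (block v i) (block p i - block xt i).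

Lemma hij_le i j p v : prod_set X p -> `|hij i j p v| <= 2 * G * Rb * norm2 v ^+ 2.
Proof.
move=> Xp; rewrite /hij normrM.
have -> : 2 * G * Rb * norm2 v ^+ 2 = (G * norm2 v) * (norm2 v * (2 * Rb)) by ring.
by apply: ler_pM => //; [exact: cdiff_le|exact: dot_xt].
Qed.

Lemma measurable_hij i j p : measurable_fun setT (hij i j p : vecT R dd -> R).
Proof.
apply: measurable_funM.
  apply: measurable_funM; last exact: measurable_cst.
  apply: measurable_funB.
  - apply: (@measurable_vec_lip _ _ _ (G * u)) => v v'.
    apply: (le_trans (fext_lip _ _ _)); rewrite -mulrA ler_pM2l//.
    have -> : p + u *: v - (p + u *: v') = u *: (v - v').
      by apply/rowP => k; rewrite !mxE; ring.
    by rewrite norm2Z gtr0_norm.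
  - apply: (@measurable_vec_lip _ _ _ (G * u)) => v v'.
    apply: (le_trans (fext_lip _ _ _)); rewrite -mulrA ler_pM2l//.
    have -> : p - u *: v - (p - u *: v') = u *: (v' - v).
      by apply/rowP => k; rewrite !mxE; ring.
    by rewrite norm2Z gtr0_norm// norm2_sub.
apply: (@measurable_vec_lip _ _ _ (norm2 (block p i - block xt i))) => v v'.
rewrite -dotBl -blockB (le_trans (normr_dot_le _ _))// mulrC.
by rewrite ler_wpM2l ?norm2_ge0// norm2_block_le.
Qed.

(** All errors due to long Gaussian vectors are expressed by this tail moment, which by [tail_time]
    is the same at all times. *)
Definition kappa : R := E (fun w => norm2 (gvec 0 w) ^+ 2 * tailind rho (gvec 0 w)).

Let rho0 : 0 <= rho. Proof. exact: le_trans ler01 rho1. Qed.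

Lemma kappa_le : kappa <= 8 * 2 ^+ dd * expR (- (rho ^+ 2 / 4)).
Proof. exact: (gaussian_tail (gvec_gaussian 0) rho0).2. Qed.

Lemma kappa_ge0 : 0 <= kappa.
Proof.
by apply: E_ge0 => w; rewrite tailindE mulr_ge0 ?sqr_ge0.
Qed.

Lemma tail_time s :
  L1 P (fun w => norm2 (gvec s w) ^+ 2 * tailind rho (gvec s w)) /\
  E (fun w => norm2 (gvec s w) ^+ 2 * tailind rho (gvec s w)) = kappa.
Proof.
apply: (std_gaussian_law_real (h := fun v => norm2 v ^+ 2 * tailind rho v)
  (gvec_gaussian 0) (gvec_gaussian s)).
  apply: measurable_funM; last exact: measurable_tailind.
  by apply: measurable_funX; exact: measurable_norm2.
exact: (gaussian_tail (gvec_gaussian 0) rho0).1.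
Qed.

Lemma hij_L1 i j p t : prod_set X p -> L1 P (fun w => hij i j p (gvec t w)).
Proof.
move=> Xp; have [iq _] := gaussian_norm_sqr (gvec_gaussian t).
apply: (L1_dom _ (L1Z (2 * G * Rb) iq)) => [|w]; last exact: hij_le.
exact: (measurable_vec_comp (gvec_gaussian t) (measurable_hij i j p)).
Qed.

Definition Hij i j p : R := E (fun w => hij i j p (gvec 0 w)).

Lemma Hij_time i j p t : prod_set X p -> E (fun w => hij i j p (gvec t w)) = Hij i j p.
Proof.
move=> Xp; exact: (std_gaussian_law_real (gvec_gaussian 0) (gvec_gaussian t)
  (measurable_hij i j p) (hij_L1 i j 0 Xp)).2.
Qed.

(** x(s) is a function of the past and the Gaussian vector of time s is fresh, so the latter can be
    averaged out with x(s) frozen. *)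
Lemma drift_fubini i j s : [/\ L1 P (fun w => Hij i j (x s w)),
  L1 P (fun w => hij i j (x s w) (gvec s w)) &
  E (fun w => hij i j (x s w) (gvec s w)) = E (fun w => Hij i j (x s w))].
Proof.
have [iq _] := gaussian_norm_sqr (gvec_gaussian s).
have mg a : meas (fresh s) (fun w => gvec s w 0 a).
  rewrite (_ : (fun w => _) = (fun w => gauss s (tagnat.sig1 a) (tagnat.sig2 a) w)).
    exact: meas_gauss.
  by apply/funext => w; rewrite gvecE.
have mx1 a : measurable_fun setT
    (fun q : subT Y (past s) * subT Y (fresh s) => x s q.1 0 a).
  exact: (measurableT_comp (@meas_x s a) (@measurable_fst _ _ _ _)).
have mg2 a : measurable_fun setT
    (fun q : subT Y (past s) * subT Y (fresh s) => gvec s q.2 0 a).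
  exact: (measurableT_comp (mg a) (@measurable_snd _ _ _ _)).
have mh : measurable_fun setT (fun q : subT Y (past s) * subT Y (fresh s) =>
    hij i j (x s q.1) (gvec s q.2)).
  apply: measurable_funM.
    apply: measurable_funM; last exact: measurable_cst.
    apply: measurable_funB; apply: (meas_coord_comp (fext_lip j)) => a.
      rewrite (_ : (fun w => _) = (fun q => x s q.1 0 a + u * gvec s q.2 0 a));
        last by apply/funext => q; rewrite !mxE.
      apply: measurable_funD; first exact: mx1.
      by apply: measurable_funM; [exact: measurable_cst|exact: mg2].
    rewrite (_ : (fun w => _) = (fun q => x s q.1 0 a - u * gvec s q.2 0 a));
      last by apply/funext => q; rewrite !mxE.
    apply: measurable_funB; first exact: mx1.
    by apply: measurable_funM; [exact: measurable_cst|exact: mg2].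
  apply: measurable_dot_fun => k.
    rewrite (_ : (fun w => _) = (fun q => gvec s q.2 0 (tagnat.Rank i k))); first exact: mg2.
    by apply/funext => q; rewrite blockE.
  rewrite (_ : (fun w => _) = (fun q => x s q.1 0 (tagnat.Rank i k) - block xt i 0 k)).
    by apply: measurable_funB; [exact: mx1|exact: measurable_cst].
  by apply/funext => q; rewrite -blockE !mxE.
have disj : past s `&` fresh s = set0.
  by apply/seteqP; split => // a [h [k e]]; move: h; rewrite e /past/= ltnn.
have mq : meas (fresh s) (fun w => 2 * G * Rb * norm2 (gvec s w) ^+ 2).
  apply: measurable_funM; first exact: measurable_cst.
  by apply: measurable_funX; exact: measurable_norm2_comp.
have [_ iH id _ e] := fubini_indep mY iY disj
  (h := fun w w' => hij i j (x s w) (gvec s w')) mh mq (L1Z (2 * G * Rb) iq)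
  (fun w w' => hij_le i j (gvec s w') (x_in s w)).
have eH : (fun w => E (fun w' => hij i j (x s w) (gvec s w'))) = (fun w => Hij i j (x s w)).
  by apply/funext => w; apply: Hij_time; exact: x_in.
by rewrite eH in iH e.
Qed.

(** Both x(t) + u z(t) and x(t) - u z(t) lie in X, and they differ by 2 u z(t). This deterministic
    bound provides the domination for products with the noise. *)
Lemma z_bounded t w : norm2 (z t w) <= Rb / u.
Proof.
rewrite ler_pdivlMr//.
have h1 := norm2_in (xz_in t w true); have h2 := norm2_in (xz_in t w false).
have h3 := ler_norm2B (x t w + u *: z t w) (x t w + - u *: z t w).
have e : x t w + u *: z t w - (x t w + - u *: z t w) = (2 * u) *: z t w.
  by apply/rowP => k; rewrite !mxE; ring.
rewrite e norm2Z gtr0_norm ?mulr_gt0// in h3; move: h1 h2 => /=; lra.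
Qed.

Definition Uz i s w : R := dot (block (z s w) i) (block (x s w) i - block xt i).

Lemma Uz_le i s w : `|Uz i s w| <= Rb / u * (2 * Rb).
Proof.
apply: (le_trans (dot_xt _ _ (x_in s w))); rewrite ler_wpM2r ?z_bounded//.
by rewrite mulr_ge0// Rb_ge0.
Qed.

(** The noise has mean zero and is independent of [pastg s], which determines [Uz]. *)
Lemma noise_drift b i j s : L1 P (fun w => Uz i s w * noise b s j w) /\
  E (fun w => Uz i s w * noise b s j w) = 0.
Proof.
pose a : sample_index dim := inr (b, s, j).
have disj : pastg s `&` [set a] = set0.
  apply/seteqP; split => // c [h /= e]; move: h; rewrite e.
  by case=> [|[k]] //; rewrite /past/= ltnn.
have mn : meas [set a] (fun w => noise b s j w).
  exact: (@measurable_fun_sample _ _ R _ Y [set a] a erefl).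
have mU : meas (pastg s) (Uz i s).
  apply: measurable_dot_fun => k; first exact: (meas_z_block k (@meas_x s)).
  rewrite (_ : (fun w => _) = (fun w => x s w 0 (tagnat.Rank i k) - block xt i 0 k)).
    apply: measurable_funB; last exact: measurable_cst.
    by apply: (measurable_fun_sub _ (@meas_x s _)) => c; left.
  by apply/funext => w; rewrite -blockE !mxE.
have C0 : 0 <= Rb / u * (2 * Rb) by exact: le_trans (normr_ge0 _) (Uz_le i s point).
have mh : measurable_fun setT (fun q : subT Y (pastg s) * subT Y [set a] =>
    Uz i s q.1 * noise b s j q.2).
  apply: measurable_funM.
    exact: (measurableT_comp mU (@measurable_fst _ _ _ _)).
  exact: (measurableT_comp mn (@measurable_snd _ _ _ _)).
have inn : L1 P (fun w => Rb / u * (2 * Rb) * `|noise b s j w|).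
  by apply: L1Z; exact: integrable_norm (noise_L1 b s j).
have mnn : meas [set a] (fun w => Rb / u * (2 * Rb) * `|noise b s j w|).
  apply: measurable_funM; first exact: measurable_cst.
  exact: (measurableT_comp (@normr_measurable R setT) mn).
have [_ _ id _ e] := fubini_indep mY iY disj
  (h := fun w w' => Uz i s w * noise b s j w') mh mnn inn
  (fun w w' => ltac:(by rewrite normrM ler_wpM2r// Uz_le)).
split=> //; rewrite e (_ : (fun w => _) = (fun=> 0)) ?E_cst//.
by apply/funext => w; rewrite E_Z ?noise_E ?mulr0//; exact: noise_L1.
Qed.

Lemma x_dist s t w i : (0 < s <= t)%N ->
  norm2 (block (x t w) i - block (x s w) i) <=
  \sum_(s <= r < t) eta * norm2 (grad r i w).
Proof.
move=> /andP[s0]; elim: t => [|t IH].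
  by rewrite leqn0 => /eqP s'; rewrite s' in s0.
rewrite leq_eqVlt => /orP[/eqP ->|]; first by rewrite subrr norm20 big_geq.
rewrite ltnS => st; rewrite big_nat_recr//=.
apply: (le_trans (ler_dist2D (block (x t w) i) _ _)); rewrite [leRHS]addrC.
apply: lerD; last exact: IH st.
have [gradP _ scP] := mirror i.
apply: (mirror_step_length (@cX i) (@cS i) (@subS i) eta0 scP gradP) => //.
  by apply: x_shrink; exact: leq_trans s0 st.
exact: step_mirror.
Qed.

Lemma E_sum_nat_le (a b : nat) (F : nat -> Omega -> R) (c : R) :
  (forall r, L1 P (F r)) -> (forall r, E (F r) <= c) ->
  E (fun w => \sum_(a <= r < b) F r w) <= (b - a)%:R * c.
Proof.
move=> iF hF; rewrite E_sum//; apply: (@le_trans _ _ (\sum_(a <= r < b) c)).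
  by apply: ler_sum => r _; exact: hF.
by rewrite big_const_nat iter_addr_0 mulr_natl.
Qed.

(** Each of the t - s steps has length at most eta |grad|, and Young's inequality leaves half sums
    of squares whose means are at most [Vc * (dim i)%:R]. Here the delays enter the error at its
    leading order. *)
Lemma lag_term i j s t : (0 < s <= t)%N ->
  L1 P (fun w => dot (term s i j w) (block (x t w) i - block (x s w) i)) /\
  - ((t - s)%:R * (eta * (Vc * (dim i)%:R))) <=
  E (fun w => dot (term s i j w) (block (x t w) i - block (x s w) i)).
Proof.
move=> st.
pose F r w : R := eta / 2 * (norm2 (term s i j w) ^+ 2 + norm2 (grad r i w) ^+ 2).
have iF r : L1 P (F r).
  by apply: L1Z; apply: L1D; [exact: (term_sq s i j).1|exact: (grad_sq r i).1].
have EF r : E (F r) <= eta * (Vc * (dim i)%:R).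
  rewrite E_Z; last by apply: L1D; [exact: (term_sq s i j).1|exact: (grad_sq r i).1].
  rewrite E_D; [|exact: (term_sq s i j).1|exact: (grad_sq r i).1].
  rewrite -mulrA ler_pM2l// mulrC ler_pdivrMr//.
  have := (term_sq s i j).2; have := (grad_sq r i).2; lra.
have bnd w : `|dot (term s i j w) (block (x t w) i - block (x s w) i)| <=
    \sum_(s <= r < t) F r w.
  apply: (le_trans (normr_dot_le _ _)).
  apply: (le_trans (ler_wpM2l (norm2_ge0 _) (x_dist w i st))).
  rewrite mulr_sumr; apply: ler_sum => r _; rewrite /F.
  have h := mulr_ge0 (ltW eta0) (sqr_ge0 (norm2 (term s i j w) - norm2 (grad r i w))).
  move: h; lra.
have iS : L1 P (fun w => \sum_(s <= r < t) F r w) by exact: L1_sum.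
have iD : L1 P (fun w => dot (term s i j w) (block (x t w) i - block (x s w) i)).
  apply: (L1_dom _ iS) => //; apply: measurable_dot_fun => k; first exact: meas_term.
  rewrite (_ : (fun w => _) = (fun w => x t w 0 (tagnat.Rank i k) - x s w 0 (tagnat.Rank i k))).
    by apply: measurable_funB; exact: (run_meas run _ _).1.
  by apply/funext => w; rewrite -!blockE !mxE.
split=> //; have := normr_E_le iD iS bnd; have := E_sum_nat_le s t iF EF.
rewrite ler_norml => h1 /andP[h2 _]; lra.
Qed.

(** Bounds the expected displacement during the maximal delay. It comes from |grad| <= 1/u + u
    |grad|^2, weighted so that both summands are of order 1 / u in the mean. *)
Definition lag : R :=
  eta * (Bmax edge Delta)%:R * (n%:R / u + u * (Vc * dd%:R)).

Lemma x_move s t : (0 < s <= t)%N -> (t - s <= Bmax edge Delta)%N ->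
  L1 P (fun w => norm2 (x t w - x s w)) /\ E (fun w => norm2 (x t w - x s w)) <= lag.
Proof.
move=> st tsB.
pose F r w : R := \sum_i eta * (u^-1 + u * norm2 (grad r i w) ^+ 2).
have iF r : L1 P (F r).
  apply: L1_sum => i; apply: L1Z; apply: L1D; first exact: L1_cst.
  by apply: L1Z; exact: (grad_sq r i).1.
have EF r : E (F r) <= eta * (n%:R / u + u * (Vc * dd%:R)).
  rewrite E_sum => [|i]; last first.
    by apply: L1Z; apply: L1D; [exact: L1_cst|apply: L1Z; exact: (grad_sq r i).1].
  apply: (@le_trans _ _ (\sum_(i < n) eta * (u^-1 + u * (Vc * (dim i)%:R)))).
    apply: ler_sum => i _; rewrite E_Z; last first.
      by apply: L1D; [exact: L1_cst|apply: L1Z; exact: (grad_sq r i).1].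
    rewrite E_D; [|exact: L1_cst|by apply: L1Z; exact: (grad_sq r i).1].
    rewrite E_cst E_Z; last exact: (grad_sq r i).1.
    by rewrite ler_pM2l// lerD2l ler_pM2l//; exact: (grad_sq r i).2.
  rewrite -mulr_sumr big_split/= sumr_const card_ord -!mulr_sumr -natr_sum.
  by rewrite -[_ *+ n]mulr_natl.
have bnd w : norm2 (x t w - x s w) <= \sum_(s <= r < t) F r w.
  rewrite /F exchange_big/=; apply: (@le_trans _ _ (\sum_i norm2 (block (x t w - x s w) i))).
    rewrite -(@ler_pXn2r _ 2)// ?nnegrE ?norm2_ge0//; last first.
      by apply: sumr_ge0 => i _; exact: norm2_ge0.
    rewrite sqr_norm2_block expr2 mulr_suml; apply: ler_sum => i _.
    rewrite expr2 ler_wpM2l ?norm2_ge0// [leRHS](bigD1 i)//= lerDl.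
    by apply: sumr_ge0 => k _; exact: norm2_ge0.
  apply: ler_sum => i _; rewrite blockB; apply: (le_trans (x_dist w i st)).
  apply: ler_sum => r _; rewrite ler_pM2l//.
  set g := norm2 _; rewrite -(@ler_pM2l _ u)// mulrDr mulfV ?gt_eqF//.
  have := sqr_ge0 (u * g - 1); have : 0 <= u * g by rewrite mulr_ge0 ?norm2_ge0// ltW.
  nra.
have iS : L1 P (fun w => \sum_(s <= r < t) F r w) by exact: L1_sum.
have iD : L1 P (fun w => norm2 (x t w - x s w)).
  apply: (L1_dom _ iS) => [|w]; last by rewrite ger0_norm ?norm2_ge0.
  apply: measurable_norm2_comp => k.
  rewrite (_ : (fun w => _) = (fun w => x t w 0 k - x s w 0 k)).
    by apply: measurable_funB; exact: (run_meas run _ _).1.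
  by apply/funext => w; rewrite !mxE.
split=> //; apply: (le_trans (E_le iD iS bnd)).
apply: (le_trans (E_sum_nat_le s t iF EF)); 
have -> : lag = (Bmax edge Delta)%:R * (eta * (n%:R / u + u * (Vc * dd%:R))).
  by rewrite /lag; ring.
rewrite ler_wpM2r ?ler_nat//; apply: mulr_ge0; first exact: ltW.
have v0 := Vc_ge0.
by apply: addr_ge0; [rewrite divr_ge0// ltW|rewrite mulr_ge0 ?(ltW u0)// mulr_ge0].
Qed.

Lemma cdiff_lip j p q v : Sset p -> Sset q -> norm2 v < rho ->
  cdiff j p v - cdiff j q v <= L * norm2 v * norm2 (p - q).
Proof.
move=> Sp Sq vr; case: setting => _ _ _ /(_ j)[_ [gh [ghP ghL]]] _.
have cXX : @convex_set R (profile R dim) (prod_set X).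
  apply/convex_setE => a b t Xa Xb t01 i; rewrite blockD !blockZ.
  by apply: (convex_setE (X i)).1 => //; exact: cX.
have := central_difference_le cXX (ltW L0) (Sset_add Sp vr) (Sset_sub Sp vr)
  (Sset_add Sq vr) (Sset_sub Sq vr) ghP ghL.
rewrite -!fext_eq; try by [exact: Sset_add|exact: Sset_sub].
rewrite norm2Z gtr0_norm// /cdiff -mulrBl ler_pdivrMr ?mulr_gt0//.
by congr (_ <= _); ring.
Qed.

(** For |v| < rho both factors of [hij] are Lipschitz in the base point, with constants L |v| and
    |v|. On the tail the two values are bounded separately, by 2 G Rb |v|^2 each. *)
Lemma Hij_lip i j p q : Sset p -> Sset q ->
  Hij i j q - Hij i j p <=
  (2 * Rb * L + G) * dd%:R * norm2 (p - q) + 4 * G * Rb * kappa.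
Proof.
move=> Sp Sq; have Xp := Sset_in Sp; have Xq := Sset_in Sq.
have R0 := Rb_ge0; have c0 := norm2_ge0 (p - q).
have [iq Eq] := gaussian_norm_sqr (gvec_gaussian 0); have [it Et] := tail_time 0.
pose c : R := (2 * Rb * L + G) * norm2 (p - q).
have cc : 0 <= c by rewrite mulr_ge0// addr_ge0 ?(ltW G0)// mulr_ge0 ?(ltW L0)// mulr_ge0.
rewrite /Hij -E_B; [|exact: hij_L1..].
apply: (@le_trans _ _ (E (fun w => c * norm2 (gvec 0 w) ^+ 2
   + 4 * G * Rb * (norm2 (gvec 0 w) ^+ 2 * tailind rho (gvec 0 w))))); last first.
  rewrite E_D; [|exact: L1Z..]; rewrite !E_Z// Et lerD2r.
  by have := ler_wpM2l cc Eq; rewrite /c; lra.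
apply: E_le => [||w]; [by apply: L1B; exact: hij_L1|by apply: L1D; exact: L1Z|].
set v := gvec 0 w; rewrite tailindE.
have b1 : `|hij i j q v| <= 2 * G * Rb * norm2 v ^+ 2 by exact: hij_le.
have b2 : `|hij i j p v| <= 2 * G * Rb * norm2 v ^+ 2 by exact: hij_le.
have [vr|vr] := leP rho (norm2 v).
  rewrite mulr1; move: b1 b2; rewrite !ler_norml => /andP[_ b1] /andP[b2 _].
  have := mulr_ge0 cc (sqr_ge0 (norm2 v)); lra.
rewrite !mulr0 addr0.
have k1 : `|cdiff j q v - cdiff j p v| <= L * norm2 v * norm2 (p - q).
  rewrite ler_norml; have := cdiff_lip j Sp Sq vr; have := cdiff_lip j Sq Sp vr.
  by rewrite (norm2_sub q) => h1 h2; rewrite h1 andbT lerNl opprB.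
have -> : hij i j q v - hij i j p v =
    (cdiff j q v - cdiff j p v) * dot (block v i) (block q i - block xt i)
    + cdiff j p v * dot (block v i) (block (q - p) i).
  by rewrite /hij blockB !dotBr; ring.
have t1 : (cdiff j q v - cdiff j p v) * dot (block v i) (block q i - block xt i) <=
    (L * norm2 v * norm2 (p - q)) * (norm2 v * (2 * Rb)).
  rewrite (le_trans (ler_norm _))// normrM; apply: ler_pM => //; exact: dot_xt.
have t2 : cdiff j p v * dot (block v i) (block (q - p) i) <=
    (G * norm2 v) * (norm2 v * norm2 (p - q)).
  rewrite (le_trans (ler_norm _))// normrM; apply: ler_pM => //; first exact: cdiff_le.
  rewrite (le_trans (normr_dot_le _ _))//; apply: ler_pM; rewrite ?norm2_ge0 ?norm2_block_le//.
  by rewrite norm2_sub norm2_block_le.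
rewrite /c; lra.
Qed.

Lemma sum_affine (H a : 'I_n -> 'I_n -> R) (v : 'I_n -> R) (c e r : R) :
  \sum_i \sum_j (H i j - c - a i j * (e * (r * v i))) =
  \sum_i \sum_j H i j - n%:R ^+ 2 * c - e * r * \sum_i \sum_j a i j * v i.
Proof.
have -> : n%:R ^+ 2 * c = \sum_(i < n) \sum_(j < n) c.
  by rewrite !sumr_const card_ord -mulrnA -[RHS]mulr_natl natrM expr2.
rewrite mulr_sumr -!sumrB; apply: eq_bigr => i _.
rewrite mulr_sumr -!sumrB; apply: eq_bigr => j _; ring.
Qed.

Let K1 : R := (2 * Rb * L + G) * dd%:R.

(** The 8 in front of the tail is 4 + 4: the first part for exchanging z(s) for the Gaussian vector,
    the second for moving [Hij] from x(s) to x(t), the base point shared by all pairs (i, j). *)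
Lemma drift_term i j t : (Bmax edge Delta < t)%N ->
  L1 P (fun w => dot (delayed t i j w) (block (x t w) i - block xt i)) /\
  E (fun w => Hij i j (x t w)) - K1 * lag - 8 * G * Rb * kappa
    - (gdist edge i j + Delta)%:R * (eta * (Vc * (dim i)%:R)) <=
  E (fun w => dot (delayed t i j w) (block (x t w) i - block xt i)).
Proof.
move=> tB; have [s []] := tau_delay t i j; first by rewrite leqNgt tB.
move=> [ts s0 st tsd].
have st' : (0 < s <= t)%N by rewrite s0.
have tsB : (t - s <= Bmax edge Delta)%N.
  apply: leq_trans tsd _; rewrite /Bmax leq_add2r.
  apply: leq_trans (leq_bigmax (F := fun i => \max_j gdist edge i j) i).
  exact: (leq_bigmax (F := fun j => gdist edge i j) j).
rewrite /delayed ts.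
have R0 := Rb_ge0.
have K10 : 0 <= K1.
  by rewrite mulr_ge0// addr_ge0 ?(ltW G0)// mulr_ge0 ?(ltW L0)// mulr_ge0.
have [iL EL] := lag_term i j st'; have [iM EM] := x_move st' tsB.
have [iHs ih Eh] := drift_fubini i j s; have [iHt _ _] := drift_fubini i j t.
have [iN1 EN1] := noise_drift true i j s; have [iN2 EN2] := noise_drift false i j s.
have [iT ET] := tail_time s.
have iD : L1 P (fun w => dot (term s i j w) (block (x t w) i - block xt i)).
  have iq := (term_sq s i j).1.
  apply: (L1_dom _ (L1D (L1Z (2 * Rb) iq) (L1_cst P (2 * Rb)))) => [|w].
    apply: measurable_dot_fun => k; first exact: meas_term.
    rewrite (_ : (fun w => _) = (fun w => x t w 0 (tagnat.Rank i k) - block xt i 0 k)).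
      by apply: measurable_funB; [exact: (run_meas run _ _).1|exact: measurable_cst].
    by apply/funext => w; rewrite -!blockE !mxE.
  apply: (le_trans (normr_dot_le _ _)).
  have h : norm2 (block (x t w) i - block xt i) <= 2 * Rb.
    rewrite -blockB; exact: le_trans (norm2_block_le _ _) (dist_xt (x_in t w)).
  have := norm2_ge0 (term s i j w); set a := norm2 (term s i j w) => a0.
  apply: (le_trans (ler_wpM2l a0 h)).
  have := mulr_ge0 R0 (sqr_ge0 (a - 1)); have := mulr_ge0 R0 a0; lra.
split; first exact: iD.
(* A pathwise minorant with computable mean: displacement, noise, and [hij] at the unprojected
   Gaussian vector, less a tail term for the paths on which the projection may act. *)
pose low w := dot (term s i j w) (block (x t w) i - block (x s w) i)
  + (2 * u)^-1 * (Uz i s w * noise true s j w - Uz i s w * noise false s j w)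
  + (hij i j (x s w) (gvec s w)
     - 4 * G * Rb * (norm2 (gvec s w) ^+ 2 * tailind rho (gvec s w))).
have i1 : L1 P (fun w => (2 * u)^-1 *
    (Uz i s w * noise true s j w - Uz i s w * noise false s j w)).
  by apply: L1Z; exact: L1B.
have i2 : L1 P (fun w => hij i j (x s w) (gvec s w)
     - 4 * G * Rb * (norm2 (gvec s w) ^+ 2 * tailind rho (gvec s w))).
  by apply: L1B => //; exact: L1Z.
have il : L1 P low by apply: L1D => //; exact: L1D.
have Elow : E low = E (fun w => dot (term s i j w) (block (x t w) i - block (x s w) i))
   + E (fun w => Hij i j (x s w)) - 4 * G * Rb * kappa.
  rewrite /low (E_D (L1D iL i1) i2) (E_D iL i1) (E_Z _ (L1B iN1 iN2)) (E_B iN1 iN2).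
  by rewrite EN1 EN2 subrr mulr0 addr0 (E_B ih (L1Z _ iT)) (E_Z _ iT) ET Eh addrA.
have lowP w : low w <= dot (term s i j w) (block (x t w) i - block xt i).
  have e1 : dot (term s i j w) (block (x t w) i - block xt i) =
      dot (term s i j w) (block (x t w) i - block (x s w) i)
      + (2 * u)^-1 * (Uz i s w * noise true s j w - Uz i s w * noise false s j w)
      + cdiff j (x s w) (z s w) * Uz i s w.
    rewrite /Uz /term dqE /perturb !dotZl !dotBr; field.
    exact: lt0r_neq0.
  rewrite e1 /low lerD2l tailindE.
  have Xs := x_in s w.
  have [vr|vr] := leP rho (norm2 (gvec s w)); last first.
    rewrite !mulr0 subr0 /hij /Uz (z_eq_gvec (t := s))// => i'.
    by apply: lt_le_trans (rad i'); rewrite ltr_pM2l.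
  rewrite mulr1 lerBlDr.
  have h1 : hij i j (x s w) (gvec s w) <= 2 * G * Rb * norm2 (gvec s w) ^+ 2.
    exact: le_trans (ler_norm _) (hij_le i j _ Xs).
  have h2 : - (2 * G * Rb * norm2 (gvec s w) ^+ 2) <= cdiff j (x s w) (z s w) * Uz i s w.
    rewrite lerNl -mulNr (le_trans (ler_norm _))// normrM normrN.
    have -> : 2 * G * Rb * norm2 (gvec s w) ^+ 2 =
      (G * norm2 (gvec s w)) * (norm2 (gvec s w) * (2 * Rb)) by ring.
    apply: ler_pM => //.
      by apply: (le_trans (cdiff_le _ _ _)); rewrite ler_pM2l// z_le.
    apply: (le_trans (dot_xt _ _ Xs)); rewrite ler_wpM2r ?z_le//.
    by rewrite mulr_ge0.
  lra.
apply: le_trans (E_le il iD lowP); rewrite Elow.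
have hH : E (fun w => Hij i j (x t w)) <=
    E (fun w => Hij i j (x s w)) + K1 * lag + 4 * G * Rb * kappa.
  apply: (@le_trans _ _ (E (fun w => Hij i j (x s w)
     + (K1 * norm2 (x t w - x s w) + 4 * G * Rb * kappa)))).
    apply: (E_le iHt (L1D iHs (L1D (L1Z K1 iM) (L1_cst P _)))) => w.
    rewrite -lerBlDl norm2_sub; apply: Hij_lip => k; apply: x_shrink => //.
    exact: leq_trans s0 st.
  rewrite (E_D iHs (L1D (L1Z K1 iM) (L1_cst P _))) (E_D (L1Z K1 iM) (L1_cst P _)).
  rewrite (E_Z _ iM) E_cst.
  by have := ler_wpM2l K10 EM; lra.
have hd : (t - s)%:R * (eta * (Vc * (dim i)%:R)) <=
    (gdist edge i j + Delta)%:R * (eta * (Vc * (dim i)%:R)).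
  rewrite ler_wpM2r ?ler_nat//; have v0 := Vc_ge0.
  by apply: mulr_ge0; [exact: ltW|exact: mulr_ge0].
move: EL hH hd.
move: (Rintegral _ _ (fun w => dot _ (_ - block (x s w) i))) => a.
move: (Rintegral _ _ (fun w => Hij i j (x s w))) => b.
move: (Rintegral _ _ (fun w => Hij i j (x t w))) => c.
move: ((t - s)%:R * _) => l1; move: ((gdist edge i j + Delta)%:R * _) => l2.
move: (K1 * lag) kappa => q k h1 h2 h3 {Elow lowP il i1 i2 low EM Eh EN1 EN2 ET K10}; lra.
Qed.

Lemma avg_fext p : prod_set X p -> n%:R^-1 * \sum_j fext j p = avg_cost f p.
Proof.
by move=> Xp; congr (_ * _); apply: eq_bigr => j _; exact: fext_eq.
Qed.

Let nR : 0 < n%:R :> R. Proof. by rewrite ltr0n. Qed.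

Lemma avg_fext_lip p q :
  `|n%:R^-1 * \sum_j fext j p - n%:R^-1 * \sum_j fext j q| <= G * norm2 (p - q).
Proof.
rewrite -mulrBr -sumrB normrM gtr0_norm ?invr_gt0// ler_pdivrMl//.
apply: (le_trans (ler_norm_sum _ _ _)); rewrite mulr_natl.
rewrite (_ : _ *+ n = \sum_(j < n) G * norm2 (p - q)); last by rewrite sumr_const card_ord.
by apply: ler_sum => j _; exact: fext_lip.
Qed.

Lemma convex_prod : @convex_set R (profile R dim) (prod_set X).
Proof.
apply/convex_setE => a b t Xa Xb t01 i; rewrite blockD !blockZ.
by apply: (convex_setE (X i)).1 => //; exact: cX.
Qed.

Lemma convex_Sset p q (t : R) : Sset p -> Sset q -> 0 <= t <= 1 ->
  Sset ((1 - t) *: p + t *: q).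
Proof.
move=> Sp Sq t01 i; rewrite blockD !blockZ.
have := (convex_setE (shrink delta (X i))).1 (@cS i) _ _ (1 - t) (Sp i) (Sq i).
by rewrite opprB addrCA subrr addr0; apply; lra.
Qed.

Lemma avg_convex p q (t : R) : prod_set X p -> prod_set X q -> 0 <= t <= 1 ->
  avg_cost f (t *: p + (1 - t) *: q) <= t * avg_cost f p + (1 - t) * avg_cost f q.
Proof. by case: setting => _ _ _ _ /convex_functionE; apply. Qed.

(** Summed over i, the inner products of blocks recombine to the inner product with p - xt, and
    summed over j the differences become one of the averaged cost; [smoothing_le] then applies with
    K = L / 2. *)
Lemma smoothing_drift p : Sset p ->
  avg_cost f p - avg_cost f xt - L / 2 * u ^+ 2 * dd%:R - 4 * G * Rb * kappa <=
  n%:R^-1 * \sum_i \sum_j Hij i j p.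
Proof.
move=> Sp; have Xp := Sset_in Sp; have Xxt := Sset_in Sxt.
pose phi q := n%:R^-1 * \sum_j fext j q.
have eH : n%:R^-1 * \sum_i \sum_j Hij i j p =
  E (fun w => (phi (p + u *: gvec 0 w) - phi (p - u *: gvec 0 w)) / (2 * u)
              * dot (gvec 0 w) (p - xt)).
  have ih i j : L1 P (fun w => hij i j p (gvec 0 w)) by exact: hij_L1.
  have ihs i : L1 P (fun w => \sum_j hij i j p (gvec 0 w)) by apply: L1_sum => j.
  transitivity (n%:R^-1 * E (fun w => \sum_i \sum_j hij i j p (gvec 0 w))).
    congr (_ * _); rewrite (E_sum _ ihs); apply: eq_bigr => i _.
    by rewrite (E_sum _ (ih i)).
  rewrite -(E_Z _ (L1_sum _ ihs)); apply: E_ext => w.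
  pose A := \sum_j cdiff j p (gvec 0 w).
  have -> : (phi (p + u *: gvec 0 w) - phi (p - u *: gvec 0 w)) / (2 * u) = n%:R^-1 * A.
    by rewrite /A /cdiff /phi -mulrBr -sumrB -mulrA mulr_suml.
  rewrite dot_block -mulrA [A * _]mulr_sumr; congr (_ * _); apply: eq_bigr => i _.
  by rewrite /A mulr_suml; apply: eq_bigr => j _; rewrite /hij blockB.
rewrite eH.
have conv z' (s : R) : norm2 z' < rho -> 0 <= s <= 1 ->
     phi ((1 - s) *: p + s *: xt + u *: z') <=
     (1 - s) * phi (p + u *: z') + s * phi (xt + u *: z').
  move=> zr s01; rewrite /phi !avg_fext; try exact: Sset_add.
    have -> : (1 - s) *: p + s *: xt + u *: z' =
      (1 - s) *: (p + u *: z') + (1 - (1 - s)) *: (xt + u *: z').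
      by apply/rowP => k; rewrite !mxE; ring.
    have -> : s * avg_cost f (xt + u *: z') = (1 - (1 - s)) * avg_cost f (xt + u *: z').
      by rewrite opprB addrCA subrr addr0.
    apply: avg_convex; [exact: Sset_add|exact: Sset_add|lra].
  by apply: Sset_add => //; exact: convex_Sset.
have mid z' : norm2 z' < rho -> 2 * phi p <= phi (p + u *: z') + phi (p - u *: z').
  move=> zr; rewrite /phi !avg_fext//; try by [exact: Sset_add|exact: Sset_sub].
  have h12 : 0 <= (1 / 2 : R) <= 1 by lra.
  have := avg_convex (Sset_add Sp zr) (Sset_sub Sp zr) h12.
  have -> : (1 / 2) *: (p + u *: z') + (1 - 1 / 2) *: (p - u *: z') = p.
    by apply/rowP => k; rewrite !mxE; field.
  lra.
(* The gradient terms of the two opposite directions cancel. *)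
have sm z' : norm2 z' < rho -> phi (xt + u *: z') + phi (xt - u *: z') <=
    2 * phi xt + 2 * (L / 2) * (u ^+ 2 * norm2 z' ^+ 2).
  move=> zr; rewrite /phi !avg_fext//; try by [exact: Sset_add|exact: Sset_sub].
  rewrite /avg_cost -mulrDr -big_split/= -(@ler_pM2l _ n%:R)// mulVKf ?gt_eqF//.
  have -> : n%:R * (2 * (n%:R^-1 * \sum_i f i xt) + 2 * (L / 2) * (u ^+ 2 * norm2 z' ^+ 2)) =
     \sum_i (2 * f i xt + L * (u ^+ 2 * norm2 z' ^+ 2)).
    rewrite big_split/= sumr_const card_ord -mulr_sumr -mulr_natl; field.
    exact: lt0r_neq0.
  apply: ler_sum => j _; case: setting => _ _ _ /(_ j)[_ [gh [ghP ghL]]] _.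
  have h1 := smooth_upper convex_prod Xxt (Sset_add Sxt zr) ghP ghL.
  have h2 := smooth_upper convex_prod Xxt (Sset_sub Sxt zr) ghP ghL.
  have e1 : xt + u *: z' - xt = u *: z' by rewrite addrC addKr.
  have e2 : xt - u *: z' - xt = - (u *: z') by rewrite addrC addKr.
  rewrite e1 norm2Z gtr0_norm// exprMn in h1.
  rewrite e2 norm2N dotNr norm2Z gtr0_norm// exprMn in h2.
  lra.
have := smoothing_le (phi := phi) (K := L / 2) (gvec_gaussian 0) (ltW G0) u0 rho1
  ltac:(by rewrite divr_ge0// ltW) avg_fext_lip conv mid sm.
rewrite -/kappa /phi !avg_fext//; apply: le_trans; rewrite lerD2l lerN2.
have := dist_xt Xp; have := kappa_ge0 => k0 h.
have : G * kappa * norm2 (p - xt) <= G * kappa * (2 * Rb).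
  by apply: ler_wpM2l => //; rewrite mulr_ge0// ltW.
lra.
Qed.

(** The mean delay with weights [dim i] is at most the quadratic mean. This is Cauchy-Schwarz,
    obtained from the nonnegative variance around c = M / W. *)
Lemma delay_average :
  n%:R^-1 * \sum_i \sum_j (gdist edge i j + Delta)%:R * (dim i)%:R
  <= bbar edge R dim Delta * dd%:R.
Proof.
pose M : R := \sum_i \sum_j (gdist edge i j + Delta)%:R * (dim i)%:R.
pose S : R := \sum_i \sum_j (gdist edge i j + Delta)%:R ^+ 2 * (dim i)%:R.
have d0 : 0 < dd%:R :> R.
  rewrite ltr0n; case: setting => -[n1 dim0] _ _ _ _.
  by rewrite (bigD1 (Ordinal n1))//= addn_gt0 dim0.
pose W : R := n%:R * dd%:R; have W0 : 0 < W by rewrite mulr_gt0.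
have eW : \sum_(i < n) \sum_(j < n) (dim i)%:R = W.
  rewrite /W natr_sum mulr_sumr; apply: eq_bigr => i _.
  by rewrite sumr_const card_ord mulr_natl.
have M0 : 0 <= M by do 2!(apply: sumr_ge0 => ? _); rewrite mulr_ge0.
have S0 : 0 <= S by do 2!(apply: sumr_ge0 => ? _); rewrite mulr_ge0 ?sqr_ge0.
have MS : M ^+ 2 <= S * W.
  pose c := M / W.
  have : 0 <= \sum_i \sum_j ((gdist edge i j + Delta)%:R - c) ^+ 2 * (dim i)%:R.
    by do 2!(apply: sumr_ge0 => ? _); rewrite mulr_ge0 ?sqr_ge0.
  have -> : \sum_i \sum_j ((gdist edge i j + Delta)%:R - c) ^+ 2 * (dim i)%:R =
     S - 2 * c * M + c ^+ 2 * W.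
    rewrite -eW /S /M !mulr_sumr -sumrB -big_split/=; apply: eq_bigr => i _.
    rewrite !mulr_sumr -sumrB -big_split/=; apply: eq_bigr => j _; ring.
  have -> : S - 2 * c * M + c ^+ 2 * W = (S * W - M ^+ 2) / W.
    by rewrite /c; field; rewrite gt_eqF.
  by rewrite pmulr_lge0 ?invr_gt0// subr_ge0.
rewrite ler_pdivrMl// (_ : n%:R * (_ * _) = bbar edge R dim Delta * W); last first.
  by rewrite /W; ring.
rewrite -/M -(@ler_pXn2r _ 2)// ?nnegrE//; last by rewrite mulr_ge0 ?sqrtr_ge0// ltW.
apply: (le_trans MS); rewrite exprMn /bbar sqr_sqrtr -/S -/W; last first.
  by rewrite divr_ge0// ltW.
by rewrite le_eqVlt; apply/orP; left; apply/eqP; field; rewrite gt_eqF.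
Qed.

Definition err : R := n%:R * (K1 * lag + 8 * G * Rb * kappa) + 4 * G * Rb * kappa
  + L / 2 * u ^+ 2 * dd%:R.

Lemma avg_cost_L1 (V : Omega -> profile R dim) : (forall w, prod_set X (V w)) ->
  (forall k, measurable_fun setT (fun w => V w 0 k)) ->
  L1 P (fun w => avg_cost f (V w)).
Proof.
move=> XV mV; apply: (@L1_bounded _ _ _ _ _ (`|avg_cost f xt| + 2 * G * Rb)) => [|w].
  rewrite (_ : (fun w => _) = (fun w => n%:R^-1 * \sum_j fext j (V w))).
    exact: (meas_coord_comp avg_fext_lip).
  by apply/funext => w; rewrite avg_fext.
have Xxt := Sset_in Sxt.
have := avg_fext_lip (V w) xt; rewrite !avg_fext// => h.
have := ler_wpM2l (ltW G0) (dist_xt (XV w)) => h2.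
have := ler_normD (avg_cost f (V w) - avg_cost f xt) (avg_cost f xt); rewrite subrK; lra.
Qed.

Lemma cost_L1 t : L1 P (fun w => avg_cost f (x t w)).
Proof.
by apply: avg_cost_L1 => [w|k]; [exact: x_in|exact: (run_meas run _ _).1].
Qed.

(** Averaging n^2 pairs with weight 1 / n leaves n copies of the error per pair, which explains the
    factor n in [err]; the delay terms are collected by [delay_average]. *)
Lemma drift_time t : (Bmax edge Delta < t)%N ->
  L1 P (fun w => \sum_i dot (grad t i w) (block (x t w) i - block xt i)) /\
  E (fun w => avg_cost f (x t w)) - avg_cost f xt
    - eta * Vc * dd%:R * bbar edge R dim Delta - err <=
  E (fun w => \sum_i dot (grad t i w) (block (x t w) i - block xt i)).
Proof.
move=> tB.
have t0 : (0 < t)%N by exact: leq_ltn_trans (leq0n _) tB.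
have e : (fun w => \sum_i dot (grad t i w) (block (x t w) i - block xt i)) =
  (fun w => n%:R^-1 * \sum_i \sum_j dot (delayed t i j w) (block (x t w) i - block xt i)).
  apply/funext => w; rewrite mulr_sumr; apply: eq_bigr => i _.
  by rewrite gradE dotZl dot_suml.
have iD i j := (drift_term i j tB).1.
have iDs i : L1 P (fun w => \sum_j dot (delayed t i j w) (block (x t w) i - block xt i)).
  by apply: L1_sum => j; exact: iD.
have iDD : L1 P (fun w => \sum_i \sum_j dot (delayed t i j w) (block (x t w) i - block xt i)).
  by apply: L1_sum => i; exact: iDs.
rewrite e; split; first exact: L1Z.
rewrite (E_Z _ iDD) (E_sum _ iDs).
have iH i j : L1 P (fun w => Hij i j (x t w)) by have [] := drift_fubini i j t.
have iHs i : L1 P (fun w => \sum_j Hij i j (x t w)) by apply: L1_sum => j.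
have iHH : L1 P (fun w => \sum_i \sum_j Hij i j (x t w)) by apply: L1_sum => i.
have hs : E (fun w => avg_cost f (x t w)) - avg_cost f xt
    - L / 2 * u ^+ 2 * dd%:R - 4 * G * Rb * kappa <=
    n%:R^-1 * \sum_i \sum_j E (fun w => Hij i j (x t w)).
  have -> : \sum_i \sum_j E (fun w => Hij i j (x t w)) =
      E (fun w => \sum_i \sum_j Hij i j (x t w)).
    by rewrite (E_sum _ iHs); apply: eq_bigr => i _; rewrite (E_sum _ (iH i)).
  rewrite -(E_Z _ iHH).
  have -> : E (fun w => avg_cost f (x t w)) - avg_cost f xt
    - L / 2 * u ^+ 2 * dd%:R - 4 * G * Rb * kappa =
    E (fun w => avg_cost f (x t w) + (- avg_cost f xt
    - L / 2 * u ^+ 2 * dd%:R - 4 * G * Rb * kappa)).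
    by rewrite (E_D (cost_L1 t) (L1_cst P _)) E_cst !addrA.
  apply: E_le => [||w]; [by apply: L1D; [exact: cost_L1|exact: L1_cst]|exact: L1Z|].
  by rewrite !addrA; apply: smoothing_drift => i; exact: x_shrink.
have hd : n%:R^-1 * \sum_i \sum_j (E (fun w => Hij i j (x t w)) - (K1 * lag + 8 * G * Rb * kappa)
    - (gdist edge i j + Delta)%:R * (eta * (Vc * (dim i)%:R))) <=
   n%:R^-1 * \sum_i E (fun w => \sum_j dot (delayed t i j w) (block (x t w) i - block xt i)).
  rewrite ler_pM2l ?invr_gt0//; apply: ler_sum => i _.
  rewrite (E_sum _ (iD i)); apply: ler_sum => j _; have := (drift_term i j tB).2; lra.
apply: le_trans hd.
rewrite sum_affine !mulrBr.
have e1 : n%:R^-1 * (n%:R ^+ 2 * (K1 * lag + 8 * G * Rb * kappa)) =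
    n%:R * (K1 * lag + 8 * G * Rb * kappa).
  by field; rewrite gt_eqF.
have v0 : 0 <= eta * Vc by rewrite mulr_ge0 ?Vc_ge0// ltW.
have := ler_wpM2l v0 delay_average; rewrite e1 /err; move: hs.
move: (Rintegral _ _ (fun w => avg_cost _ _)) (\sum_i \sum_j Rintegral _ _ _) => a b.
move: (\sum_i \sum_j _%:R * _) (bbar _ _ _ _) kappa (K1 * lag) => M bb k q.
lra.
Qed.

(** * Telescoping and averaging over time *)

Definition breg (p : profile R dim) : R :=
  \sum_i bregman (psi i) (gpsi i) (block xt i) (block p i).

Lemma breg_ge0 p : prod_set X p -> 0 <= breg p.
Proof.
move=> Xp; apply: sumr_ge0 => i _; have [gradP _ scP] := mirror i.
have := strong_gradient (@cX i) scP (Xp i) (Sset_in Sxt i) (gradP _ (Xp i)).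
rewrite /bregman; have := sqr_ge0 (norm2 (block xt i - block p i)); lra.
Qed.

Lemma mirror_telescope w (a k : nat) : (0 < a)%N ->
  \sum_(a <= t < a + k) \sum_i dot (grad t i w) (block (x t w) i - block xt i) <=
  eta^-1 * (breg (x a w) - breg (x (a + k) w))
  + eta / 2 * \sum_(a <= t < a + k) \sum_i norm2 (grad t i w) ^+ 2.
Proof.
move=> a0; elim: k => [|k IH].
  by rewrite addn0 !big_geq// subrr !mulr0 addr0.
rewrite addnS !big_nat_recr ?leq_addr//=.
have h : \sum_i dot (grad (a + k) i w) (block (x (a + k) w) i - block xt i) <=
    eta^-1 * (breg (x (a + k) w) - breg (x (a + k).+1 w))
    + eta / 2 * \sum_i norm2 (grad (a + k) i w) ^+ 2.
  rewrite /breg -sumrB !mulr_sumr -big_split/=; apply: ler_sum => i _.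
  have [gradP _ scP] := mirror i.
  apply: (mirror_step_le (@cX i) (@cS i) (@subS i) eta0 scP gradP) => //.
    exact: x_in.
  exact: step_mirror.
lra.
Qed.

Lemma convex_average (C : set (profile R dim)) (h : profile R dim -> R)
    (y : nat -> profile R dim) (a k : nat) :
  (forall p q (t : R), C p -> C q -> 0 <= t <= 1 -> C (t *: p + (1 - t) *: q)) ->
  (forall p q (t : R), C p -> C q -> 0 <= t <= 1 ->
     h (t *: p + (1 - t) *: q) <= t * h p + (1 - t) * h q) ->
  (forall t, C (y t)) ->
  C (k.+1%:R^-1 *: \sum_(a <= t < a + k.+1) y t) /\
  h (k.+1%:R^-1 *: \sum_(a <= t < a + k.+1) y t) <=
  k.+1%:R^-1 * \sum_(a <= t < a + k.+1) h (y t).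
Proof.
move=> cC ch Cy; elim: k => [|k [IH1 IH2]].
  by rewrite addn1 !big_nat1 invr1 scale1r mul1r.
rewrite addnS !big_nat_recr ?leq_addr//=.
set S := \sum_(a <= t < a + k.+1) y t in IH1 IH2 *.
set F := \sum_(a <= t < a + k.+1) h (y t) in IH2 *.
pose s : R := k.+1%:R / k.+2%:R.
have k1 : k.+1%:R != 0 :> R by rewrite pnatr_eq0.
have k2 : k.+2%:R != 0 :> R by rewrite pnatr_eq0.
have s01 : 0 <= s <= 1 by rewrite divr_ge0//= ler_pdivrMr// mul1r ler_nat.
have s1 : 1 - s = k.+2%:R^-1.
  apply: (mulIf k2); rewrite mulrBl mul1r divfK// mulVf//.
  by rewrite -[k.+2%:R]natr1 addrAC subrr add0r.
have e : k.+2%:R^-1 *: (S + y (a + k.+1)%N) =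
    s *: (k.+1%:R^-1 *: S) + (1 - s) *: y (a + k.+1)%N.
  by rewrite s1 scalerA /s mulrAC mulfV// mul1r scalerDr.
rewrite e; split; first exact: cC.
apply: (le_trans (ch _ _ _ IH1 (Cy _) s01)).
rewrite s1 mulrDr lerD2r; have /andP[s0 _] := s01.
apply: (le_trans (ler_wpM2l s0 IH2)).
by rewrite mulrA (_ : s / k.+1%:R = k.+2%:R^-1)// /s mulrAC mulfV// mul1r.
Qed.

(** The times after B go through [drift_time] and telescope. The summand t = B may involve estimates
    from time 0; it is bounded by 2 G Rb, which is divided by the number of summands. *)
Lemma run_accuracy (D0 : R) (T : nat) : (Bmax edge Delta <= T)%N ->
  (forall p, prod_set X p -> breg p <= D0) ->
  L1 P (fun w => avg_cost f (xbar edge Delta x T w)) /\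
  E (fun w => avg_cost f (xbar edge Delta x T w)) - avg_cost f xt <=
  (T - Bmax edge Delta + 1)%:R^-1 * (2 * G * Rb + D0 / eta)
  + eta * Vc * dd%:R * (bbar edge R dim Delta + 1 / 2) + err.
Proof.
set B := Bmax edge Delta => BT D0P.
have [k Tk] : exists k, T = (B + k)%N by exists (T - B)%N; rewrite subnKC.
pose N : R := k.+1%:R; have N0 : 0 < N by rewrite ltr0n.
have xbarE w : xbar edge Delta x T w = N^-1 *: \sum_(B <= t < B + k.+1) x t w.
  by rewrite /xbar -/B Tk addKn addn1 addnS.
have cv w := convex_average (y := fun t => x t w) B k ((convex_setE _).1 convex_prod)
  avg_convex (fun t => x_in t w).
have iX : L1 P (fun w => avg_cost f (xbar edge Delta x T w)).
  apply: avg_cost_L1 => [w|a]; first by rewrite xbarE; exact: (cv w).1.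
  rewrite (_ : (fun w => _) = (fun w => N^-1 * \sum_(B <= t < B + k.+1) x t w 0 a)).
    apply: measurable_funM; first exact: measurable_cst.
    by apply: measurable_sum => t; exact: (run_meas run _ _).1.
  by apply/funext => w; rewrite xbarE mxE summxE.
have eT : (T - B + 1)%N = k.+1 by rewrite Tk addKn addn1.
split=> //; rewrite eT -/N.
have iC := cost_L1.
pose c : R := eta * Vc * dd%:R * bbar edge R dim Delta + err.
pose Q t w : R := \sum_i norm2 (grad t i w) ^+ 2.
have iQ t : L1 P (Q t) by apply: L1_sum => i; exact: (grad_sq t i).1.
have EQ t : E (Q t) <= Vc * dd%:R.
  rewrite E_sum => [|i]; last exact: (grad_sq t i).1.
  by rewrite natr_sum mulr_sumr; apply: ler_sum => i _; exact: (grad_sq t i).2.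
pose Dr t w : R := \sum_i dot (grad t i w) (block (x t w) i - block xt i).
have v0 : 0 <= eta * Vc * dd%:R by rewrite mulr_ge0// mulr_ge0 ?Vc_ge0// ltW.
have sumD : \sum_(B.+1 <= t < B.+1 + k) (E (fun w => avg_cost f (x t w)) - avg_cost f xt - c)
    <= D0 / eta + k%:R * (eta * Vc * dd%:R * (1 / 2)).
  have iDr t : (B < t)%N -> L1 P (Dr t) by move=> tB; exact: (drift_time tB).1.
  (* [E_sum] asks for integrability at every index, hence the value 0 up to time B. *)
  have h1 : \sum_(B.+1 <= t < B.+1 + k) (E (fun w => avg_cost f (x t w)) - avg_cost f xt - c)
      <= \sum_(B.+1 <= t < B.+1 + k) E (fun w => if (B < t)%N then Dr t w else 0).
    rewrite !big_nat; apply: ler_sum => t /andP[tB _].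
    by rewrite tB; have := (drift_time tB).2; rewrite /c /Dr; lra.
  apply: (le_trans h1).
  have iD' t : L1 P (fun w => if (B < t)%N then Dr t w else 0).
    by case: ltnP => h; [exact: iDr|exact: L1_cst].
  rewrite -(E_sum _ iD').
  apply: (@le_trans _ _ (E (fun w => D0 / eta + eta / 2 * \sum_(B.+1 <= t < B.+1 + k) Q t w))).
    apply: E_le => [||w]; first by apply: L1_sum.
      by apply: L1D; [exact: L1_cst|apply: L1Z; exact: L1_sum].
    rewrite (_ : \sum_(B.+1 <= t < B.+1 + k) _ = \sum_(B.+1 <= t < B.+1 + k) Dr t w);
      last by rewrite !big_nat; apply: eq_bigr => t /andP[-> _].
    apply: (le_trans (mirror_telescope w k (ltn0Sn B))); rewrite lerD2r mulrC.
    rewrite ler_pM2r ?invr_gt0//.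
    have := D0P _ (x_in B.+1 w); have := breg_ge0 (x_in (B.+1 + k) w); lra.
  rewrite (E_D (L1_cst P _) (L1Z _ (L1_sum _ iQ))) E_cst (E_Z _ (L1_sum _ iQ)) lerD2l.
  have := E_sum_nat_le B.+1 (B.+1 + k) iQ EQ; rewrite addKn => h2.
  have e2 : 0 <= eta / 2 by rewrite divr_ge0// ltW.
  by have := ler_wpM2l e2 h2; lra.
have hX : E (fun w => avg_cost f (xbar edge Delta x T w)) <=
    N^-1 * \sum_(B <= t < B + k.+1) E (fun w => avg_cost f (x t w)).
  rewrite -(E_sum _ iC) -(E_Z _ (L1_sum _ iC)).
  apply: E_le => [//||w]; first by apply: L1Z; exact: L1_sum.
  by rewrite xbarE; exact: (cv w).2.
have h0 : E (fun w => avg_cost f (x B w)) - avg_cost f xt <= 2 * G * Rb.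
  rewrite lerBlDr -(E_cst P (2 * G * Rb + avg_cost f xt)).
  apply: E_le => [||w]; [exact: iC|exact: L1_cst|].
  have Xxt := Sset_in Sxt; have := avg_fext_lip (x B w) xt.
  rewrite !avg_fext//; last exact: x_in.
  rewrite ler_norml => /andP[_ h].
  by have := ler_wpM2l (ltW G0) (dist_xt (x_in B w)); lra.
move: hX; rewrite big_ltn ?leq_addr -?addSnnS//; last by rewrite ltnS leq_addr.
move: sumD; rewrite sumrB sumrB !big_const_nat !iter_addr_0 addKn.
move: (Rintegral _ _ _) h0 (Rintegral _ _ _) => b h0 a.
move: (\sum_(_ <= t < _) _) => S hS ha.
apply: (@le_trans _ _ (N^-1 * (b + S) - avg_cost f xt)); first by rewrite lerD2r.
have c0 : 0 <= eta * Vc * dd%:R * bbar edge R dim Delta.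
  by rewrite mulr_ge0// sqrtr_ge0.
have er0 : 0 <= err.
  have k0 := kappa_ge0; have R0 := Rb_ge0; have G1 := ltW G0; have L1' := ltW L0.
  have g0 : 0 <= G * Rb * kappa by rewrite !mulr_ge0.
  have l0 : 0 <= lag.
    rewrite /lag mulr_ge0//; first by rewrite mulr_ge0// ltW.
    apply: addr_ge0; first by rewrite divr_ge0// ltW.
    by rewrite mulr_ge0 ?(ltW u0)// mulr_ge0// Vc_ge0.
  have K10 : 0 <= K1 by rewrite mulr_ge0// addr_ge0// mulr_ge0// mulr_ge0.
  rewrite /err; apply: addr_ge0; last first.
    by rewrite mulr_ge0// mulr_ge0 ?sqr_ge0// divr_ge0.
  apply: addr_ge0; last by rewrite -!mulrA mulr_ge0// mulrA.
  rewrite mulr_ge0// addr_ge0//; first by rewrite mulr_ge0.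
  by rewrite -!mulrA mulr_ge0// mulrA.
rewrite -(@ler_pM2l _ N)// mulrBr mulVKf ?gt_eqF// [leRHS]mulrDr.
rewrite [N * (N^-1 * _ + _)]mulrDr mulVKf ?gt_eqF//.
have eN : N = 1 + k%:R by rewrite /N -natr1 addrC.
rewrite eN; move: hS h0 c0 er0 v0; rewrite /c -(mulr_natl (avg_cost f xt)) -(mulr_natl (_ + err)).
move: (avg_cost f xt) (bbar _ _ _ _) err (D0 / eta) (G * Rb) => A bb er d g.
move: (eta * Vc * dd%:R) => v hS h0 c0 er0 v0.
lra.
Qed.

Lemma run_bound (D0 kap a : R) (T : nat) : (Bmax edge Delta <= T)%N ->
  (forall p, prod_set X p -> breg p <= D0) ->
  8 * 2 ^+ dd * expR (- (rho ^+ 2 / 4)) <= kap ->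
  ('E_P[fun w => avg_cost f (xbar edge Delta x T w)] - a%:E <=
   (avg_cost f xt - a
    + (T - Bmax edge Delta + 1)%:R^-1 * (2 * G * Rb + D0 / eta)
    + eta * Vc * dd%:R * (bbar edge R dim Delta + 1 / 2)
    + (n%:R * ((2 * Rb * L + G) * dd%:R *
         (eta * (Bmax edge Delta)%:R * (n%:R / u + u * (Vc * dd%:R)))
         + 8 * G * Rb * kap) + 4 * G * Rb * kap + L / 2 * u ^+ 2 * dd%:R))%:E)%E.
Proof.
move=> BT D0P kapP; have [iX] := run_accuracy BT D0P.
rewrite expectation.unlock -(EFin_E iX) -EFinB lee_fin.
move: (Rintegral _ _ _) => q.
have g0 : 0 <= G * Rb by rewrite mulr_ge0 ?Rb_ge0// ltW.
have h : G * Rb * kappa <= G * Rb * kap.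
  by apply: ler_wpM2l => //; exact: le_trans kappa_le kapP.
have h' : n%:R * (G * Rb * kappa) <= n%:R * (G * Rb * kap) by rewrite ler_wpM2l.
rewrite /err /K1 /lag; move: h h'; move: kappa => k.
move: (_^-1 * _) => A.
set W := (_ * (_ * _ * (_ + _))).
move: (avg_cost f xt) (eta * Vc * _ * _) W (L / 2 * u ^+ 2 * _) => F v W' l.
lra.
Qed.

End Run.

(** * Accuracy *)

(** By convention [sup] is 0 when the set of radii is empty or unbounded. *)
Lemma inradius_ge0 (R : realType) m (C : set 'rV[R]_m) : 0 <= inradius C.
Proof.
rewrite /inradius; set S := [set r | _].
have [hs|/sup_out -> //] := pselect (has_sup S).
have [[r [r0 rC]] _] := hs; apply: (le_trans (ltW r0)).
by apply: (ub_le_sup hs.2); split.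
Qed.

Lemma inradius_le (R : realType) m (C : set 'rV[R]_m) (r : R) : (0 < m)%N -> 0 <= r ->
  C `<=` ball2 r -> inradius C <= r.
Proof.
move=> m0 r0 Cr; rewrite /inradius; set S := [set r | _].
have [S0|/nonemptyPn ->] := pselect (S !=set0); last by rewrite sup0.
apply: ge_sup => // s [s0 sC].
(* A vector of norm exactly s, which exists in positive dimension. *)
pose v : 'rV[R]_m := s *: delta_mx 0 (Ordinal m0).
have nv : norm2 v = s.
  rewrite norm2Z gtr0_norm// (_ : norm2 _ = 1) ?mulr1//.
  rewrite /norm2 /dot (bigD1 (Ordinal m0))//= big1 => [|k kn].
    by rewrite !mxE !eqxx mulr1 addr0 sqrtr1.
  by rewrite !mxE (negbTE kn) andbF mulr0.
by have := Cr v (sC v _); rewrite /ball2/= nv; apply.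
Qed.

Lemma min_inradius_le (R : realType) n (dim : 'I_n -> nat)
    (X : forall i, set 'rV[R]_(dim i)) i : min_inradius X <= inradius (X i).
Proof.
apply: ge_inf; last by exists i.
by exists 0 => _ [j _ <-]; exact: inradius_ge0.
Qed.

Lemma sqrt_small (R : realType) (A b : R) : 0 <= A -> 0 < b ->
  exists2 e : R, 0 < e & forall eps, 0 < eps < e -> A * Num.sqrt eps <= b.
Proof.
move=> A0 b0; have A1 : 0 < A + 1 by lra.
exists ((b / (A + 1)) ^+ 2) => [|eps /andP[e0 ee]]; first by rewrite exprn_gt0// divr_gt0.
have s0 := sqrtr_ge0 eps.
have : Num.sqrt eps <= b / (A + 1).
  rewrite -(@ler_pXn2r _ 2)// ?nnegrE//; last by rewrite divr_ge0 ?ltW.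
  by rewrite sqr_sqrtr ltW.
rewrite ler_pdivlMr// mulrC mulrDl; lra.
Qed.

Lemma sum_bregmanE (R : realType) n (dim : 'I_n -> nat)
    (psi : forall i, 'rV[R]_(dim i) -> R)
    (gpsi : forall i, 'rV[R]_(dim i) -> 'rV[R]_(dim i)) (p q : profile R dim) :
  bregman (sum_psi psi) (sum_gpsi gpsi) p q =
  \sum_i bregman (psi i) (gpsi i) (block p i) (block q i).
Proof.
rewrite /bregman /sum_psi dot_block !sumrB; congr (_ - _ - _).
by apply: eq_bigr => i _; rewrite mxrow_block blockB.
Qed.

Lemma ler_sqr_sqrt1 (R : realType) (d : R) : 0 <= d -> d <= (Num.sqrt d + 1) ^+ 2.
Proof.
move=> d0; rewrite -{1}(sqr_sqrtr d0); have := sqrtr_ge0 d; move: (Num.sqrt d) => s s0.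
by rewrite ler_pXn2r// ?nnegrE; lra.
Qed.

(** One factor u and the factor eps are given up; what remains is linear in u. *)
Lemma eta_max_le (R : realType) (sig b q u eps eta : R) :
  0 < sig -> 0 <= b -> 1 <= q -> 0 < u -> u <= 1 -> 0 < eps -> eps <= 1 ->
  eta <= 3 * u ^+ 2 * eps / (8 * sig ^+ 2 * (b + 1 / 2) * q ^+ 2) ->
  eta <= 3 / 4 / sig ^+ 2 * u.
Proof.
move=> s0 b0 q1 u0 u1 ep0 ep1 heta; apply: (le_trans heta).
have s2 : 0 < sig ^+ 2 by rewrite exprn_gt0.
have h1 : 4 * sig ^+ 2 <= 8 * sig ^+ 2 * (b + 1 / 2) * q ^+ 2.
  have q2 : 1 <= q ^+ 2 by rewrite expr_ge1//; lra.
  have h2 : 4 * sig ^+ 2 <= 8 * sig ^+ 2 * (b + 1 / 2).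
    by have := mulr_ge0 (ltW s2) b0; lra.
  have h3 : 0 <= 8 * sig ^+ 2 * (b + 1 / 2) by lra.
  have := ler_peMr h3 q2; lra.
have h4 : 3 * u ^+ 2 * eps <= 3 * u.
  have h5 : u * eps <= 1 by have := ler_pM (ltW u0) (ltW ep0) u1 ep1; lra.
  have := ler_wpM2l (ltW u0) h5; lra.
rewrite ler_pdivrMr; last by lra.
apply: (le_trans h4).
apply: (@le_trans _ _ (3 / 4 / sig ^+ 2 * u * (4 * sig ^+ 2))).
  by rewrite le_eqVlt; apply/orP; left; apply/eqP; field; rewrite gt_eqF.
apply: ler_wpM2l h1.
by rewrite mulr_ge0 ?(ltW u0)// divr_ge0 ?(ltW s2)// divr_ge0.
Qed.

(** The shares of eps are 1/4 for the shrinkage, 2/15 for the initial divergence, 15/32 for second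
    moments and delays (5/4 from [Vc] times 3/8 from the step size), 1/36 for the smoothing, and
    four times 1/50 for terms with a spare factor u, delta or eta. They sum to less than 0.97. *)
Lemma error_budget (R : realType)
    (nn d Bm G L Rb sig Db M0 b u delta eta N eps kap gap q Ck : R) :
  0 < nn -> 1 <= d -> 0 <= Bm -> 0 < G -> 0 < L -> 0 < Rb -> 0 < sig -> 0 < Db ->
  0 <= b -> 0 < u -> 0 < eta -> 0 < N -> 0 < eps -> 1 <= q -> d <= q ^+ 2 ->
  gap <= eps / 4 ->
  15 * Db / (2 * eta * eps) <= N ->
  eta <= 3 * u ^+ 2 * eps / (8 * sig ^+ 2 * (b + 1 / 2) * q ^+ 2) ->
  L / 2 * u ^+ 2 * d <= eps / 36 ->
  kap <= Ck * u * eps ->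
  delta * M0 * (2 / (15 * Db)) <= 1 / 50 ->
  eta * (4 * G * Rb / (15 * Db)) <= 1 / 50 ->
  nn * (2 * Rb * L + G) * d * Bm * (nn + 5 / 4 * sig ^+ 2 * d) * (3 / 4 / sig ^+ 2) * u
    <= 1 / 50 ->
  (8 * nn + 4) * G * Rb * Ck * u <= 1 / 50 ->
  gap + N^-1 * (2 * G * Rb + (Db + delta * M0) / eta)
  + eta * (5 / 4 * sig ^+ 2 / u ^+ 2) * d * (b + 1 / 2)
  + (nn * ((2 * Rb * L + G) * d *
       (eta * Bm * (nn / u + u * (5 / 4 * sig ^+ 2 / u ^+ 2 * d)))
       + 8 * G * Rb * kap) + 4 * G * Rb * kap + L / 2 * u ^+ 2 * d) <= eps.
Proof.
move=> n0 d1 B0 G0 L0 R0 s0 D0 b0 u0 e0 N0 ep0 q1 dq hgap hN heta hL hk hd hE hA hK.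
have b12 : 0 < b + 1 / 2 by lra.
have u2 : 0 < u ^+ 2 by rewrite exprn_gt0.
have s2 : 0 < sig ^+ 2 by rewrite exprn_gt0.
have q2 : 1 <= q ^+ 2 by rewrite expr_ge1//; lra.
have q20 : 0 < q ^+ 2 by lra.
have q0 : 0 < q by lra.
have iN : N^-1 <= 2 * eta * eps / (15 * Db).
  rewrite -[leRHS]invf_div lef_pV2 ?posrE// divr_gt0// ?mulr_gt0//; lra.
have iN0 : 0 < N^-1 by rewrite invr_gt0.
have ei0 : 0 < eta^-1 by rewrite invr_gt0.
have a1 : N^-1 * (2 * G * Rb) <= eps * (1 / 50).
  apply: (@le_trans _ _ (eps * (eta * (4 * G * Rb / (15 * Db))))); last by rewrite ler_pM2l.
  have := ler_wpM2r (_ : 0 <= 2 * G * Rb) iN; rewrite !mulr_ge0 ?(ltW G0) ?(ltW R0)//.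
  move=> /(_ isT) h; apply: (le_trans h); rewrite le_eqVlt; apply/orP; left; apply/eqP.
  by field; rewrite gt_eqF.
have a2 : N^-1 * ((Db + delta * M0) / eta) <= eps * (2 / 15) + eps * (1 / 50).
  have h1 : N^-1 * (Db / eta) <= eps * (2 / 15).
    apply: (le_trans (ler_wpM2r _ iN)); first by rewrite divr_ge0 ?ltW.
    by rewrite le_eqVlt; apply/orP; left; apply/eqP; field; rewrite !gt_eqF.
  have h2 : N^-1 * (delta * M0 / eta) <= eps * (1 / 50).
    have [dm|dm] := leP (delta * M0) 0.
      apply: (@le_trans _ _ 0); last by rewrite mulr_ge0// ltW.
      by rewrite pmulr_rle0// pmulr_lle0.
    apply: (le_trans (ler_wpM2r _ iN)); first by rewrite divr_ge0 ?ltW.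
    apply: (@le_trans _ _ (eps * (delta * M0 * (2 / (15 * Db))))); last by rewrite ler_pM2l.
    by rewrite le_eqVlt; apply/orP; left; apply/eqP; field; rewrite !gt_eqF.
  rewrite mulrDl mulrDr; lra.
have a3 : eta * (5 / 4 * sig ^+ 2 / u ^+ 2) * d * (b + 1 / 2) <= eps * (15 / 32).
  move: heta; rewrite ler_pdivlMr ?mulr_gt0// => heta.
  rewrite (_ : eta * _ * d * _ = eta * sig ^+ 2 * (b + 1 / 2) * (5 / 4 * d) / u ^+ 2);
    last by field; rewrite gt_eqF.
  rewrite ler_pdivrMr//.
  have : eta * sig ^+ 2 * (b + 1 / 2) * (5 / 4 * d) <=
      eta * sig ^+ 2 * (b + 1 / 2) * (5 / 4 * q ^+ 2).
    by rewrite ler_wpM2l// ?ler_pM2l// !mulr_ge0 ?ltW.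
  lra.
have eu : eta / u <= 3 / 4 / sig ^+ 2 * u * eps.
  rewrite ler_pdivrMr//; apply: (le_trans heta).
  rewrite (_ : 3 / 4 / sig ^+ 2 * u * eps * u = 3 * u ^+ 2 * eps / (4 * sig ^+ 2));
    last by field; rewrite gt_eqF.
  apply: ler_wpM2l; first by rewrite !mulr_ge0 ?ltW.
  rewrite lef_pV2 ?posrE ?mulr_gt0//.
  have h1 : 8 * sig ^+ 2 * (1 / 2) <= 8 * sig ^+ 2 * (b + 1 / 2).
    by rewrite ler_pM2l ?mulr_gt0//; lra.
  have h2 : 0 <= 8 * sig ^+ 2 * (b + 1 / 2) by rewrite !mulr_ge0// ltW.
  have := ler_peMr h2 q2; lra.
have a4 : nn * ((2 * Rb * L + G) * d *
    (eta * Bm * (nn / u + u * (5 / 4 * sig ^+ 2 / u ^+ 2 * d)))) <= eps * (1 / 50).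
  pose A := nn * (2 * Rb * L + G) * d * Bm * (nn + 5 / 4 * sig ^+ 2 * d).
  have A0 : 0 <= A.
    have h1 : 0 <= 2 * Rb * L by rewrite !mulr_ge0 ?ltW.
    have h2 : 0 <= 5 / 4 * sig ^+ 2 * d by rewrite !mulr_ge0 ?ltW//; lra.
    rewrite /A mulr_ge0//; last by rewrite addr_ge0// ltW.
    rewrite mulr_ge0// mulr_ge0//; last by lra.
    by rewrite mulr_ge0 ?addr_ge0// ltW.
  rewrite (_ : nn * _ = A * (eta / u)); last by rewrite /A; field; rewrite gt_eqF.
  apply: (le_trans (ler_wpM2l A0 eu)); rewrite -/A in hA.
  have := ler_wpM2l (ltW ep0) hA; lra.
have a5 : (8 * nn + 4) * G * Rb * kap <= eps * (1 / 50).
  have k0 : 0 <= (8 * nn + 4) * G * Rb by rewrite !mulr_ge0 ?ltW//; lra.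
  apply: (le_trans (ler_wpM2l k0 hk)); have := ler_wpM2l (ltW ep0) hK; lra.
rewrite [N^-1 * _]mulrDr [nn * (_ + _)]mulrDr; lra.
Qed.

(** * Smallness of the errors under the parameter conditions *)

Section Accuracy.
Variables (R : realType) (n : nat) (dim : 'I_n -> nat).
Variables (X : forall i, set 'rV[R]_(dim i)) (Ri : 'I_n -> R) (G L : R)
  (f : 'I_n -> profile R dim -> R).
Variables (edge : rel 'I_n) (Delta : nat) (sigma Dbar : R).
Variables (psi : forall i, 'rV[R]_(dim i) -> R)
          (gpsi : forall i, 'rV[R]_(dim i) -> 'rV[R]_(dim i)).
Variable xstar : profile R dim.
Arguments X : clear implicits.
Arguments psi : clear implicits.
Arguments gpsi : clear implicits.
Hypothesis setting : constrained_convex_setting X Ri G L f.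
Hypothesis mirror : mirror_maps X psi gpsi.
Hypothesis opt : is_argmin (prod_set X) (avg_cost f) xstar.
Hypothesis DbarP : is_max [set bregman (sum_psi psi) (sum_gpsi gpsi) xstar x
         | x in prod_set X] Dbar.
Hypotheses (G0 : 0 < G) (L0 : 0 < L) (sigma0 : 0 < sigma).

Notation dd := (\sum_i dim i)%N.
Notation Rbar := (Rb Ri).
Notation rlow := (min_inradius X).

Let n0 : (0 < n)%N. Proof. by case: setting => -[]. Qed.
Let nR : 0 < n%:R :> R. Proof. by rewrite ltr0n. Qed.
Let i0 : 'I_n := Ordinal n0.
Let dim0 i : (0 < dim i)%N. Proof. by case: setting => -[]. Qed.
Let cX i : @convex_set R 'rV[R]_(dim i) (X i).
Proof. by case: setting => _ /(_ i)[]. Qed.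
Let X0 i : X i 0.
Proof. by case: setting => _ /(_ i)[_ _ /interior_subset]. Qed.
Let Xstar : prod_set X xstar. Proof. exact: opt.1. Qed.

Lemma Rb_gt0 : 0 < Rbar.
Proof.
rewrite sqrtr_gt0 (bigD1 i0)//= ltr_pwDl//.
  by rewrite exprn_gt0//; case: setting => _ _ /(_ i0)[].
by apply: sumr_ge0 => i _; exact: sqr_ge0.
Qed.

Lemma Ri_le i : Ri i <= Rbar.
Proof.
have Ri0 : 0 < Ri i by case: setting => _ _ /(_ i)[].
rewrite /Rb -[leLHS]ger0_norm ?(ltW Ri0)// -sqrtr_sqr; apply: ler_wsqrtr.
rewrite (bigD1 i)//= lerDl.
by apply: sumr_ge0 => j _; exact: sqr_ge0.
Qed.

Lemma rlow_le : rlow <= Rbar.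
Proof.
apply: (le_trans (min_inradius_le X i0)); apply: le_trans (Ri_le i0).
by case: setting => _ _ /(_ i0)[r0 rX] _ _; apply: inradius_le => //; exact: ltW.
Qed.

Lemma dd_ge1 : 1 <= dd%:R :> R.
Proof. by rewrite ler1n (bigD1 i0)//= addn_gt0 dim0. Qed.

(** By strong convexity the divergence is positive at every point other than [xstar], for instance
    at 0 or, if [xstar] is 0, at a short nonzero vector. *)
Lemma Dbar_gt0 : 0 < rlow -> 0 < Dbar.
Proof.
move=> r0.
have [p Xp pn] : exists2 p, prod_set X p & p != xstar.
  have [x0|xn] := eqVneq xstar 0; last first.
    by exists 0; [move=> i; rewrite block0|rewrite eq_sym].
  pose p : profile R dim :=
    mxrow (fun i => (rlow / 2) *: delta_mx 0 (Ordinal (dim0 i))).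
  have nd m (k : 'I_m) : norm2 (delta_mx 0 k : 'rV[R]_m) = 1.
    rewrite /norm2 /dot (bigD1 k)//= big1 => [|l kn].
      by rewrite !mxE !eqxx mulr1 addr0 sqrtr1.
    by rewrite !mxE (negbTE kn) andbF mulr0.
  have np i : norm2 (block p i) = rlow / 2.
    by rewrite mxrow_block norm2Z nd mulr1 gtr0_norm// divr_gt0.
  exists p => [i|].
    apply: in_inradius; rewrite np; apply: lt_le_trans (min_inradius_le X i); lra.
  apply/eqP => e; have := np i0; rewrite e x0 block0 norm20; lra.
have h : 1 / 2 * norm2 (xstar - p) ^+ 2 <= bregman (sum_psi psi) (sum_gpsi gpsi) xstar p.
  rewrite sum_bregmanE sqr_norm2_block mulr_sumr; apply: ler_sum => i _.
  have [gP _ sc] := mirror i.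
  have := strong_gradient (@cX i) sc (Xp i) (Xstar i) (gP _ (Xp i)).
  rewrite blockB /bregman; lra.
have := DbarP.2 _ (ex_intro2 _ _ p Xp erefl).
have : 0 < norm2 (xstar - p) ^+ 2.
  rewrite exprn_gt0// lt_neqAle norm2_ge0 andbT eq_sym; apply/eqP => /norm2_eq0/eqP.
  by rewrite subr_eq0 eq_sym (negbTE pn).
lra.
Qed.

(** [Dbar] concerns xstar, but the telescoping sum starts from the divergence of (1 - delta) xstar.
    Convexity between xstar and 0 bounds the excess by delta <gpsi p - gpsi 0, p>, and each [gpsi i]
    is bounded on the compact set X i. *)
Lemma breg_shrink : 0 <= Dbar -> exists2 M0 : R, 0 <= M0 &
  forall (delta : R) p, 0 < delta < 1 -> prod_set X p ->
  breg psi gpsi ((1 - delta) *: xstar) p <= Dbar + delta * M0.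
Proof.
move=> D0.
have /choice[M hM] : forall i, exists M : R,
    0 < M /\ forall y, X i y -> norm2 (gpsi i y) <= M.
  move=> i; have [_ cg _] := mirror i.
  have [M M0 hM] : exists2 M : R, 0 < M & forall y, X i y -> norm2 (gpsi i y) <= M.
    by apply: compact_norm2_bounded => //; case: setting => _ /(_ i)[].
  by exists M.
exists (\sum_i 2 * M i * Ri i) => [|delta p /andP[d0 d1] Xp].
  apply: sumr_ge0 => i _; have [M0 _] := hM i.
  by rewrite !mulr_ge0 ?(ltW M0)//; case: setting => _ _ /(_ i)[/ltW].
apply: (@le_trans _ _ (\sum_i ((1 - delta) * bregman (psi i) (gpsi i) (block xstar i) (block p i)
   + delta * (2 * M i * Ri i)))).
  apply: ler_sum => i _; have [gP _ sc] := mirror i; have [M0 hMi] := hM i.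
  have Xpi := Xp i; have Xsi := Xstar i; rewrite blockZ.
  move: (block p i) (block xstar i) Xpi Xsi => pi si Xpi Xsi.
  have t01 : 0 <= 1 - delta <= 1 by apply/andP; split; lra.
  have h1 := sc si 0 (1 - delta) Xsi (X0 i) t01.
  rewrite scaler0 addr0 in h1.
  have h2 := strong_gradient (@cX i) sc (X0 i) Xpi (gP _ (X0 i)).
  rewrite subr0 in h1; rewrite subr0 in h2.
  have h3 : dot (gpsi i pi - gpsi i 0) pi <= 2 * M i * Ri i.
    apply: (le_trans (dot_le _ _)); apply: ler_pM; rewrite ?norm2_ge0//.
      have := ler_norm2B (gpsi i pi) (gpsi i 0); have := hMi _ Xpi; have := hMi _ (X0 i); lra.
    by case: setting => _ _ /(_ i)[_ rX] _ _; exact: rX.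
  have := sqr_ge0 (norm2 pi); have := sqr_ge0 (norm2 si) => sq1 sq2.
  have h4 : 0 <= 1 / 2 * ((1 - delta) * (1 - (1 - delta))) * norm2 si ^+ 2.
    by rewrite mulr_ge0// mulr_ge0// mulr_ge0//; lra.
  rewrite dotBl in h3.
  have h5 := ler_wpM2l (ltW d0) h3; have h6 := ler_wpM2l (ltW d0) h2.
  have h7 := mulr_ge0 (ltW d0) sq2.
  rewrite /bregman !dotBr dotZr; lra.
rewrite big_split/= -!mulr_sumr lerD2r -sum_bregmanE.
have h := DbarP.2 _ (ex_intro2 _ _ p Xp erefl).
have d1' : 0 <= 1 - delta by lra.
have := ler_wpM2l d1' h; have := mulr_ge0 (ltW d0) D0; lra.
Qed.

Lemma xstar_le : norm2 xstar <= Rbar. Proof. exact: norm2_in setting _ Xstar. Qed.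

Lemma shrink_xstar (delta : R) : 0 < delta < 1 -> Sset X delta ((1 - delta) *: xstar).
Proof. by move=> d01 i; rewrite blockZ; exists (block xstar i). Qed.

Lemma cost_shrink_lip (delta : R) : 0 < delta < 1 ->
  avg_cost f ((1 - delta) *: xstar) - avg_cost f xstar <= G * (delta * Rbar).
Proof.
move=> d01; have /andP[d0 d1] := d01.
have Xt : prod_set X ((1 - delta) *: xstar).
  by move=> i; apply: (shrink_sub (@cX i) (X0 i) d01); exact: shrink_xstar.
rewrite /avg_cost -mulrBr -sumrB ler_pdivrMl// mulr_natl.
rewrite (_ : _ *+ n = \sum_(j < n) G * (delta * Rbar)); last by rewrite sumr_const card_ord.
apply: ler_sum => j _; case: setting => _ _ _ /(_ j)[lip _] _.
apply: (le_trans (ler_norm _)); apply: (le_trans (lip _ _ Xt Xstar)).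
rewrite ler_pM2l// (_ : _ - xstar = - (delta *: xstar)); last first.
  by apply/rowP => k; rewrite !mxE; ring.
by rewrite norm2N norm2Z gtr0_norm// ler_pM2l// xstar_le.
Qed.

(** What matters is the sign of the derivative [a] along xstar. As xstar is interior, moving
    outwards stays in X, and minimality gives a >= 0; shrinking then costs at most the quadratic
    term. *)
Lemma cost_shrink_interior (delta : R) : interior (prod_set X) xstar -> 0 < delta < 1 ->
  avg_cost f ((1 - delta) *: xstar) - avg_cost f xstar <= L / 2 * (delta * Rbar) ^+ 2.
Proof.
move=> int d01; have /andP[d0 d1] := d01.
have Xt : prod_set X ((1 - delta) *: xstar).
  by move=> i; apply: (shrink_sub (@cX i) (X0 i) d01); exact: shrink_xstar.
have /choice[gh ghP] : forall j, exists gh : profile R dim -> profile R dim,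
    (forall x, prod_set X x -> is_gradient (prod_set X) (f j) x (gh x)) /\
    (forall x y, prod_set X x -> prod_set X y -> norm2 (gh x - gh y) <= L * norm2 (x - y)).
  by move=> j; case: setting => _ _ _ /(_ j)[_ [gh hg]] _; exists gh.
pose a := n%:R^-1 * \sum_j dot (gh j xstar) xstar.
pose q := norm2 xstar ^+ 2.
have up (r : R) : prod_set X (xstar + r *: xstar) ->
    avg_cost f (xstar + r *: xstar) <= avg_cost f xstar + r * a + L / 2 * r ^+ 2 * q.
  move=> Xr; rewrite /avg_cost /a -(@ler_pM2l _ n%:R)// mulVKf ?gt_eqF//.
  have -> : n%:R * (n%:R^-1 * (\sum_i f i xstar) + r * (n%:R^-1 * \sum_j dot (gh j xstar) xstar)
      + L / 2 * r ^+ 2 * q) =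
    \sum_i (f i xstar + r * dot (gh i xstar) xstar + L / 2 * r ^+ 2 * q).
    rewrite !big_split/= sumr_const card_ord -mulr_sumr -[_ *+ n]mulr_natl; field.
    by rewrite gt_eqF.
  apply: ler_sum => j _; have [gP gL] := ghP j.
  have := smooth_upper (convex_prod setting) Xstar Xr gP gL.
  rewrite (_ : xstar + r *: xstar - xstar = r *: xstar); last by rewrite addrC addKr.
  rewrite dotZr norm2Z exprMn real_normK ?num_real// /q; lra.
have a0 : 0 <= a.
  move: int; rewrite /interior => /nbhs_ballP[e /= e0 he].
  have q0 : 0 <= q by exact: sqr_ge0.
  have inr (r : R) : 0 < r -> r * (`|xstar| + 1) < e -> prod_set X (xstar + r *: xstar).
    move=> r0 re; apply: he; rewrite -ball_normE/=.
    rewrite opprD addrA subrr sub0r normrN normrZ gtr0_norm//.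
    by apply: le_lt_trans re; rewrite ler_pM2l// lerDl.
  have c0 : 0 < `|xstar| + 1 by rewrite ltr_wpDl.
  rewrite -oppr_le0; apply/ler_addgt0Pr => e1 e10; rewrite add0r.
  pose r := Num.min (e / (2 * (`|xstar| + 1))) (e1 / (L / 2 * q + 1)).
  have l0 : 0 <= L / 2 * q by rewrite mulr_ge0// divr_ge0// ltW.
  have l1 : 0 < L / 2 * q + 1 by lra.
  have r0 : 0 < r by rewrite lt_min !divr_gt0// mulr_gt0.
  have r1 : r * (`|xstar| + 1) < e.
    have : r <= e / (2 * (`|xstar| + 1)) by rewrite ge_min lexx.
    rewrite ler_pdivlMr ?mulr_gt0//; lra.
  have r2 : r * (L / 2 * q + 1) <= e1.
    by rewrite -ler_pdivlMr// ge_min lexx orbT.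
  have h1 := up r (inr r r0 r1); have h2 := opt.2 _ (inr r r0 r1).
  have h3 : 0 <= r * (a + r * (L / 2 * q)) by lra.
  rewrite pmulr_rge0// in h3; lra.
have := up (- delta); rewrite (_ : xstar + - delta *: xstar = (1 - delta) *: xstar); last first.
  by rewrite scalerBl scale1r scaleNr.
move=> /(_ Xt) h; have h2 := mulr_ge0 (ltW d0) a0.
have h3 : delta ^+ 2 * q <= (delta * Rbar) ^+ 2.
  rewrite exprMn ler_wpM2l ?sqr_ge0// ler_pXn2r// ?nnegrE ?norm2_ge0 ?sqrtr_ge0//.
  exact: xstar_le.
have l2 : 0 <= L / 2 by rewrite divr_ge0// ltW.
have := ler_wpM2l l2 h3; rewrite sqrrN in h; lra.
Qed.

(** Since 9/4 times 4/9 is 1, rho^2 / 4 is at least ln y; this is the origin of the coefficient 4/9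
    in the condition on u. *)
Lemma tail_small (rho : R) (d : nat) (y : R) : 0 < y ->
  3 * Num.sqrt (d%:R + 4 / 9 * Num.max 0 (ln y)) <= rho ->
  expR (- (rho ^+ 2 / 4)) <= y^-1.
Proof.
move=> y0 hr; set l := Num.max 0 (ln y) in hr.
have l0 : 0 <= l by rewrite le_max lexx.
have ly : ln y <= l by rewrite le_max lexx orbT.
have s0 : 0 <= d%:R + 4 / 9 * l by rewrite addr_ge0// mulr_ge0.
have h : 9 * (d%:R + 4 / 9 * l) <= rho ^+ 2.
  rewrite -(sqr_sqrtr s0); have := sqrtr_ge0 (d%:R + 4 / 9 * l).
  by move: (Num.sqrt _) hr => s hr s1; nra.
have d0 : 0 <= d%:R :> R by [].
rewrite -[y in leRHS]lnK ?posrE// -expRN ler_expR; lra.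
Qed.

(** Both choices of delta pass through this lemma. The share eps / 36 is one ninth of eps / 4, which
    is what delta = sqrt eps / (Rbar sqrt (2 L)) gives because rlow <= Rbar. *)
Lemma accuracy_common (Cd : R) : 0 <= Cd ->
  exists2 eps0 : R, 0 < eps0 &
  forall (eps eta u delta : R) (T : nat), 0 < eps < eps0 ->
    admissible (Bmax edge Delta) T u delta eta ->
    delta <= Cd * Num.sqrt eps ->
    L / 2 * (delta * rlow / 3) ^+ 2 <= eps / 36 ->
    avg_cost f ((1 - delta) *: xstar) - avg_cost f xstar <= eps / 4 ->
    star_le n dd (Bmax edge Delta) T G Rbar rlow sigma Dbar (bbar edge R dim Delta)
      eps u delta eta ->
    zfo_accuracy X f edge Delta sigma psi gpsi xstar eta u delta T eps.
Proof.
move=> Cd0.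
(* Without rlow > 0 the condition on u would bound a positive quantity by one that is not. *)
have [r0|r0] := ltP 0 rlow; last first.
  exists 1 => // eps eta u delta T _ [_ u0 /andP[d0 _] _] _ _ _ [].
  rewrite /u_lhs /u_rhs => h _ _; exfalso.
  have d1 := dd_ge1.
  have : 0 < u * Num.sqrt (dd%:R + 4 / 9 *
      Num.max 0 (ln (20 * G * Rbar ^+ 2 * Num.sqrt n%:R / (u * eps)))).
    rewrite mulr_gt0// sqrtr_gt0 ltr_pwDl//; first by lra.
    by rewrite mulr_ge0// le_max lexx.
  have : delta * rlow / 3 <= 0 by rewrite pmulr_lle0// pmulr_rle0.
  lra.
have D0 := Dbar_gt0 r0; have [M0 M00 hM0] := breg_shrink (ltW D0).
have R0 := Rb_gt0; have d1 := dd_ge1; have s2 : 0 < sigma ^+ 2 by rewrite exprn_gt0.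
pose Bm : R := (Bmax edge Delta)%:R; pose b := bbar edge R dim Delta.
have b0 : 0 <= b by exact: sqrtr_ge0.
pose Ck : R := 8 * 2 ^+ dd / (20 * G * Rbar ^+ 2 * Num.sqrt n%:R).
have y0 : 0 < 20 * G * Rbar ^+ 2 * Num.sqrt n%:R.
  by rewrite mulr_gt0 ?sqrtr_gt0// mulr_gt0 ?exprn_gt0// mulr_gt0.
have Ck0 : 0 <= Ck by rewrite divr_ge0 ?(ltW y0)// mulr_ge0// exprn_ge0.
pose A1 : R := n%:R * (2 * Rbar * L + G) * dd%:R * Bm * (n%:R + 5 / 4 * sigma ^+ 2 * dd%:R)
  * (3 / 4 / sigma ^+ 2).
have A10 : 0 <= A1.
  rewrite /A1; apply: mulr_ge0; last by rewrite divr_ge0 ?(ltW s2)// divr_ge0.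
  apply: mulr_ge0; last by rewrite addr_ge0// mulr_ge0// mulr_ge0// ltW.
  apply: mulr_ge0 => //; apply: mulr_ge0 => //; apply: mulr_ge0 => //.
  by rewrite addr_ge0 ?(ltW G0)// mulr_ge0 ?(ltW L0)// mulr_ge0// ltW.
pose A2 : R := (8 * n%:R + 4) * G * Rbar * Ck.
have A20 : 0 <= A2.
  by rewrite /A2; do 3!(apply: mulr_ge0 => //; try exact: ltW); rewrite addr_ge0// mulr_ge0.
pose A3 : R := 3 / 4 / sigma ^+ 2 * (4 * G * Rbar / (15 * Dbar)).
have A30 : 0 <= A3.
  apply: mulr_ge0; first by rewrite divr_ge0 ?(ltW s2)// divr_ge0.
  by apply: divr_ge0; [apply: mulr_ge0; [apply: mulr_ge0 => //|]; exact: ltW|rewrite mulr_ge0// ltW].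
pose A4 : R := 11 * (32 * 2 ^+ dd) * G ^+ 2 / (3 / 20 * sigma ^+ 2).
have A40 : 0 <= A4.
  apply: divr_ge0; last by rewrite mulr_ge0 ?(ltW s2)// divr_ge0.
  by apply: mulr_ge0; [apply: mulr_ge0 => //; apply: mulr_ge0 => //; exact: exprn_ge0|exact: sqr_ge0].
(* Collects the constants that will multiply u, so that u S <= 1/50 yields all these smallness
   requirements at once. [F1] and [F2] are the resulting factors of sqrt eps in the bounds for u S
   and for the excess divergence. *)
pose S : R := A1 + A2 + A3 + A4 + 1.
have S0 : 0 <= S by rewrite /S; lra.
pose F1 : R := Cd * rlow / 3 * S; pose F2 : R := Cd * (M0 * (2 / (15 * Dbar))).
have F10 : 0 <= F1 by rewrite mulr_ge0// divr_ge0// mulr_ge0// ltW.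
have F20 : 0 <= F2.
  by rewrite mulr_ge0// mulr_ge0// divr_ge0// mulr_ge0// ltW.
have [e1 e10 he1] := sqrt_small (addr_ge0 F10 F20) (ltac:(lra) : 0 < (1 / 50 : R)).
exists (Num.min 1 e1); first by rewrite lt_min ltr01.
move=> eps eta u delta T /andP[ep0]; rewrite lt_min => /andP[ep1 epe].
move=> [eta0 u0 d01 BT] hd hL hgap [].
rewrite /u_lhs /u_rhs /eta_max /T_min -/b => hu heta hT.
have /andP[dl0 dl1] := d01.
set s := Num.sqrt eps in hd; have s0 : 0 <= s by exact: sqrtr_ge0.
have hF : (F1 + F2) * s <= 1 / 50 by apply: he1; rewrite ep0.
set y := 20 * G * Rbar ^+ 2 * Num.sqrt n%:R / (u * eps) in hu.
have yy0 : 0 < y by rewrite divr_gt0// mulr_gt0.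
set w := dd%:R + 4 / 9 * Num.max 0 (ln y) in hu.
have w1 : dd%:R <= w by rewrite /w lerDl mulr_ge0// le_max lexx.
have sw1 : 1 <= Num.sqrt w by rewrite -sqrtr1; apply: ler_wsqrtr; lra.
have usw := ler_peMr (ltW u0) sw1.
have ur : u <= Cd * rlow / 3 * s.
  have := ler_wpM2r (ltW r0) hd; lra.
have uS : u * S <= 1 / 50.
  have := ler_wpM2r S0 ur; have := mulr_ge0 F20 s0.
  by move: hF; rewrite /F1; lra.
have uA1 := mulr_ge0 (ltW u0) A10; have uA2 := mulr_ge0 (ltW u0) A20.
have uA3 := mulr_ge0 (ltW u0) A30; have uA4 := mulr_ge0 (ltW u0) A40.
rewrite /S in uS.
have u1 : u <= 1 / 50 by lra.
have sm : 11 * (32 * 2 ^+ dd) * G ^+ 2 * u ^+ 2 <= 3 / 20 * sigma ^+ 2.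
  have s3 : 0 < 3 / 20 * sigma ^+ 2 by lra.
  rewrite -[leRHS]mul1r -ler_pdivrMr//.
  rewrite [leLHS](_ : _ = u * A4 * u); last first.
    by rewrite /A4; move: (2 ^+ dd : R) => W; field; rewrite gt_eqF.
  have uA : u * A4 <= 1 / 50 by lra.
  have := ler_pM uA4 (ltW u0) uA u1; lra.
(* Gaussian vectors shorter than this are unchanged by the projection; the condition on u makes it
   at least 3 sqrt w. *)
pose rho := delta * rlow / u.
have rhoE : 3 * Num.sqrt w <= rho by rewrite ler_pdivlMr//; lra.
have rho1 : 1 <= rho by lra.
have rad i : u * rho <= delta * inradius (X i).
  by rewrite /rho mulrC divfK ?gt_eqF// ler_pM2l// min_inradius_le.
have rad0 i : 0 < inradius (X i) by exact: lt_le_trans (min_inradius_le X i).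
have tailP : 8 * 2 ^+ dd * expR (- (rho ^+ 2 / 4)) <= Ck * u * eps.
  rewrite (_ : Ck * u * eps = 8 * 2 ^+ dd * y^-1); last first.
    rewrite /Ck /y invf_div; move: (20 * G * _ * _) (2 ^+ dd : R) y0 => c W c0.
    by field; rewrite gt_eqF.
  apply: ler_wpM2l; first by rewrite mulr_ge0// exprn_ge0.
  exact: (tail_small yy0 rhoE).
move=> disp Omega P gauss noise x0 arrivals x z Dmem tau Xx0 smp run.
apply: (le_trans (run_bound setting mirror Xx0 smp run eta0 u0 d01 G0 rad0 L0 sm rho1 rad
  (shrink_xstar d01) (avg_cost f xstar) BT (fun p Xp => hM0 delta p d01 Xp) tailP)).
rewrite lee_fin -/b -/Bm.
set N : R := (_ + 1)%:R.
have N0 : 0 < N by rewrite ltr0n addn1.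
have NP : 15 * Dbar / (2 * eta * eps) <= N.
  apply: (le_trans (ceil_ge _)); rewrite /N -(ler_int R) in hT *.
  by apply: le_trans hT _.
pose q : R := Num.sqrt dd%:R + 1.
have q1 : 1 <= q by rewrite lerDr sqrtr_ge0.
have dq : dd%:R <= q ^+ 2 by exact: ler_sqr_sqrt1.
have hLu : L / 2 * u ^+ 2 * dd%:R <= eps / 36.
  apply: le_trans hL; rewrite -mulrA; apply: ler_wpM2l; first by rewrite divr_ge0// ltW.
  have h1 : (u * Num.sqrt w) ^+ 2 <= (delta * rlow / 3) ^+ 2.
    rewrite ler_pXn2r// ?nnegrE.
      by rewrite mulr_ge0 ?sqrtr_ge0// ltW.
    by rewrite divr_ge0// mulr_ge0// ltW.
  apply: le_trans h1; rewrite exprMn sqr_sqrtr; last by lra.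
  by rewrite ler_wpM2l// sqr_ge0.
have hdM : delta * M0 * (2 / (15 * Dbar)) <= 1 / 50.
  have c0 : 0 <= M0 * (2 / (15 * Dbar)) by rewrite mulr_ge0// divr_ge0// mulr_ge0// ltW.
  have := ler_wpM2r c0 hd; have := mulr_ge0 F10 s0; move: hF; rewrite /F2; lra.
have heta' : eta <= 3 / 4 / sigma ^+ 2 * u.
  apply: (eta_max_le sigma0 b0 q1 u0 _ ep0 (ltW ep1) heta); apply: le_trans u1 _.
  by rewrite ler_pdivrMr// mul1r ler1n.
have hE : eta * (4 * G * Rbar / (15 * Dbar)) <= 1 / 50.
  have c0 : 0 <= 4 * G * Rbar / (15 * Dbar).
    by apply: divr_ge0; [apply: mulr_ge0; [apply: mulr_ge0 => //|]; exact: ltW|rewrite mulr_ge0// ltW].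
  have := ler_wpM2r c0 heta'.
  rewrite (_ : 3 / 4 / sigma ^+ 2 * u * _ = u * A3); last by rewrite /A3; ring.
  lra.
apply: (error_budget (q := q) (Ck := Ck) nR d1 _ G0 L0 R0 sigma0 D0 b0 u0 eta0 N0 ep0 q1 dq hgap
  NP heta hLu (lexx _) hdM hE) => //.
- by rewrite -/A1; lra.
- by rewrite -/A2; lra.
Qed.

End Accuracy.

(** * Complexity *)

Section Delays.
Variables (R : realType) (n : nat) (dim : 'I_n -> nat) (edge : rel 'I_n) (Delta : nat).
Hypotheses (n0 : (0 < n)%N) (dim0 : forall i, (0 < dim i)%N).
Notation dd := (\sum_i dim i)%N.
Notation delay i j := (gdist edge i j + Delta)%N.
Notation S := (\sum_i \sum_j (delay i j)%:R ^+ 2 * (dim i)%:R : R).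
Notation b := (bbar edge R dim Delta).

Lemma gdist_eq0 i j : (gdist edge i j == 0%N) = (i == j).
Proof.
rewrite /gdist; case: n n0 i j edge => // m _ i j e /=.
have -> : [exists p : 0.-tuple 'I_m.+1, path e i p && (last i p == j)] = (i == j).
  apply/existsP/eqP => [[p]|<-]; first by rewrite (tuple0 p)/= => /eqP.
  by exists [tuple]; rewrite /= eqxx.
by case: (i == j).
Qed.

Lemma leq_card_dim : (n <= dd)%N.
Proof.
rewrite -[X in (X <= _)%N](card_ord n) -sum1_card; apply: leq_sum => i _; exact: dim0.
Qed.

Let d0 : 0 < dd%:R :> R.
Proof. by rewrite ltr0n; exact: leq_trans n0 leq_card_dim. Qed.

Let nR : 0 < n%:R :> R. Proof. by rewrite ltr0n. Qed.

Let W0 : 0 < n%:R * dd%:R :> R. Proof. exact: mulr_gt0. Qed.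

Let S0 : 0 <= S.
Proof. by do 2!(apply: sumr_ge0 => ? _); rewrite mulr_ge0 ?sqr_ge0. Qed.

Lemma sqr_bbar : b ^+ 2 * (n%:R * dd%:R) = S.
Proof. by rewrite sqr_sqrtr ?divfK ?gt_eqF// divr_ge0// ltW. Qed.

Lemma delay_neq0 : 0 < b -> exists i j, delay i j != 0%N.
Proof.
move=> b0; apply: contrapT => h; move: b0; rewrite /bbar big1 ?mul0r ?sqrtr0 ?ltxx//.
move=> i _; rewrite big1// => j _; have [->|dn] := eqVneq (delay i j) 0%N.
  by rewrite expr0n mul0r.
by case: h; exists i, j.
Qed.

Lemma Bmax_gt0 : 0 < b -> (0 < Bmax edge Delta)%N.
Proof.
move=> /delay_neq0[i [j]]; rewrite -lt0n => h; apply: leq_trans h _.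
rewrite /Bmax leq_add2r.
apply: leq_trans (leq_bigmax (F := fun i => \max_j gdist edge i j) i).
exact: (leq_bigmax (F := fun j => gdist edge i j) j).
Qed.

(** B^2 occurs in the sum with weight at least 1, and the sum equals b^2 n d, at most b^2 d^2. *)
Lemma Bmax_le : (Bmax edge Delta)%:R <= b * dd%:R.
Proof.
have [i [j hB]] : exists i j, Bmax edge Delta = delay i j.
  have c0 : (0 < #|'I_n|)%N by rewrite card_ord.
  have [i hi] := @bigop.eq_bigmax _ (fun i : 'I_n => \max_j gdist edge i j)%N c0.
  have [j hj] := @bigop.eq_bigmax _ (fun j : 'I_n => gdist edge i j) c0.
  by exists i, j; rewrite /Bmax hi hj.
have b0 : 0 <= b by exact: sqrtr_ge0.
rewrite -(@ler_pXn2r _ 2)// ?nnegrE//; last by rewrite mulr_ge0// ltW.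
have h1 : (Bmax edge Delta)%:R ^+ 2 <= S.
  rewrite hB (bigD1 i)//= (bigD1 j)//= -addrA; apply: ler_wpDr.
    apply: addr_ge0; first by apply: sumr_ge0 => ? _; rewrite mulr_ge0 ?sqr_ge0.
    by do 2!(apply: sumr_ge0 => ? _); rewrite mulr_ge0 ?sqr_ge0.
  by rewrite ler_peMr ?sqr_ge0// ler1n.
apply: (le_trans h1); rewrite -sqr_bbar exprMn; apply: ler_wpM2l; first exact: sqr_ge0.
by rewrite expr2 ler_pM2r// ler_nat leq_card_dim.
Qed.

(** For each i at least half of the delays are nonzero: all of them if Delta > 0, otherwise n - 1 of
    them with n >= 2. Hence b^2 >= 1/2. The bound lets b + 1/2 be absorbed into a multiple of b. *)
Lemma bbar_ge : 0 < b -> 1 / 2 <= b.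
Proof.
move=> b0; have [i1 [j1 ij]] := delay_neq0 b0.
suff h : n%:R * dd%:R <= 2 * S.
  have : 1 / 2 <= b ^+ 2.
    by rewrite -(@ler_pM2r _ (n%:R * dd%:R))// sqr_bbar; lra.
  rewrite leNgt => /negP hb; rewrite leNgt; apply/negP => h'; apply: hb; nra.
have lowS : \sum_i \sum_(j | delay i j != 0%N) (dim i)%:R <= S.
  apply: ler_sum => i _; rewrite big_mkcond/=; apply: ler_sum => j _.
  case: ifPn => [dn|_]; last by rewrite mulr_ge0 ?sqr_ge0.
  by rewrite ler_peMl// expr_ge1// ler1n lt0n.
apply: (@le_trans _ _ (2 * \sum_i \sum_(j | delay i j != 0%N) (dim i)%:R));
  last by rewrite ler_pM2l.
rewrite natr_sum !mulr_sumr; apply: ler_sum => i _.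
rewrite sumr_const -[_ *+ #|_|]mulr_natl mulrA ler_wpM2r// -natrM ler_nat.
pose A := [pred j | delay i j != 0%N]; suff : (n <= 2 * #|A|)%N by [].
have [D0|D0] := posnP Delta; last first.
  have -> : #|A| = n.
    by rewrite -[RHS]card_ord; apply: eq_card => j; rewrite !inE; lia.
  by lia.
have Ai j : (j \in A) = (j != i).
  by rewrite inE D0 addn0 gdist_eq0 eq_sym.
have cA : (#|A|.+1 = n)%N.
  rewrite (eq_card (B := predC1 i)) ?cardC1 ?card_ord ?prednK//.
have n1 : (1 < n)%N.
  rewrite D0 addn0 gdist_eq0 in ij; rewrite -[n]card_ord; apply/card_gt1P.
  by exists i1, j1.
by lia.
Qed.

End Delays.

(** * From the equalities to the number of iterations *)

Lemma ln_le (R : realType) (y : R) : 0 < y -> ln y <= y - 1.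
Proof.
move=> y0; have := expR_ge1Dx (ln y); rewrite lnK ?posrE//; lra.
Qed.

Lemma sqrt_le_half (R : realType) (y : R) : 0 <= y -> Num.sqrt y <= (1 + y) / 2.
Proof.
move=> y0; rewrite -{2}(sqr_sqrtr y0); have := sqr_ge0 (Num.sqrt y - 1); nra.
Qed.

Lemma star_ratio (R : realType) (D sig b s u eps : R) :
  0 < sig -> 0 < b -> 0 < s -> 0 < u -> 0 < eps ->
  15 * D / (2 * (3 * u ^+ 2 * eps / (8 * sig ^+ 2 * b * s ^+ 2)) * eps) =
  20 * D * sig ^+ 2 * b * s ^+ 2 / (u ^+ 2 * eps ^+ 2).
Proof. by move=> sig0 b0 s0 u0 eps0; field; rewrite !gt_eqF. Qed.

Lemma star_ratio' (R : realType) (D sig b s delta r w eps Kd : R) :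
  0 < delta -> 0 < r -> 0 < w -> 0 < eps -> 0 < Kd ->
  20 * D * sig ^+ 2 * b * s ^+ 2 / ((delta * r / 3) ^+ 2 / w * eps ^+ 2) =
  20 * 9 * D * sig ^+ 2 * Kd / r ^+ 2 * (b * s ^+ 2 * w) / (delta ^+ 2 * eps ^+ 2 * Kd).
Proof. by move=> delta0 r0 w0 eps0 Kd0; field; rewrite !gt_eqF. Qed.

Section Complexity.
Variables (R : realType) (G Rbar rlow sigma Dbar Kd Cd : R).
Hypotheses (G0 : 0 < G) (Rbar0 : 0 < Rbar) (rlow0 : 0 < rlow) (sigma0 : 0 < sigma)
  (Dbar0 : 0 < Dbar) (Kd0 : 0 < Kd) (Cd0 : 0 < Cd).

(** The factor left of 15 Dbar / (2 eta eps) once delta^2 eps^2 Kd has become a power of eps. It is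
    free of n, d and b, as is [C], which makes the final bounds uniform in these. *)
Let K : R := 20 * 9 * Dbar * sigma ^+ 2 * Kd / rlow ^+ 2.
Let C : R := 2 * `|ln (60 * G * Rbar ^+ 2 * Cd / rlow)| + 3.

Let K0 : 0 < K.
Proof.
by rewrite divr_gt0 ?exprn_gt0// mulr_gt0// mulr_gt0 ?exprn_gt0// mulr_gt0.
Qed.

(* The logarithm inside the condition on [u] involves [1/u] itself, so that it is
   first bounded in terms of itself. *)
Lemma log_term_le (n d : nat) (eps u delta v : R) : (0 < n <= d)%N -> 0 < eps < 1 ->
  0 < u -> 0 < delta -> eps <= Cd * delta ->
  v = Num.max 0 (ln (20 * G * Rbar ^+ 2 * Num.sqrt n%:R / (u * eps))) ->
  u * Num.sqrt (d%:R + 4 / 9 * v) = delta * rlow / 3 ->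
  v <= C * (d%:R + ln (1 / eps)).
Proof.
move=> /andP[n0 nd] /andP[e0 e1] u0 dl0 hd vE hu.
have d1 : 1 <= d%:R :> R by rewrite ler1n; exact: leq_trans n0 nd.
have l0 : 0 <= ln (1 / eps) by rewrite ln_ge0// ler_pdivlMr// mul1r ltW.
have C3 : 3 <= C by rewrite lerDr mulr_ge0.
have v0 : 0 <= v by rewrite vE le_max lexx.
have [vl|vl] := leP v 0; first by apply: (le_trans vl); rewrite mulr_ge0//; lra.
set y := 20 * G * Rbar ^+ 2 * _ / _ in vE.
have vy : v = ln y.
  by move: vl; rewrite vE; case: (ltP 0 (ln y)) => h; rewrite ?max_r ?max_l ?ltxx// ltW.
set w := d%:R + 4 / 9 * v in hu.
have w0 : 0 < w by rewrite /w; lra.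
have sw0 : 0 < Num.sqrt w by rewrite sqrtr_gt0.
have sn0 : 0 < Num.sqrt n%:R :> R by rewrite sqrtr_gt0 ltr0n.
pose A : R := 60 * G * Rbar ^+ 2 * Cd / rlow.
have A0 : 0 < A.
  by rewrite divr_gt0// mulr_gt0// mulr_gt0 ?exprn_gt0// mulr_gt0.
have iu : u^-1 = 3 * Num.sqrt w / (delta * rlow).
  have e : delta * rlow = 3 * (u * Num.sqrt w) by rewrite hu; field.
  by rewrite e; field; rewrite !gt_eqF.
(* 1 / u is eliminated by the condition on u, which brings in 1 / delta <= Cd / eps and thus a
   second factor 1 / eps. *)
have yA : y <= A * Num.sqrt n%:R * Num.sqrt w * (1 / eps) * (1 / eps).
  have -> : y = 60 * G * Rbar ^+ 2 / rlow * Num.sqrt n%:R * Num.sqrt w / eps * delta^-1.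
    by rewrite /y invfM iu; field; rewrite !gt_eqF.
  have -> : A * Num.sqrt n%:R * Num.sqrt w * (1 / eps) * (1 / eps) =
    60 * G * Rbar ^+ 2 / rlow * Num.sqrt n%:R * Num.sqrt w / eps * (Cd / eps).
    by rewrite /A; field; rewrite !gt_eqF.
  apply: ler_wpM2l; last first.
    rewrite ler_pdivlMr// mulrC ler_pdivrMr//.
  apply: divr_ge0; last exact: ltW.
  do 2!(apply: mulr_ge0; last exact: ltW).
  apply: divr_ge0; last exact: ltW.
  by apply: mulr_ge0; [apply: mulr_ge0 => //; exact: ltW|exact: sqr_ge0].
have y0 : 0 < y.
  apply: divr_gt0; last exact: mulr_gt0.
  by rewrite mulr_gt0// mulr_gt0 ?exprn_gt0// mulr_gt0.
have ie : 0 < 1 / eps by rewrite divr_gt0.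
have lnyA : ln y <= ln A + ln (Num.sqrt n%:R) + ln (Num.sqrt w) + ln (1 / eps) + ln (1 / eps).
  apply: (@le_trans _ _ (ln (A * Num.sqrt n%:R * Num.sqrt w * (1 / eps) * (1 / eps)))).
    by rewrite ler_ln ?posrE//; do 4!(apply: mulr_gt0 => //).
  have ln5 (a c e g : R) : 0 < a -> 0 < c -> 0 < e -> 0 < g ->
      ln (a * c * e * g * g) = ln a + ln c + ln e + ln g + ln g.
    by move=> a0 c0 e0' g0; rewrite !lnM ?posrE ?mulr_gt0.
  by rewrite ln5.
have h1 : ln A <= `|ln A| by exact: ler_norm.
have h2 : ln (Num.sqrt n%:R) <= d%:R :> R.
  apply: (le_trans (ln_le sn0)); have := @sqrt_le_half R n%:R (ler0n _ _).
  have : n%:R <= d%:R :> R by rewrite ler_nat.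
  lra.
have h3 : ln (Num.sqrt w) <= w / 2.
  by apply: (le_trans (ln_le sw0)); have := sqrt_le_half (ltW w0); lra.
(* ln (sqrt w) <= w / 2 = d / 2 + 2/9 v, and 1 - 2/9 = 7/9 of v remains on the left. *)
have h4 : 7 / 9 * v <= `|ln A| + 3 / 2 * d%:R + 2 * ln (1 / eps).
  by move: lnyA; rewrite -vy /w in h3 *; lra.
have a0 := normr_ge0 (ln A).
have h5 := mulr_ge0 a0 l0; have h6 := ler_peMr a0 d1.
rewrite /C -/A; lra.
Qed.

(** T - B + 1 is the ceiling of a quantity proportional to (b + 1/2) s^2 w, and w is comparable to d
    + ln (1 / eps), from above by [log_term_le]. The 8 comes from b + 1/2 <= 2 b and s^2 <= 4 d; the
    3 from rounding, as 1 <= 2 b d, and from B <= b d. *)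
Lemma complexity_of_star (n d B T p : nat) (b eps u delta eta : R) :
  (0 < n <= d)%N -> (0 < B)%N -> B%:R <= b * d%:R -> 1 / 2 <= b -> 0 < eps < 1 ->
  admissible B T u delta eta -> eps <= Cd * delta ->
  delta ^+ 2 * eps ^+ 2 * Kd = eps ^+ p ->
  delta * rlow / 3 <= 20 * G * Rbar ^+ 2 ->
  star_eq n d B T G Rbar rlow sigma Dbar b eps u delta eta ->
  complexity d T b eps p (4 / 9 * K) (8 * K * (1 + 4 / 9 * C) + 3).
Proof.
move=> nd B0 Bb b12 e01 [eta0 u0 /andP[dl0 dl1] BT] hd hp hs [].
have /andP[e0 e1] := e01; have /andP[n0 nled] := nd.
rewrite /u_lhs /u_rhs /eta_max /T_min; set v := Num.max 0 _ => hu heta hT.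
have d1 : 1 <= d%:R :> R by rewrite ler1n; exact: leq_trans n0 nled.
have l0 : 0 <= ln (1 / eps) by rewrite ln_ge0// ler_pdivlMr// mul1r ltW.
have C3 : 3 <= C by rewrite lerDr mulr_ge0.
have v0 : 0 <= v by rewrite le_max lexx.
have vC : v <= C * (d%:R + ln (1 / eps)) by exact: (log_term_le nd e01 u0 dl0 hd erefl hu).
set w := d%:R + 4 / 9 * v in hu.
have w1 : 1 <= w by rewrite /w; lra.
have sw1 : 1 <= Num.sqrt w by rewrite -[leLHS]sqrtr1; apply: ler_wsqrtr.
have u2 : u ^+ 2 * w = (delta * rlow / 3) ^+ 2.
  by rewrite -hu exprMn sqr_sqrtr//; lra.
(* The condition on u together with [hs] gives u <= 20 G Rbar^2, so the argument of the logarithm is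
   at least 1 / eps. *)
have vl : ln (1 / eps) <= v.
  rewrite /v le_max; apply/orP; right; rewrite ler_ln ?posrE.
  - rewrite invfM mulrA ler_pM2r ?invr_gt0// ler_pdivlMr// mul1r.
    apply: (@le_trans _ _ (u * Num.sqrt w)); first by rewrite ler_peMr// ltW.
    rewrite hu; apply: (le_trans hs); rewrite ler_peMr//.
      by rewrite mulr_ge0 ?sqr_ge0// mulr_ge0// ltW.
    by rewrite -[leLHS]sqrtr1; apply: ler_wsqrtr; rewrite ler1n.
  - by rewrite divr_gt0.
  - rewrite divr_gt0 ?mulr_gt0 ?exprn_gt0// sqrtr_gt0 ltr0n//.
set l := ln (1 / eps) in l0 vC vl.
pose s : R := Num.sqrt d%:R + 1.
have q0 : 0 < Num.sqrt d%:R :> R by rewrite sqrtr_gt0; lra.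
have s2 : d%:R <= s ^+ 2 <= 4 * d%:R.
  have e : Num.sqrt d%:R ^+ 2 = d%:R :> R by rewrite sqr_sqrtr.
  have q1 : 1 <= Num.sqrt d%:R :> R by rewrite -[leLHS]sqrtr1; apply: ler_wsqrtr.
  by rewrite /s; move: (Num.sqrt _) e q0 q1 => q <- q0 q1; apply/andP; split; nra.
have /andP[s21 s22] := s2.
have p0 : 0 < eps ^+ p by rewrite exprn_gt0.
have s0 : 0 < s by rewrite /s; lra.
have b0 : 0 < b + 1 / 2 by lra.
pose Q : R := K * ((b + 1 / 2) * s ^+ 2 * w) / eps ^+ p.
have QE : 15 * Dbar / (2 * eta * eps) = Q.
  have w0 : 0 < w by lra.
  have ue : u ^+ 2 = (delta * rlow / 3) ^+ 2 / w by rewrite -u2 mulfK ?gt_eqF.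
  rewrite heta -/s /Q -hp /K.
  rewrite star_ratio// ue; exact: star_ratio'.
have [N1 N2] : Q <= (T - B + 1)%:R /\ (T - B + 1)%:R < Q + 1.
  have eN : (T - B + 1)%:R = (Num.ceil Q)%:~R :> R.
    by rewrite -QE -hT.
  by rewrite eN ceil_ge; split=> //; have := ceilB1_lt Q; rewrite intrB; lra.
have g0 : 0 <= b * (d%:R ^+ 2 + d%:R * l).
  by rewrite mulr_ge0//; [lra|rewrite addr_ge0 ?sqr_ge0// mulr_ge0].
rewrite /complexity -/l; apply/andP; split.
  apply: (@le_trans _ _ Q).
    rewrite [leLHS](_ : _ = K * (b * d%:R * (4 / 9 * (d%:R + l))) / eps ^+ p); last first.
      by move: (eps ^+ p) K => ep K'; ring.
    rewrite /Q ler_pM2r ?invr_gt0// ler_pM2l//.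
    have h1 : b * d%:R <= (b + 1 / 2) * s ^+ 2 by apply: ler_pM => //; lra.
    have h2 : 4 / 9 * (d%:R + l) <= w by rewrite /w; lra.
    have h3 : 0 <= b * d%:R by rewrite mulr_ge0//; lra.
    have := ler_pM h3 (_ : 0 <= 4 / 9 * (d%:R + l)) h1 h2.
    by rewrite mulr_ge0// ?addr_ge0// => /(_ isT); lra.
  (* Since B >= 1, the number T - B + 1 of averaged profiles is at most T. *)
  apply: (le_trans N1); by rewrite ler_nat addn1 ltn_subrL B0 (leq_trans B0 BT).
have T1 : T%:R <= Q + 1 + B%:R.
  have : (T - B + 1)%:R + B%:R = T%:R + 1 :> R.
    by rewrite -natrD -[X in _ + X]/(1%:R) -natrD; rewrite addnAC subnK.
  lra.
set g := b * _ / _.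
have gd : b * d%:R <= g.
  rewrite /g ler_pdivlMr//.
  have h1 : b * d%:R * eps ^+ p <= b * d%:R.
    by rewrite ler_piMr//; [rewrite mulr_ge0//; lra|rewrite exprn_ile1// ltW].
  have h2 : b * d%:R <= b * d%:R ^+ 2.
    by rewrite ler_pM2l; [rewrite expr2 ler_peMr|lra].
  have : 0 <= b * (d%:R * l) by rewrite mulr_ge0 ?mulr_ge0//; lra.
  lra.
have Qg : Q <= 8 * K * (1 + 4 / 9 * C) * g.
  rewrite [leRHS](_ : _ = K * (2 * b * (4 * d%:R) * ((1 + 4 / 9 * C) * (d%:R + l)))
      / eps ^+ p); last by rewrite /g; move: (eps ^+ p) K C => ep K' C'; ring.
  rewrite /Q ler_pM2r ?invr_gt0// ler_pM2l//; apply: ler_pM.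
  - by rewrite mulr_ge0 ?sqr_ge0// ltW.
  - lra.
  - by apply: ler_pM => //; rewrite ?sqr_ge0//; lra.
  - by rewrite /w; lra.
have h1 : 1 <= 2 * (b * d%:R).
  by have := ler_pM (_ : 0 <= 1 / 2) (_ : 0 <= 1) b12 d1; lra.
lra.
Qed.

End Complexity.

Lemma complexity_weaken (R : realType) (d T p : nat) (b eps c1 c2 c1' c2' : R) :
  0 <= b -> 0 < eps < 1 -> c1' <= c1 -> c2 <= c2' ->
  complexity d T b eps p c1 c2 -> complexity d T b eps p c1' c2'.
Proof.
move=> b0 /andP[e0 e1] h1 h2; rewrite /complexity.
set g := b * _ / _ => /andP[l1 l2].
have g0 : 0 <= g.
  apply: divr_ge0; last by rewrite exprn_ge0// ltW.
  apply: mulr_ge0 => //; apply: addr_ge0; first exact: sqr_ge0.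
  by rewrite mulr_ge0// ln_ge0// ler_pdivlMr// mul1r ltW.
have := ler_wpM2r g0 h1; have := ler_wpM2r g0 h2 => k1 k2.
by rewrite (le_trans k2)// (le_trans l2).
Qed.

Lemma star_eq_rlow (R : realType) (n d B T : nat) (G Rbar rlow sigma Dbar b eps u delta eta : R) :
  (0 < d)%N -> admissible B T u delta eta ->
  star_eq n d B T G Rbar rlow sigma Dbar b eps u delta eta -> 0 < rlow.
Proof.
move=> d0 [_ u0 /andP[dl0 _] _] [hu _ _].
have : 0 < u_rhs rlow delta.
  rewrite -hu mulr_gt0// sqrtr_gt0 ltr_pwDl ?ltr0n//.
  by rewrite mulr_ge0// le_max lexx.
by rewrite /u_rhs pmulr_lgt0// pmulr_rgt0.
Qed.

(* The exponents arise since delta^2 eps^2 is a multiple of eps^4 for the first choice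
   of delta and of eps^3 for the second one. *)
Lemma complexity_constants (R : realType) (G L Rbar rlow sigma Dbar : R) :
  0 < G -> 0 < L -> 0 < sigma ->
  exists c1 c2 eps1 : R, [/\ 0 < c1, 0 < c2, 0 < eps1 &
  forall (n d B T : nat) (b eps eta u delta : R),
    0 < Dbar -> 0 < Rbar -> (0 < n <= d)%N -> (0 < B)%N -> B%:R <= b * d%:R -> 1 / 2 <= b ->
    0 < eps < eps1 -> admissible B T u delta eta ->
    star_eq n d B T G Rbar rlow sigma Dbar b eps u delta eta ->
    (delta = eps / (5 * G * Rbar) -> complexity d T b eps 4 c1 c2) /\
    (delta = Num.sqrt eps / (Rbar * Num.sqrt (2 * L)) -> complexity d T b eps 3 c1 c2)].
Proof.
move=> G0 L0 sigma0.
(* The constants are fixed before the instance is known. If one of these parameters is not positive,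
   the assumptions on the instance are contradictory and arbitrary constants will do. *)
have [[D0 [R0 r0]]|h] := pselect (0 < Dbar /\ 0 < Rbar /\ 0 < rlow); last first.
  exists 1, 1, 1; split => // n d B T b eps eta u delta D0 R0 /andP[n0 nd] _ _ _ _ ad st.
  exfalso; apply: h; split=> //; split=> //.
  exact: star_eq_rlow (leq_trans n0 nd) ad st.
have sL : 0 < Num.sqrt (2 * L) by rewrite sqrtr_gt0 mulr_gt0.
pose Kd1 : R := 5 ^+ 2 * G ^+ 2 * Rbar ^+ 2; pose Cd1 := 5 * G * Rbar.
pose Kd2 : R := 2 * L * Rbar ^+ 2; pose Cd2 := Rbar * Num.sqrt (2 * L).
have Kd10 : 0 < Kd1 by rewrite !mulr_gt0 ?exprn_gt0.
have Cd10 : 0 < Cd1 by rewrite !mulr_gt0.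
have Kd20 : 0 < Kd2 by rewrite !mulr_gt0 ?exprn_gt0.
have Cd20 : 0 < Cd2 by rewrite !mulr_gt0.
have P1 := complexity_of_star G0 R0 r0 sigma0 D0 Kd10 Cd10.
have P2 := complexity_of_star G0 R0 r0 sigma0 D0 Kd20 Cd20.
move: P1 P2.
set a1 := 4 / 9 * _; set a2 := _ + 3; set b1 := 4 / 9 * _; set b2 := _ + 3 => P1 P2.
have pos Kd : 0 < Kd -> 0 < 20 * 9 * Dbar * sigma ^+ 2 * Kd / rlow ^+ 2.
  by move=> k0; rewrite divr_gt0 ?exprn_gt0// mulr_gt0// mulr_gt0 ?exprn_gt0// mulr_gt0.
have a10 : 0 < a1 by rewrite mulr_gt0// pos.
have b10 : 0 < b1 by rewrite mulr_gt0// pos.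
have a20 : 0 < a2.
  by rewrite /a2 ltr_wpDl// mulr_ge0//; rewrite mulr_ge0// ltW// pos.
have c0 : 0 < 20 * G * Rbar ^+ 2 by rewrite !mulr_gt0 ?exprn_gt0.
have A0 : 0 <= rlow / 3 * (Cd1^-1 + Cd2^-1).
  by rewrite mulr_ge0 ?addr_ge0 ?invr_ge0 ?divr_ge0// ltW.
have [e1 e10 he1] := sqrt_small A0 c0.
(* Common constants for both choices of delta; the threshold [e1] ensures that delta rlow / 3 <= 20
   G Rbar^2 in both cases. *)
exists (Num.min a1 b1), (Num.max a2 b2), (Num.min 1 e1); split.
- by rewrite lt_min a10.
- by rewrite lt_max a20.
- by rewrite lt_min ltr01.
move=> n d B T b eps eta u delta _ _ nd B0 Bb b12 /andP[ep0]; rewrite lt_min => /andP[ep1 epe].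
move=> ad st.
have ep01 : 0 < eps < 1 by rewrite ep0.
have b0 : 0 <= b by lra.
set s := Num.sqrt eps.
have s0 : 0 < s by rewrite sqrtr_gt0.
have es : eps = s ^+ 2 by rewrite sqr_sqrtr// ltW.
have s1 : s <= 1 by rewrite -[leRHS]sqrtr1; apply: ler_wsqrtr; exact: ltW.
have ss : eps <= s by rewrite es expr2 ler_piMr// ltW.
have hs : rlow / 3 * (Cd1^-1 + Cd2^-1) * s <= 20 * G * Rbar ^+ 2.
  by apply: he1; rewrite ep0.
have i10 : 0 < Cd1^-1 by rewrite invr_gt0.
have i20 : 0 < Cd2^-1 by rewrite invr_gt0.
have r3 : 0 < rlow / 3 by rewrite divr_gt0.
split=> hd.
- apply: (@complexity_weaken _ _ _ _ _ _ a1 a2) => //; first by rewrite ge_min lexx.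
    by rewrite le_max lexx.
  apply: P1 nd B0 Bb b12 ep01 ad _ _ _ st; rewrite hd.
  + by rewrite mulrC divfK// gt_eqF.
  + by rewrite /Kd1; field; rewrite !gt_eqF.
  + apply: le_trans hs.
    have h1 : eps * Cd1^-1 <= s * Cd1^-1 by rewrite ler_pM2r.
    have h2 := ler_wpM2l (ltW r3) h1; have := mulr_ge0 (ltW r3) (mulr_ge0 (ltW i20) (ltW s0)).
    rewrite -/Cd1; lra.
- apply: (@complexity_weaken _ _ _ _ _ _ b1 b2) => //.
    by rewrite ge_min lexx orbT.
    by rewrite le_max lexx orbT.
  apply: P2 nd B0 Bb b12 ep01 ad _ _ _ st; rewrite hd.
  + by rewrite mulrC divfK// gt_eqF.
  + have e2 : Num.sqrt (2 * L) ^+ 2 = 2 * L by rewrite sqr_sqrtr// mulr_ge0// ltW.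
    rewrite /Kd2; move: (Num.sqrt (2 * L)) sL e2 => q q0 <-; rewrite es.
    by field; rewrite !gt_eqF.
  + apply: le_trans hs; have := mulr_ge0 (ltW r3) (mulr_ge0 (ltW i10) (ltW s0)).
    rewrite -/Cd2 -/s; lra.
Qed.

Theorem theorem2 (R : realType) (G L Rbar rlow sigma Dbar : R)
    (G_gt0 : 0 < G) (L_gt0 : 0 < L) (sigma_gt0 : 0 < sigma) :
  exists c1 c2 eps1 : R, [/\ 0 < c1, 0 < c2, 0 < eps1 &
  forall (n : nat) (dim : 'I_n -> nat)
    (X : forall i, set 'rV[R]_(dim i)) (Ri : 'I_n -> R)
    (f : 'I_n -> profile R dim -> R)
    (edge : rel 'I_n) (Delta : nat)
    (psi : forall i, 'rV[R]_(dim i) -> R)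
    (gpsi : forall i, 'rV[R]_(dim i) -> 'rV[R]_(dim i))
    (xstar : profile R dim),
  constrained_convex_setting X Ri G L f ->
  Rbar = Num.sqrt (\sum_i Ri i ^+ 2) ->
  rlow = min_inradius X ->
  connected_graph edge ->
  mirror_maps X psi gpsi ->
  is_argmin (prod_set X) (avg_cost f) xstar ->
  is_max [set bregman (sum_psi psi) (sum_gpsi gpsi) xstar x
         | x in prod_set X] Dbar ->
  let d := (\sum_i dim i)%N in
  let B := Bmax edge Delta in
  let b := bbar edge R dim Delta in
  let delta1 (eps : R) : R := eps / (5 * G * Rbar) in
  let delta2 (eps : R) : R := Num.sqrt eps / (Rbar * Num.sqrt (2 * L)) in
  [/\ exists2 eps0 : R, 0 < eps0 &
        forall (eps eta u delta : R) (T : nat), 0 < eps < eps0 ->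
          admissible B T u delta eta ->
          delta <= delta1 eps ->
          star_le n d B T G Rbar rlow sigma Dbar b eps u delta eta ->
          zfo_accuracy X f edge Delta sigma psi gpsi xstar eta u delta T eps,
      0 < b ->
        forall (eps eta u delta : R) (T : nat), 0 < eps < eps1 ->
          admissible B T u delta eta ->
          delta = delta1 eps ->
          star_eq n d B T G Rbar rlow sigma Dbar b eps u delta eta ->
          complexity d T b eps 4 c1 c2,
      interior (prod_set X) xstar ->
      exists2 eps0 : R, 0 < eps0 &
        forall (eps eta u delta : R) (T : nat), 0 < eps < eps0 ->
          admissible B T u delta eta ->
          delta <= delta2 eps ->
          star_le n d B T G Rbar rlow sigma Dbar b eps u delta eta ->
          zfo_accuracy X f edge Delta sigma psi gpsi xstar eta u delta T eps &
      interior (prod_set X) xstar -> 0 < b ->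
        forall (eps eta u delta : R) (T : nat), 0 < eps < eps1 ->
          admissible B T u delta eta ->
          delta = delta2 eps ->
          star_eq n d B T G Rbar rlow sigma Dbar b eps u delta eta ->
          complexity d T b eps 3 c1 c2]].
Proof.
have [c1 [c2 [eps1 [c10 c20 eps10 compl]]]] :=
  complexity_constants Rbar rlow Dbar G_gt0 L_gt0 sigma_gt0.
exists c1, c2, eps1; split=> // n dim X Ri f edge Delta psi gpsi xstar setting RbarE rlowE _
  mirror opt DbarP d B b delta1 delta2.
have R0 : 0 < Rbar by rewrite RbarE; exact: (Rb_gt0 setting).
have rR : rlow <= Rbar by rewrite RbarE rlowE; exact: (rlow_le setting).
have [n0 dim0] : (0 < n)%N /\ (forall i, 0 < dim i)%N by case: setting.
have nd : (0 < n <= d)%N by rewrite n0; exact: leq_card_dim.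
have r0 : 0 <= rlow.
  rewrite rlowE; apply: lb_le_inf; first by exists (inradius (X (Ordinal n0))), (Ordinal n0).
  by move=> _ [i _ <-]; exact: inradius_ge0.
have complB : 0 < b -> forall (eps eta u delta : R) (T : nat), 0 < eps < eps1 ->
    admissible B T u delta eta ->
    star_eq n d B T G Rbar rlow sigma Dbar b eps u delta eta ->
    (delta = delta1 eps -> complexity d T b eps 4 c1 c2) /\
    (delta = delta2 eps -> complexity d T b eps 3 c1 c2).
  move=> b0 eps eta u delta T epsP ad st.
  have d0 : (0 < d)%N by case/andP: nd => ? ?; exact: leq_trans n0 _.
  have rl0 := star_eq_rlow d0 ad st.
  have D0 : 0 < Dbar by apply: (Dbar_gt0 setting mirror opt DbarP); rewrite -rlowE.
  apply: (compl n d B T b eps eta u delta D0 R0 nd _ _ _ epsP ad st).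
  - exact: Bmax_gt0 b0.
  - exact: Bmax_le.
  - exact: bbar_ge.
have eR : Rb Ri = Rbar by rewrite RbarE.
have sL : 0 < Num.sqrt (2 * L) by rewrite sqrtr_gt0 mulr_gt0.
split.
- have Cd0 : 0 <= (5 * G * Rbar)^-1 by rewrite invr_ge0 !mulr_ge0 ?ltW.
  have [e e0 he] := accuracy_common edge Delta setting mirror opt DbarP G_gt0 L_gt0
    sigma_gt0 Cd0; rewrite eR -rlowE in he.
  (* Below this threshold L / 2 (eps / (15 G))^2 = L eps^2 / (450 G^2) is at most eps / 36. *)
  have e1 : 0 < 25 / 2 * G ^+ 2 / L by rewrite divr_gt0// mulr_gt0 ?exprn_gt0.
  exists (Num.min (Num.min 1 (25 / 2 * G ^+ 2 / L)) e).
    by rewrite !lt_min ltr01 e1.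
  move=> eps eta u delta T /andP[ep0]; rewrite !lt_min => /andP[/andP[ep1 epG] epe] ad hd st.
  have d01 : 0 < delta < 1 by case: ad.
  have /andP[dl0 dl1] := d01.
  have dR : delta * Rbar <= eps / (5 * G).
    rewrite ler_pdivlMr ?mulr_gt0//.
    by move: hd; rewrite /delta1 ler_pdivlMr ?mulr_gt0//; lra.
  apply: he => //; first by rewrite ep0.
  + apply: (le_trans hd); rewrite /delta1 mulrC ler_wpM2l//.
    have s1 : Num.sqrt eps <= 1 by rewrite -[leRHS]sqrtr1; apply: ler_wsqrtr; exact: ltW.
    by rewrite -{1}(sqr_sqrtr (ltW ep0)) expr2 ler_piMr// sqrtr_ge0.
  + have h1 : delta * rlow / 3 <= eps / (5 * G) / 3.
      rewrite ler_pM2r//; apply: le_trans dR; by rewrite ler_pM2l.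
    have h2 : (delta * rlow / 3) ^+ 2 <= (eps / (5 * G) / 3) ^+ 2.
      rewrite ler_pXn2r// ?nnegrE; first by rewrite divr_ge0// mulr_ge0// ltW.
      by rewrite divr_ge0// divr_ge0 ?mulr_ge0 ?ltW.
    have l2 : 0 <= L / 2 by rewrite divr_ge0// ltW.
    apply: (le_trans (ler_wpM2l l2 h2)).
    move: epG; rewrite ltr_pdivlMr// => epG.
    have G2 : 0 < G ^+ 2 by rewrite exprn_gt0.
    rewrite [leLHS](_ : _ = eps * L * eps / (9 * 50 * G ^+ 2)); last by field; rewrite gt_eqF.
    rewrite ler_pdivrMr ?mulr_gt0//.
    have := ler_wpM2r (ltW ep0) (ltW epG); lra.
  + have := cost_shrink_lip setting opt G_gt0 d01.
    rewrite eR.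
    have := ler_wpM2l (ltW G_gt0) dR.
    rewrite [G * (eps / (5 * G))](_ : _ = eps / 5); last by field; rewrite gt_eqF.
    lra.
- move=> b0 eps eta u delta T epsP ad hd st.
  exact: (complB b0 eps eta u delta T epsP ad st).1.
- move=> int.
  have Cd0 : 0 <= (Rbar * Num.sqrt (2 * L))^-1 by rewrite invr_ge0 mulr_ge0 ?ltW.
  have [e e0 he] := accuracy_common edge Delta setting mirror opt DbarP G_gt0 L_gt0
    sigma_gt0 Cd0; rewrite eR -rlowE in he.
  exists e => // eps eta u delta T epsP ad hd st.
  have /andP[ep0 _] := epsP.
  have d01 : 0 < delta < 1 by case: ad.
  have /andP[dl0 dl1] := d01.
  have dR : (delta * Rbar) ^+ 2 <= eps / (2 * L).
    have h1 : delta * Rbar <= Num.sqrt eps / Num.sqrt (2 * L).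
      rewrite ler_pdivlMr//.
      by move: hd; rewrite /delta2 ler_pdivlMr ?mulr_gt0// mulrA.
    apply: (@le_trans _ _ ((Num.sqrt eps / Num.sqrt (2 * L)) ^+ 2)).
      by rewrite ler_pXn2r// ?nnegrE ?divr_ge0 ?sqrtr_ge0// mulr_ge0// ltW.
    by rewrite expr_div_n !sqr_sqrtr// ?ltW// mulr_gt0.
  have dR2 : L * (delta * Rbar) ^+ 2 <= eps / 2.
    have := ler_wpM2l (ltW L_gt0) dR.
    by rewrite [L * (eps / _)](_ : _ = eps / 2)//; field; rewrite gt_eqF.
  apply: he => //.
  + by rewrite mulrC.
  + have h2 : (delta * rlow) ^+ 2 <= (delta * Rbar) ^+ 2.
      by rewrite ler_pXn2r// ?nnegrE ?mulr_ge0 ?(ltW dl0) ?(ltW R0)// ler_pM2l.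
    have := ler_wpM2l (ltW L_gt0) h2.
    rewrite (_ : (delta * rlow / 3) ^+ 2 = (delta * rlow) ^+ 2 / 9); last by field.
    lra.
  + have := cost_shrink_interior setting opt L_gt0 int d01.
    rewrite eR.
    lra.
- move=> _ b0 eps eta u delta T epsP ad hd st.
  exact: (complB b0 eps eta u delta T epsP ad st).2.
Qed.
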